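(* Let $\mathcal{H}$ be a separable Hilbert space and let $\rho\in\mathfrak{S}(\mathcal{H})$ be a quantum state. The following properties are equivalent: (i) the FA-property holds for the state $\rho$; (ii) there is a positive operator $G$ on $\mathcal{H}$ satisfying $\lim_{\beta\to0^+}\left[\mathrm{Tr}\,e^{-\beta G}\right]^{\beta}=1$ such that $\mathrm{Tr}\,G\rho<+\infty$; (iii) $H(\rho)<+\infty$ and $H(\rho\,\|\,\sigma)<+\infty$ for some state $\sigma\in\mathfrak{S}(\mathcal{H})$ such that $\mathrm{Tr}\,\sigma^q<+\infty$ for all $q>0$ and $\lim_{q\to0^+}\left[\mathrm{Tr}\,\sigma^q\right]^q=1$. Moreover, the equivalent properties (i)-(iii) hold provided that $$\sum_{i=1}^{+\infty}\lambda^{\rho}_i\ln^q i<+\infty\quad\text{for some } q>2.$$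
   Context: A state on $\mathcal{H}$ is a positive trace-class operator with unit trace; $\mathfrak{S}(\mathcal{H})$ is the set of all states. $\{\lambda^{\rho}_i\}_{i\ge1}$ denotes the non-increasing sequence of eigenvalues of $\rho$ counted with multiplicity (the positive eigenvalues, followed by zeros if $\rho$ has finite rank). FA-property: it holds for a state $\rho$ if there is a sequence $\{g_i\}_{i\ge1}$ of nonnegative numbers such that $\sum_{i=1}^{+\infty}\lambda^{\rho}_i g_i<+\infty$ and $\lim_{\beta\to0^+}\left[\sum_{i=1}^{+\infty}e^{-\beta g_i}\right]^{\beta}=1$. A positive operator $G$ on $\mathcal{H}$ is a (possibly unbounded) densely defined positive self-adjoint operator; $\mathrm{Tr}\,G\rho\in[0,+\infty]$ is defined as $\sup_n\mathrm{Tr}\,P_nG\rho$, where $P_n$ is the spectral projector of $G$ corresponding to $[0,n]$. $H(\rho)=-\mathrm{Tr}\,\rho\log\rho\in[0,+\infty]$ is the von Neumann entropy. The quantum relative entropy is $H(\rho\|\sigma)=\sum_i\langle\varphi_i|\rho\log\rho-\rho\log\sigma|\varphi_i\rangle$, where $\{\varphi_i\}$ is an orthonormal basis of eigenvectors of $\rho$, with $H(\rho\|\sigma)=+\infty$ if $\mathrm{supp}\,\rho\not\subseteq\mathrm{supp}\,\sigma$ (the support is the closed span of eigenvectors with positive eigenvalues). $\log$ is the natural logarithm. *)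

(* Defs.v *)
From HB Require Import structures.
From mathcomp Require Import all_boot all_order all_algebra.
From mathcomp Require Import sesquilinear complex.
From mathcomp Require Import all_classical all_reals all_analysis.

Set Implicit Arguments.
Unset Strict Implicit.
Unset Printing Implicit Defensive.

Import Order.TTheory GRing.Theory Num.Theory.
Import numFieldNormedType.Exports.

Local Open Scope classical_set_scope.
Local Open Scope ring_scope.
Local Open Scope complex_scope.

(* Inner products are linear in the first argument and conjugate-linear in the
   second one; the physicist's bracket <x|A|x> is [dot (A x) x].  The order of
   R[i] is the one in which [0 <= z] says that z is real and nonnegative. *)
Definition hilbert (R : realType) (H : completeNormedModType R[i])
    (dot : {dot H for Num.conj}) : Prop :=
  forall x, dot x x = `|x| ^+ 2.

Definition separable_space (T : topologicalType) : Prop :=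
  exists2 D : set T, countable D & dense D.

(* The values of [app] outside [dom] are irrelevant. *)
Record operator (T : Type) := Operator { dom : set T ; app :> T -> T }.

Definition everywhere (T : Type) (A : T -> T) : operator T := Operator setT A.

Section HilbertSpace.
Context (R : realType) (H : completeNormedModType R[i])
  (dot : {dot H for Num.conj}).
Implicit Types (A : H -> H) (G : operator H) (B W : set H) (x y z : H).

Definition span B : set H :=
  [set x | exists n (a : 'I_n -> R[i]) (v : 'I_n -> H),
    (forall i, B (v i)) /\ x = \sum_i a i *: v i].

Definition orthonormal_set B : Prop :=
  forall x y, B x -> B y -> dot x y = (x == y)%:R.

Definition orthonormal_basis W B : Prop :=
  orthonormal_set B /\ closure (span B) = W.

(* Some orthonormal basis of the whole space. *)
Definition hbasis : set H := xget set0 (orthonormal_basis setT).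

(* Unordered sum of terms of any sign.  It is only used when one of the two
   sums on the right is finite. *)
Definition usum B (f : H -> \bar R) : \bar R :=
  (\esum_(e in B) f^\+ e - \esum_(e in B) f^\- e)%E.

(* Trace of the operator with diagonal matrix elements [q e]; being
   \bar R-valued, it is meant for operators whose trace is real or +oo. *)
Definition trace (q : H -> \bar R) : \bar R := usum hbasis q.

Definition expect A x : R := complex.Re (dot (A x) x).

Definition tr A : \bar R := trace (fun e => (expect A e)%:E).

Definition positive_operator G : Prop :=
  [/\ (dom G 0 /\
        (forall (a : R[i]) x y, dom G x -> dom G y ->
          dom G (a *: x + y) /\ G (a *: x + y) = a *: G x + G y)),
      dense (dom G),
      (* G is equal to its adjoint, as a graph *)
      (forall y z, (forall x, dom G x -> dot (G x) y = dot x z) <->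
                   (dom G y /\ G y = z)) &
      (forall x, dom G x -> 0 <= dot (G x) x)].

Definition state (rho : {linear H -> H}) : Prop :=
  [/\ continuous rho, (forall x, 0 <= dot (rho x) x) & tr rho = 1%:E].

Definition orthogonal_projection A : Prop :=
  [/\ linear A, (forall x, A (A x) = A x) &
      (forall x y, dot (A x) y = dot x (A y))].

(* A |-> <x|E(A)|x> *)
Definition scalar_measure (E : set R -> H -> H) x : set R -> \bar R :=
  fun S => (expect (E S) x)%:E.

Definition projection_valued_measure (E : set R -> H -> H) : Prop :=
  [/\ (forall S : set R, measurable S -> orthogonal_projection (E S)),
      E set0 = cst 0, E setT = id &
      forall x, semi_sigma_additive (scalar_measure E x)].

(* G is the integral of t with respect to E(dt) *)
Definition is_spectral_measure G (E : set R -> H -> H) : Prop :=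
  [/\ projection_valued_measure E,
      dom G =
        [set x | (\int[scalar_measure E x]_t (t ^+ 2)%:E < +oo)%E] &
      forall x, dom G x ->
        (expect G x)%:E = (\int[scalar_measure E x]_t t%:E)%E].

(* By the spectral theorem a self-adjoint operator has exactly one spectral
   measure, so the default value 0 is not used for such operators. *)
Definition spectral_measure G : set R -> H -> H :=
  xget (fun _ => cst 0) (is_spectral_measure G).

(* <x|f(G)|x> in the functional calculus of the self-adjoint operator G *)
Definition fexpect G (f : R -> R) x : \bar R :=
  (\int[scalar_measure (spectral_measure G) x]_t (f t)%:E)%E.

(* Tr f(G) *)
Definition ftrace G (f : R -> R) : \bar R := trace (fexpect G f).

(* sup_n Tr (P_n G rho), where P_n is the spectral projector of G for [0, n].
   The bounded operator extending P_n G is written G P_n, the range of P_n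
   being contained in dom G. *)
Definition mean_value G (rho : H -> H) : \bar R :=
  ereal_sup (range (fun n : nat =>
    tr (fun x => G (spectral_measure G `[0, n%:R] (rho x))))).

Definition eigenspace A (c : R) : set H := [set x | A x = c%:C *: x].

Definition supp A : set H :=
  closure (span (\bigcup_(c in [set c : R | 0 < c]) eigenspace A c)).

(* The eigenvalue of index i.+1 in the usual numbering is [l i]; the condition
   counts the multiplicities of the positive eigenvalues only, so that the
   value 0 occurs in [l] exactly when rho has finite rank. *)
Definition is_eigenvalue_seq A (l : nat -> R) : Prop :=
  [/\ nonincreasing_seq l, (forall i, 0 <= l i) &
      forall c : R, 0 < c -> exists2 B : set H,
        orthonormal_basis (eigenspace A c) B &
        ([set i | l i = c] #= B)%card].

Definition eigenvalue_seq A : nat -> R := xget (cst 0) (is_eigenvalue_seq A).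

Definition eigenbasis A : set H :=
  xget set0 [set B | orthonormal_basis setT B /\
                     forall e, B e -> exists c : R, eigenspace A c e].

Definition entropy (rho : H -> H) : \bar R :=
  ftrace (everywhere rho) (fun t => - (t * ln t)).

(* For an eigenvector e of rho of unit norm, <e|rho log sigma|e> is the
   eigenvalue <e|rho|e> times <e|log sigma|e>, a number of [-oo, 0], the
   product being 0 if the eigenvalue is 0.  The convention ln 0 = 0 is harmless:
   when the support condition holds, an eigenvector e with a positive eigenvalue
   is orthogonal to the kernel of sigma. *)
Definition relative_entropy (rho sigma : H -> H) : \bar R :=
  if `[< supp rho `<=` supp sigma >] then
    usum (eigenbasis rho) (fun e =>
      fexpect (everywhere rho) (fun t => t * ln t)%R e
      - (expect rho e)%:E * fexpect (everywhere sigma) (@ln R) e)%E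
  else +oo%E.

Definition FA_property (rho : H -> H) : Prop :=
  exists g : nat -> R,
    [/\ forall i, 0 <= g i,
        (\sum_(0 <= i <oo) (eigenvalue_seq rho i * g i)%:E < +oo)%E &
        (((\sum_(0 <= i <oo) (expR (- b * g i))%:E) `^ b)%E
           @[b --> (0:R)^'+] --> 1%:E)].

End HilbertSpace.

(* Main.v *)
(* All three conditions amount to the same condition on an eigenbasis (b_k) of
   rho with eigenvalues lam_k: there are energies g_k >= 0, for the k with
   lam_k > 0, such that the sum of the lam_k g_k is finite and
   [sum_k e^(-beta g_k)]^beta tends to 1.

   Such energies are extended to the kernel of rho by ln^3 (k + 1), which
   preserves the limit because [sum_k e^(-beta ln^q (k + 1))]^beta tends to 1 for
   q > 2.  The operators G = sum_k g_k |b_k><b_k| and e^(-G) / Tr e^(-G) then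
   satisfy (ii) and (iii).

   In the converse direction G and sigma need not commute with rho.  One takes
   g_k = <b_k|G|b_k>, resp. g_k = - <b_k|log sigma|b_k>; Jensen's inequality for
   the spectral measure at b_k gives e^(-beta g_k) <= <b_k|e^(-beta G)|b_k>, and
   the sum of the right-hand sides is at most Tr e^(-beta G). *)
From HB Require Import structures.
Require Import Defs.
From mathcomp Require Import all_boot all_order all_algebra.
From mathcomp Require Import finmap sesquilinear complex.
From mathcomp Require Import all_classical all_reals all_analysis.
From mathcomp Require Import measurable_realfun ring lra.

Set Implicit Arguments.
Unset Strict Implicit.
Unset Printing Implicit Defensive.
Import Order.TTheory GRing.Theory Num.Theory.
Import numFieldNormedType.Exports.
Local Open Scope classical_set_scope.
Local Open Scope ring_scope.
Local Open Scope complex_scope.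

(** * Inner products *)

(** The definitions select bases, eigenvalue sequences and spectral measures by [xget]: traces run
    over [hbasis], the relative entropy over [eigenbasis], the FA-property over [eigenvalue_seq].
    Much of the work shows that these choices do not matter. For traces, two values are always
    compared through a double series of nonnegative weighted terms |<h_j, b_k>|^2, by Parseval and
    an interchange of sums; for eigenvalues, through the dimensions of eigenspaces. H may have
    finite dimension. Sequences indexed by nat therefore contain zero vectors as padding, and series
    over a basis carry the weight [nrm2 (b k)], which is 0 or 1. A limit T(beta)^beta -> 1 only
    needs an upper bound: one term of the partition function keeps T(beta) above a constant c > 0,
    and c^beta tends to 1. Since b_k need not lie in the domain of G, <b_k|G|b_k> is read as an
    integral for the spectral measure at b_k. In (iii), H(rho) < +oo makes the negative parts of the
    relative entropy summable, so that its finiteness bounds the positive parts. *)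

Section InnerProduct.
Context (R : realType) (H : completeNormedModType R[i])
  (dot : {dot H for Num.conj}).
Implicit Types (x y z : H) (a : R[i]).

(** The inner product is R[i]-valued; its real pieces are split off so that estimates and
    nonnegative series live in R and \bar R. *)
Definition reip x y : R := complex.Re (dot x y).
Definition imip x y : R := complex.Im (dot x y).
Definition nrm2 x : R := reip x x.
Definition sqip x y : R := reip x y ^+ 2 + imip x y ^+ 2.

Lemma dotC x y : dot x y = (dot y x)^*%C.
Proof. by rewrite hermC expr0 mul1r. Qed.
Lemma ripC x y : reip x y = reip y x.
Proof. by rewrite /reip dotC; case: (dot y x). Qed.
Lemma iipC x y : imip x y = - imip y x.
Proof. by rewrite /imip dotC; case: (dot y x). Qed.
Lemma dotDl x y z : dot (x + y) z = dot x z + dot y z.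
Proof. exact: linearDl. Qed.
Lemma dotDr x y z : dot x (y + z) = dot x y + dot x z.
Proof. exact: linearDr. Qed.
Lemma dotZl a x y : dot (a *: x) y = a * dot x y.
Proof. exact: linearZl_LR. Qed.
Lemma dotZr a x y : dot x (a *: y) = a^*%C * dot x y.
Proof. exact: linearZr_LR. Qed.
Lemma dotxx x : dot x x = (nrm2 x)%:C.
Proof. have := dnorm_ge0 dot x. rewrite /nrm2 /reip. 
case: (dot x x) => u v /=. by rewrite lecE /= => /andP[/eqP -> _]. Qed.
Lemma n2_ge0 x : 0 <= nrm2 x.
Proof. by have := dnorm_ge0 dot x; rewrite dotxx lecR. Qed.
Lemma n2_eq0 x : nrm2 x = 0 -> x = 0.
Proof. move=> h; apply/eqP; rewrite -(dnorm_eq0 dot) dotxx h //. Qed.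

Definition cabs2 a : R := complex.Re a ^+ 2 + complex.Im a ^+ 2.

Lemma cabs2_ge0 a : 0 <= cabs2 a.
Proof. by rewrite addr_ge0 // sqr_ge0. Qed.
Lemma cabs2_eq0 a : cabs2 a = 0 -> a = 0.
Proof.
case: a => u v /eqP; rewrite /cabs2 /= paddr_eq0 ?sqr_ge0 //.
by rewrite !expf_eq0 /= => /andP[/eqP -> /eqP ->].
Qed.
Lemma conj_mul a : a^*%C * a = (cabs2 a)%:C.
Proof. by case: a => u v; rewrite /cabs2; simpc => /=; congr (_ +i* _); ring. Qed.
Lemma cabs2M a b : cabs2 (a * b) = cabs2 a * cabs2 b.
Proof. by case: a => u v; case: b => p q; rewrite /cabs2 /=; ring. Qed.
Lemma cabs2J a : cabs2 a^*%C = cabs2 a.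
Proof. by case: a => u v; rewrite /cabs2 /=; ring. Qed.
Lemma cabs2R (c : R) : cabs2 c%:C = c ^+ 2.
Proof. by rewrite /cabs2 /=; ring. Qed.

Lemma sqE x y : sqip x y = cabs2 (dot x y). Proof. by []. Qed.
Lemma sq_ge0 x y : 0 <= sqip x y. Proof. exact: cabs2_ge0. Qed.
Lemma sqC x y : sqip x y = sqip y x.
Proof. by rewrite !sqE dotC cabs2J. Qed.
Lemma dot0l x : dot 0 x = 0. Proof. exact: linear0l. Qed.
Lemma dot0r x : dot x 0 = 0. Proof. exact: linear0r. Qed.
Lemma sq0l x : sqip 0 x = 0. Proof. by rewrite sqE dot0l /cabs2 /=; ring. Qed.
Lemma sq0r x : sqip x 0 = 0. Proof. by rewrite sqC sq0l. Qed.
Lemma n20 : nrm2 0 = 0. Proof. by rewrite /nrm2 /reip dot0l. Qed.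
Lemma rip0l x : reip 0 x = 0.
Proof. by rewrite /reip dot0l. Qed.
Lemma ripDl x y z : reip (x + y) z = reip x z + reip y z.
Proof. by rewrite /reip dotDl raddfD. Qed.
Lemma ripDr x y z : reip x (y + z) = reip x y + reip x z.
Proof. by rewrite /reip dotDr raddfD. Qed.
Lemma ripZl (c : R) x y : reip (c%:C *: x) y = c * reip x y.
Proof. by rewrite /reip dotZl; case: (dot x y) => u v /=; rewrite mul0r subr0. Qed.
Lemma ripZr (c : R) x y : reip x (c%:C *: y) = c * reip x y.
Proof. by rewrite ripC ripZl ripC. Qed.
Lemma ripNl x y : reip (- x) y = - reip x y.
Proof. by rewrite /reip linearNl raddfN. Qed.
Lemma ripNr x y : reip x (- y) = - reip x y.
Proof. by rewrite ripC ripNl ripC. Qed.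
Lemma ripBl x y z : reip (x - y) z = reip x z - reip y z.
Proof. by rewrite ripDl ripNl. Qed.
Lemma ripBr x y z : reip x (y - z) = reip x y - reip x z.
Proof. by rewrite ripDr ripNr. Qed.
Lemma dotBl x y z : dot (x - y) z = dot x z - dot y z.
Proof. exact: linearBl. Qed.
Lemma dotBr x y z : dot x (y - z) = dot x y - dot x z.
Proof. exact: linearBr. Qed.
Lemma iip_rip x y : imip x y = reip x ('i *: y).
Proof. by rewrite /imip /reip dotZr; case: (dot x y) => u v /=; ring. Qed.
Lemma n2D x y : nrm2 (x + y) = nrm2 x + nrm2 y + 2 * reip x y.
Proof. by rewrite /nrm2 !(ripDl, ripDr) (ripC y x); ring. Qed.
Lemma n2B x y : nrm2 (x - y) = nrm2 x + nrm2 y - 2 * reip x y.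
Proof. by rewrite /nrm2 !(ripBl, ripBr) (ripC y x); ring. Qed.
Lemma n2N x : nrm2 (- x) = nrm2 x.
Proof. by rewrite /nrm2 ripNl ripNr opprK. Qed.
Lemma n2BC x y : nrm2 (x - y) = nrm2 (y - x).
Proof. by rewrite -n2N opprB. Qed.
Lemma n2Z a x : nrm2 (a *: x) = cabs2 a * nrm2 x.
Proof.
rewrite /nrm2 /reip dotZl dotZr !dotxx mulrA (mulrC a) conj_mul -rmorphM.
done.
Qed.
Lemma n2D_le x y : nrm2 (x + y) <= 2 * (nrm2 x + nrm2 y).
Proof. by have := n2_ge0 (x - y); rewrite n2B n2D; lra. Qed.
Lemma sqZl a x y : sqip (a *: x) y = cabs2 a * sqip x y.
Proof. by rewrite !sqE dotZl cabs2M. Qed.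
Lemma n2_neq0 x : x != 0 -> 0 < nrm2 x.
Proof. by move=> x0; rewrite lt_neqAle n2_ge0 andbT eq_sym; apply: contra x0 => /eqP/n2_eq0 ->. Qed.

Lemma dot_eq x y : (forall z, dot x z = dot y z) -> x = y.
Proof.
move=> h; apply/eqP; rewrite -subr_eq0; apply/eqP/n2_eq0.
by rewrite /nrm2 /reip dotBl h subrr.
Qed.

Lemma dot_rip_iip x y : dot x y = reip x y +i* imip x y.
Proof. by rewrite /reip /imip; case: (dot x y). Qed.

Definition pos_op (A : H -> H) := forall x, 0 <= dot (A x) x.

Section Positive.
Context (A : {linear H -> H}) (A_pos : pos_op A).

Lemma pos_rip_ge0 x : 0 <= reip (A x) x.
Proof. by have := A_pos x; rewrite /reip; case: (dot _ _) => u v; rewrite lecE /= => /andP[]. Qed.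
Lemma pos_iip x : imip (A x) x = 0.
Proof. by have := A_pos x; rewrite /imip; case: (dot _ _) => u v; rewrite lecE /= => /andP[/eqP ->]. Qed.
Lemma iipDl x y z : imip (x + y) z = imip x z + imip y z.
Proof. by rewrite /imip dotDl raddfD. Qed.
Lemma iipDr x y z : imip x (y + z) = imip x y + imip x z.
Proof. by rewrite /imip dotDr raddfD. Qed.

(** Polarization: the form is real at x, y and x + y, so the imaginary parts of its two cross terms
    cancel. Replacing x by ['i *: x] then gives the symmetry of the real parts, and positivity
    implies symmetry. *)
Lemma pos_iip_sym x y : imip (A x) y = - imip (A y) x.
Proof.
have := pos_iip (x + y); rewrite linearD iipDl !iipDr !pos_iip addr0 add0r.
by move/eqP; rewrite addr_eq0 => /eqP.
Qed.

Lemma pos_rip_sym x y : reip (A x) y = reip (A y) x.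
Proof.
have := pos_iip_sym ('i *: x) y; rewrite linearZ /=.
rewrite /imip /reip dotZl dotZr.
by case: (dot _ _) => u v; case: (dot _ _) => p q /=; lra.
Qed.

Lemma pos_sym x y : dot (A x) y = dot x (A y).
Proof. by rewrite (dotC x) !dot_rip_iip /= pos_rip_sym pos_iip_sym. Qed.

(** The quadratic polynomial t -> <A (x + t y), x + t y> is nonnegative for all real t; evaluating
    it at its minimum gives the inequality. *)
Lemma pos_CSr x y : reip (A x) y ^+ 2 <= reip (A x) x * reip (A y) y.
Proof.
have h t : 0 <= reip (A y) y * t ^+ 2 + (2 * reip (A x) y) * t + reip (A x) x.
  have := pos_rip_ge0 (x + t%:C *: y).
  by rewrite linearD linearZ /= !(ripDl, ripDr, ripZl, ripZr) (pos_rip_sym y x); lra.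
have [q0|q0] := eqVneq (reip (A y) y) 0.
  have [-> |p0] := eqVneq (reip (A x) y) 0; first by rewrite q0 expr0n /= mulr0.
  (* Without a leading coefficient the polynomial is affine in t, and at this t it would take the
     value -1. *)
  exfalso; have := h (- (reip (A x) x + 1) / (2 * reip (A x) y)).
  rewrite q0 mul0r add0r mulrCA divff ?mulr1; last by rewrite mulf_neq0 ?pnatr_eq0.
  lra.
have q1 : 0 < reip (A y) y by rewrite lt_neqAle eq_sym q0 pos_rip_ge0.
have := h (- (reip (A x) y) / reip (A y) y).
have -> : reip (A y) y * (- reip (A x) y / reip (A y) y) ^+ 2 +
  2 * reip (A x) y * (- reip (A x) y / reip (A y) y) + reip (A x) x =
  (reip (A x) x * reip (A y) y - reip (A x) y ^+ 2) / reip (A y) y by field.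
by rewrite pmulr_lge0 ?invr_gt0 // subr_ge0.
Qed.

(** Multiplying y by z = <A x, y> makes the inner product equal to |z|^2, which is real, so the real
    version applies. *)
Lemma pos_CS x y : sqip (A x) y <= reip (A x) x * reip (A y) y.
Proof.
set z := dot (A x) y.
have hz : sqip (A x) y = cabs2 z by [].
have := pos_CSr x (z *: y).
have -> : reip (A x) (z *: y) = cabs2 z by rewrite /reip dotZr -/z conj_mul.
have -> : reip (A (z *: y)) (z *: y) = cabs2 z * reip (A y) y.
  rewrite (linearZ_LR A) /reip dotZl dotZr mulrA (mulrC z) conj_mul.
  by case: (dot _ _) => u v /=; rewrite mul0r subr0.
rewrite hz; have [->|z0] := eqVneq (cabs2 z) 0.
  by move=> _; rewrite mulr_ge0 ?pos_rip_ge0.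
rewrite mulrCA expr2 ler_pM2l // lt_neqAle eq_sym z0; exact: cabs2_ge0.
Qed.

(** Cauchy-Schwarz for the form of A at the pair x, A x gives |A x|^4 <= <A x, x> <A A x, A x> <= <A
    x, x> M |A x|^2. *)
Lemma pos_n2 (M : R) : (forall x, reip (A x) x <= M * nrm2 x) ->
  forall x, nrm2 (A x) <= M * reip (A x) x.
Proof.
move=> hM x; have [->|h0] := eqVneq (A x) 0.
  by rewrite n20 /reip dot0l /= mulr0.
have h1 : 0 < nrm2 (A x) by apply: n2_neq0.
rewrite -(ler_pM2r h1).
have -> : nrm2 (A x) * nrm2 (A x) = sqip (A x) (A x).
  by rewrite sqE dotxx cabs2R expr2.
apply: (le_trans (pos_CS _ _)).
rewrite [leRHS]mulrAC [leRHS]mulrC ler_wpM2l ?pos_rip_ge0 //.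
Qed.

End Positive.

Lemma CS x y : sqip x y <= nrm2 x * nrm2 y.
Proof.
have p : pos_op (@idfun H) by move=> z /=; rewrite dotxx lecR n2_ge0.
exact: (pos_CS p x y).
Qed.
Lemma rip_sq x y : reip x y ^+ 2 <= sqip x y.
Proof. by rewrite /sqip lerDl sqr_ge0. Qed.

End InnerProduct.

(** * Convergence in the norm *)

Section Topology.
Context (R : realType) (H : completeNormedModType R[i])
  (dot : {dot H for Num.conj}).
Local Notation rip := (reip dot).
Local Notation iip := (imip dot).
Local Notation n2 := (nrm2 dot).
Context (dotH : hilbert dot).
Implicit Types (x y z : H) (A D : set H).

(** Stated with the real-valued squared norm, because the norm of H takes values in R[i]. *)
Definition hcvg (u : nat -> H) x := (fun n => n2 (u n - x)) @ \oo --> (0 : R).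

Lemma normE x : `|x| = (Num.sqrt (n2 x))%:C.
Proof.
apply/eqP; rewrite -(@eqrXn2 _ 2%N) // ?lecR ?sqrtr_ge0 //.
by rewrite -dotH dotxx -rmorphXn /= sqr_sqrtr ?n2_ge0.
Qed.

Lemma lt0C (e : R[i]) : 0 < e -> exists2 r : R, 0 < r & e = r%:C.
Proof.
by case: e => r s; rewrite ltcE /= => /andP[/eqP -> r0]; exists r.
Qed.

Lemma ballE x (e : R) y : 0 < e -> ball x e%:C y <-> n2 (x - y) < e ^+ 2.
Proof.
move=> e0; rewrite -ball_normE /ball_ /= normE ltcR.
by rewrite -(@ltr_pXn2r _ 2%N) ?nnegrE ?sqrtr_ge0 ?ltW // sqr_sqrtr ?n2_ge0.
Qed.

Lemma closureP A x :
  closure A x <-> forall e : R, 0 < e -> exists2 y, A y & n2 (x - y) < e.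
Proof.
split=> [cA e e0|h B /nbhs_ballP[e /= /lt0C[r r0 ->] hB]].
  have s0 : 0 < Num.sqrt e by rewrite sqrtr_gt0.
  have [|y [Ay]] := cA (ball x (Num.sqrt e)%:C).
    by apply: nbhsx_ballx; rewrite ltcR.
  move/(ballE _ _ s0); rewrite sqr_sqrtr ?ltW // => h; by exists y.
have [y Ay hy] := h _ (exprn_gt0 2 r0).
by exists y; split => //; apply: hB; apply/ballE.
Qed.

Lemma dense_closure D : dense D <-> closure D = setT.
Proof.
split=> [dD|cD O [x Ox] oO].
  apply/seteqP; split => // x _ B Bx.
  have [y [By Dy]] := dD B^° (ex_intro B^° x Bx) (@open_interior _ B).
  by exists y; split => //; apply: interior_subset.
have cx : closure D x by rewrite cD.
have [|y [Dy Oy]] := cx O; first by move: oO; rewrite openE => /(_ _ Ox).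
by exists y.
Qed.

Lemma dense_approx D : dense D ->
  forall x (e : R), 0 < e -> exists2 y, D y & n2 (x - y) < e.
Proof. by move=> /dense_closure cD x; apply/closureP; rewrite cD. Qed.

Lemma hcomplete (u : nat -> H) :
  (forall e : R, 0 < e ->
    exists N, forall m n, (N <= m)%N -> (N <= n)%N -> n2 (u m - u n) < e) ->
  exists x, hcvg u x.
Proof.
move=> hu.
have cu : cvg (u @ \oo).
  apply: cauchy_cvg; apply/cauchy_ballP => e /= /lt0C[r r0 ->].
  have [N hN] := hu _ (exprn_gt0 2 r0).
  exists (u @` [set n | (N <= n)%N], u @` [set n | (N <= n)%N]) => /=.
    by split; exists N => // n /= Nn; exists n.
  by case=> _ _ /= [[m Nm <-] [n Nn <-]]; apply/ballE => //; apply: hN.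
exists (lim (u @ \oo)).
move/cvg_ballP : cu => cu.
apply/cvgrPdist_lt => e e0.
have s0 : 0 < Num.sqrt e by rewrite sqrtr_gt0.
have := cu (Num.sqrt e)%:C; rewrite ltcR => /(_ s0) h.
near=> n; rewrite sub0r normrN ger0_norm ?n2_ge0 // n2BC.
have : ball (lim (u @ \oo)) (Num.sqrt e)%:C (u n) by near: n; exact: h.
by move/(ballE _ _ s0); rewrite sqr_sqrtr // ltW.
Unshelve. all: by end_near. Qed.

Lemma hcvg_near u x : hcvg u x -> forall e : R, 0 < e ->
  exists N, forall n, (N <= n)%N -> n2 (u n - x) < e.
Proof.
move=> /cvgrPdist_lt h e /h [N _ hN]; exists N => n /hN /=.
by rewrite sub0r normrN ger0_norm ?n2_ge0.
Qed.

Lemma hcvg_unique u x y : hcvg u x -> hcvg u y -> x = y.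
Proof.
move=> hx hy; apply/eqP; rewrite -subr_eq0; apply/eqP/(@n2_eq0 _ _ dot).
apply/eqP; rewrite eq_le n2_ge0 andbT.
apply/ler_addgt0Pl => e e0; rewrite addr0.
have e4 : 0 < e / 4 by rewrite divr_gt0.
have [N hN] := hcvg_near hx e4; have [M hM] := hcvg_near hy e4.
have := hN (maxn N M) (leq_maxl _ _); have := hM (maxn N M) (leq_maxr _ _).
set n := maxn N M => h1 h2.
have -> : x - y = (u n - y) + (- (u n - x)) by rewrite opprB [RHS]addrC addrA subrK.
have := n2D_le dot (u n - y) (- (u n - x)); rewrite n2N; lra.
Qed.

Lemma continuous_bounded (A : {linear H -> H}) : continuous A ->
  exists2 M : R, 0 < M & forall x, n2 (A x) <= M * n2 x.
Proof.
move=> /linear_bounded_continuous /linear_boundedP [e [er h]].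
have [r r0 re] : exists2 r : R, 0 < r & e < r%:C.
  move: er => /complex_realP[k ->]; exists (`|k| + 1); first by rewrite ltr_pwDr.
  by rewrite ltcR (le_lt_trans (ler_norm _)) // ltrDl.
exists (r ^+ 2); first exact: exprn_gt0.
move=> x; have := h _ re x; rewrite !normE -rmorphM lecR /= => hx.
rewrite -[n2 (A x)]sqr_sqrtr ?n2_ge0 // -[n2 x in leRHS]sqr_sqrtr ?n2_ge0 //.
by rewrite -exprMn lerXn2r // nnegrE ?mulr_ge0 ?sqrtr_ge0 // ltW.
Qed.

Lemma bounded_continuous (A : {linear H -> H}) (M : R) :
  (forall x, n2 (A x) <= M * n2 x) -> continuous A.
Proof.
move=> h; apply/linear_bounded_continuous/linear_boundedP.
exists (Num.sqrt M)%:C; split; first by apply/complex_realP; eexists.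
move=> e he x; apply: (@le_trans _ _ ((Num.sqrt M)%:C * `|x|)); last first.
  by rewrite ler_wpM2r // ltW.
rewrite !normE -rmorphM lecR /= -(@ler_pXn2r _ 2%N) ?nnegrE ?mulr_ge0 ?sqrtr_ge0 //.
rewrite exprMn (sqr_sqrtr (n2_ge0 _ (A x))) (sqr_sqrtr (n2_ge0 _ x)).
have [M0|M0] := leP 0 M; first by rewrite sqr_sqrtr // h.
by apply: (le_trans (h x)); rewrite ltr0_sqrtr // expr0n mul0r nmulr_rle0 ?n2_ge0.
Qed.

Lemma hcvg_lin (A : {linear H -> H}) (M : R) :
  (forall x, n2 (A x) <= M * n2 x) -> forall u x, hcvg u x -> hcvg (A \o u) (A x).
Proof.
move=> hM u x ux; apply: (@squeeze_cvgr _ _ _ _ (cst 0) (fun n => M * n2 (u n - x))).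
- by near=> n; rewrite n2_ge0 /= -linearB hM.
- exact: cvg_cst.
- by rewrite -[X in _ --> X](mulr0 M); apply: cvgZr.
Unshelve. all: by end_near. Qed.

Lemma hcvg_rip u x y : hcvg u x -> (fun n => rip (u n) y) @ \oo --> rip x y.
Proof.
move=> ux; apply/cvgrPdist_lt => e e0.
have e1 : 0 < e ^+ 2 / (n2 y + 1) by rewrite divr_gt0 ?exprn_gt0 // ltr_wpDl ?n2_ge0.
have [N hN] := hcvg_near ux e1.
exists N => // n /= /hN h.
rewrite -ripBl -(@ltr_pXn2r _ 2%N) ?nnegrE //; last exact: ltW.
rewrite real_normK ?num_real //.
apply: (le_lt_trans (rip_sq _ _ _)); apply: (le_lt_trans (CS _ _ _)).
rewrite n2BC; move: h; rewrite ltr_pdivlMr ?ltr_wpDl ?n2_ge0 //.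
by apply: le_lt_trans; rewrite ler_wpM2l ?n2_ge0 // lerDl.
Qed.

Lemma hcvg_iip u x y : hcvg u x -> (fun n => iip (u n) y) @ \oo --> iip x y.
Proof.
move=> ux; rewrite iip_rip; under eq_fun do rewrite iip_rip.
exact: hcvg_rip.
Qed.

Lemma hcvg_n2 u x : hcvg u x -> (fun n => n2 (u n)) @ \oo --> n2 x.
Proof.
move=> ux.
have -> : (fun n => n2 (u n)) = (fun n => n2 (u n - x) + (2 * rip (u n) x - n2 x)).
  by apply/funext => n; rewrite n2B; ring.
have {2}-> : n2 x = 0 + (2 * rip x x - n2 x) by rewrite /nrm2; ring.
apply: cvgD; first exact: ux.
apply: cvgB; last exact: cvg_cst.
by apply: cvgM; [exact: cvg_cst|exact: hcvg_rip].
Qed.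

Lemma hcvg_dot0 u x y : hcvg u x -> (forall n, dot (u n) y = 0) -> dot x y = 0.
Proof.
move=> ux h.
have h1 : rip x y = 0.
  have := hcvg_rip (y := y) ux; under eq_fun do rewrite /reip h.
  by move=> /cvg_lim <- //; rewrite lim_cst.
have h2 : iip x y = 0.
  have := hcvg_iip (y := y) ux; under eq_fun do rewrite /imip h.
  by move=> /cvg_lim <- //; rewrite lim_cst.
by rewrite dot_rip_iip h1 h2.
Qed.

Lemma hcvg_closure A u x : (forall n, A (u n)) -> hcvg u x -> closure A x.
Proof.
move=> Au ux; apply/closureP => e /(hcvg_near ux)[N /(_ N (leqnn _))].
by exists (u N) => //; rewrite n2BC.
Qed.

Lemma closure_orth A y : (forall x, A x -> dot x y = 0) ->
  forall x, closure A x -> dot x y = 0.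
Proof.
move=> h x /closureP cx; apply: (@cabs2_eq0 R).
apply/eqP; rewrite eq_le cabs2_ge0 andbT.
apply/ler_addgt0Pl => e e0; rewrite addr0.
have [|z Az hz] := cx (e / (n2 y + 1)).
  by rewrite divr_gt0 // ltr_wpDl ?n2_ge0.
have -> : dot x y = dot (x - z) y by rewrite dotBl (h z) // subr0.
apply: (le_trans (CS _ _ _)); move: hz; rewrite ltr_pdivlMr ?ltr_wpDl ?n2_ge0 //.
move/ltW; apply: le_trans; by rewrite ler_wpM2l ?n2_ge0 // lerDl.
Qed.

End Topology.

(** * Orthonormal sequences *)

Section OrthonormalSequences.
Context (R : realType) (H : completeNormedModType R[i])
  (dot : {dot H for Num.conj}).
Local Notation rip := (reip dot).
Local Notation n2 := (nrm2 dot).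
Local Notation sq := (sqip dot).
Local Notation span := (@Defs.span R H).
Context (dotH : hilbert dot).
Implicit Types (x y z : H) (A B : set H) (b : nat -> H) (c : nat -> R[i]).

(* Zero vectors are allowed, so that nat also indexes finite orthonormal sets. *)
Definition on_seq b := forall i j, dot (b i) (b j) = ((i == j) && (b i != 0))%:R.
Definition total b := forall x, (forall i, dot x (b i) = 0) -> x = 0.
Definition psum c b n : H := \sum_(k < n) c k *: b k.

Section OnSeq.
Context (b : nat -> H) (bON : on_seq b).

Lemma on_n2 k : n2 (b k) = (b k != 0)%:R.
Proof. by rewrite /nrm2 /reip bON eqxx /=; case: (b k != 0). Qed.

Lemma on_neq0 k : b k != 0 -> n2 (b k) = 1.
Proof. by rewrite on_n2 => ->. Qed.

Lemma on_orth i j : i != j -> dot (b i) (b j) = 0.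
Proof. by rewrite bON => /negbTE ->. Qed.

Lemma on_inj i j : b i != 0 -> b i = b j -> i = j.
Proof.
move=> bi0 bij; apply/eqP/negPn/negP => /on_orth h; move: bi0.
by rewrite -(dnorm_eq0 dot) [X in dot _ X]bij h eqxx.
Qed.

(** A coefficient at a padding zero would count in the sum of the |c k|^2 without contributing to
    the vector. *)
Context (c : nat -> R[i]) (hc : forall k, b k = 0 -> c k = 0).

Lemma dot_psum n k : dot (psum c b n) (b k) = if (k < n)%N then c k else 0.
Proof.
elim: n => [|n IH]; first by rewrite /psum big_ord0 dot0l.
rewrite /psum big_ord_recr /= -/(psum c b n) dotDl IH dotZl bON.
have [-> |kn] := eqVneq k n.
  rewrite ltnSn ltnn add0r /=.
  by have [/hc ->|_] := eqVneq (b n) 0; rewrite ?mulr1 ?mulr0.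
by rewrite ltnS [in RHS]leq_eqVlt (negbTE kn) /= mulr0 addr0.
Qed.

Lemma n2_psumB m n : (m <= n)%N ->
  n2 (psum c b n - psum c b m) = \sum_(m <= k < n) cabs2 (c k).
Proof.
move=> /subnK <-; elim: (n - m)%N => [|d IH].
  by rewrite add0n subrr n20 big_geq.
rewrite addSn big_nat_recr ?leq_addl //= -IH.
have -> : psum c b (d + m).+1 = psum c b (d + m) + c (d + m)%N *: b (d + m)%N.
  by rewrite /psum big_ord_recr.
rewrite addrAC [LHS]n2D n2Z -addrA; congr (_ + _).
rewrite [X in _ + X](_ : _ = 0) ?addr0.
  by rewrite on_n2; have [/hc ->|_] := eqVneq (b (d + m)%N) 0;
    rewrite ?mulr1 // mulr0 cabs2R expr0n.
apply/eqP; rewrite mulf_eq0 pnatr_eq0 /= ripC /reip dotZl dotBr.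
rewrite -dotBr dotC dotBl !dot_psum ltnn ltnNge leq_addl.
by rewrite subrr conjc0 mulr0.
Qed.

Lemma n2_psum n : n2 (psum c b n) = \sum_(k < n) cabs2 (c k).
Proof.
have := n2_psumB (leq0n n).
by rewrite {2}/psum big_ord0 subr0 big_mkord.
Qed.

Lemma riesz_fischer : (\sum_(0 <= k <oo) (cabs2 (c k))%:E < +oo)%E ->
  exists2 x, hcvg dot (psum c b) x & forall k, dot x (b k) = c k.
Proof.
move=> hs.
have cs : cvgn (series (fun k => cabs2 (c k))).
  by apply: nnseries_is_cvg => // k; exact: cabs2_ge0.
have [x xc] : exists x, hcvg dot (psum c b) x.
  apply: (hcomplete dotH) => e e0.
  have e2 : 0 < e / 2 by rewrite divr_gt0.
  move/cvgrPdist_lt : cs => /(_ _ e2) [N _ hN]; exists N.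
  suff h m n : (N <= m)%N -> (m <= n)%N -> n2 (psum c b n - psum c b m) < e.
    move=> m n Nm Nn; have [mn|/ltnW nm] := leqP m n; last exact: h.
    by rewrite n2BC; apply: h.
  move=> Nm mn; rewrite n2_psumB // -sub_series_geq //.
  have h1 := hN _ Nm; have h2 := hN _ (leq_trans Nm mn); rewrite /= in h1 h2.
  move: h1 h2; set l := limn _; rewrite !ltr_norml => /andP[h1 h2] /andP[h3 h4].
  lra.
exists x => // k.
apply/eqP; rewrite -subr_eq0; apply/eqP.
pose y := c k *: b k.
have yk : dot y (b k) = c k.
  rewrite dotZl bON eqxx /=.
  by have [/hc ->|_] := eqVneq (b k) 0; rewrite ?mulr1 ?mulr0.
rewrite -yk -dotBl.
(* After the shift by [k.+1] every partial sum contains the term of index k, so its inner product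
   with [b k] is exactly [c k]. *)
have h : hcvg dot (fun n => psum c b (n + k.+1) - y) (x - y).
  rewrite /hcvg; under eq_fun do rewrite opprB addrA subrK.
  by move: xc; rewrite /hcvg -(cvg_shiftn k.+1).
apply: (hcvg_dot0 h) => n.
by rewrite dotBl yk dot_psum addnS ltnS leq_addl subrr.
Qed.
End OnSeq.

Section Expansion.
Context (b : nat -> H) (bON : on_seq b).

Lemma dot_b0 x k : b k = 0 -> dot x (b k) = 0.
Proof. by move=> ->; exact: dot0r. Qed.

Lemma bessel_sum x n : \sum_(k < n) sq x (b k) <= n2 x.
Proof.
set p := psum (fun k => dot x (b k)) b n.
have hp : rip x p = n2 p.
  rewrite /p (n2_psum bON) ?/psum; last exact: dot_b0.
  elim: n {p} => [|n IH]; first by rewrite !big_ord0 /reip dot0r.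
  rewrite !big_ord_recr /= ripDr IH; congr (_ + _).
  by rewrite /reip dotZr conj_mul.
have := n2_ge0 dot (x - p); rewrite n2B hp (n2_psum bON); last exact: dot_b0.
by under eq_bigr do rewrite -sqE; lra.
Qed.

Lemma bessel x : (\sum_(0 <= k <oo) (sq x (b k))%:E <= (n2 x)%:E)%E.
Proof.
apply: lime_le; first by apply: is_cvg_nneseries => n _ _; rewrite lee_fin sq_ge0.
by apply: nearW => n; rewrite sumEFin lee_fin big_mkord bessel_sum.
Qed.

Lemma projection x : exists2 p, hcvg dot (psum (fun k => dot x (b k)) b) p &
  forall k, dot (x - p) (b k) = 0.
Proof.
have [||p hp hk] := riesz_fischer bON (c := fun k => dot x (b k)).
- exact: dot_b0.
- by apply: (le_lt_trans (bessel x)); rewrite ltry.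
by exists p => // k; rewrite dotBl hk subrr.
Qed.

Hypothesis (btot : total b).

Lemma expansion x : hcvg dot (psum (fun k => dot x (b k)) b) x.
Proof.
have [p hp /btot/eqP] := projection x.
by rewrite subr_eq0 => /eqP {2}->.
Qed.

Lemma EFin_series (u : nat -> R) l : series u @ \oo --> l ->
  (\sum_(0 <= k <oo) (u k)%:E)%E = l%:E.
Proof.
move=> ul; apply/cvg_lim => //; apply: (@cvg_EFin _ _ _ _ _ l).
  by apply: nearW => n; rewrite sumEFin.
by under eq_fun do rewrite /= sumEFin.
Qed.

Lemma parseval x : (\sum_(0 <= k <oo) (sq x (b k))%:E)%E = (n2 x)%:E.
Proof.
apply: EFin_series; have := hcvg_n2 (expansion x).
by under eq_fun do rewrite (n2_psum bON (dot_b0 x)) -(big_mkord xpredT (fun k => sq x (b k))).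
Qed.

(** The terms have no sign, so this form of Parseval's identity is a limit in R and not a series in
    \bar R. *)
Lemma rip_expansion x y :
  series (fun k => complex.Re (dot x (b k) * dot (b k) y)) @ \oo --> rip x y.
Proof.
have := hcvg_rip (y := y) (expansion x).
rewrite (_ : (fun n => rip _ y) = series (fun k => complex.Re (dot x (b k) * dot (b k) y))) //.
apply/funext => n; rewrite seriesEord /psum /=.
elim: n => [|n IH]; first by rewrite !big_ord0 /reip dot0l.
by rewrite !big_ord_recr /= ripDl IH /reip dotZl.
Qed.

Lemma on_ext x y : (forall k, dot x (b k) = dot y (b k)) -> x = y.
Proof.
by move=> h; apply/eqP; rewrite -subr_eq0; apply/eqP/btot => k; rewrite dotBl h subrr.
Qed.

End Expansion.

Lemma span0 B : span B 0.
Proof.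
by exists 0%N, (fun=> 0), (fun=> 0); split; [case|rewrite big_ord0].
Qed.

Lemma spanDZ B (a : R[i]) x v : span B x -> B v -> span B (x + a *: v).
Proof.
move=> [n [a' [v' [hv ->]]]] Bv.
exists n.+1, (fun i => oapp a' a (unlift ord_max i)),
  (fun i => oapp v' v (unlift ord_max i)).
split; first by move=> i; case: unliftP => [j|] _ //=.
rewrite big_ord_recr /= unlift_none /=; congr (_ + _).
apply: eq_bigr => i _.
by have -> : widen_ord (leqnSn n) i = lift ord_max i;
  [apply: val_inj; rewrite /= /bump leqNgt ltn_ord|rewrite liftK].
Qed.

Lemma span_psum B b c n : (forall k, b k = 0 \/ B (b k)) -> span B (psum c b n).
Proof.
move=> h; rewrite /psum; elim: n => [|n IH]; first by rewrite big_ord0; exact: span0.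
rewrite big_ord_recr /=; have [->|Bb] := h n; first by rewrite scaler0 addr0.
exact: spanDZ.
Qed.

Lemma sub_span B v : B v -> span B v.
Proof. by move=> Bv; rewrite -[v]add0r -[v]scale1r; apply: spanDZ => //; exact: span0. Qed.

Lemma span_orth B y : (forall x, B x -> dot x y = 0) ->
  forall x, span B x -> dot x y = 0.
Proof.
move=> h _ [n [a [v [Bv ->]]]]; rewrite linear_sumlz big1 // => i _.
by rewrite -[LHS]/(dot (a i *: v i) y) dotZl h ?mulr0.
Qed.

Lemma closure_span_orth B y : (forall x, B x -> dot x y = 0) ->
  forall x, closure (span B) x -> dot x y = 0.
Proof. by move=> /span_orth; exact: closure_orth. Qed.

(** The residual x - p of the projection is orthogonal to all [b k], hence to x by hypothesis and to
    p as a limit of their combinations; so it is orthogonal to itself. *)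
Lemma in_closure_span B b x : on_seq b -> (forall k, b k = 0 \/ B (b k)) ->
  (forall y, (forall k, dot y (b k) = 0) -> dot y x = 0) -> closure (span B) x.
Proof.
move=> bON bB hx; have [p hp hk] := projection bON x.
suff -> : x = p by apply: (hcvg_closure dotH _ hp) => n; exact: span_psum.
apply/eqP; rewrite -subr_eq0; apply/eqP/(@n2_eq0 _ _ dot).
rewrite /nrm2 ripBr {1}/reip hx // sub0r /reip.
have -> : dot (x - p) p = 0; last by rewrite oppr0.
rewrite dotC (hcvg_dot0 hp) ?conjc0 // => n.
apply: (@span_orth (range b)); last by apply: span_psum => k; right; exists k.
by move=> _ [k _ <-]; rewrite dotC hk conjc0.
Qed.

End OrthonormalSequences.

(** * Orthonormal sets as sequences *)

Section Enumeration.
Context (R : realType) (H : completeNormedModType R[i])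
  (dot : {dot H for Num.conj}).
Local Notation n2 := (nrm2 dot).
Local Notation span := (@Defs.span R H).
Context (dotH : hilbert dot) (Hsep : separable_space H).
Implicit Types (x y z : H) (B W : set H) (b : nat -> H).

Definition enumerates b B :=
  on_seq dot b /\ forall x, B x <-> x != 0 /\ exists k, b k = x.

Lemma orthonormal_n2 B x : orthonormal_set dot B -> B x -> n2 x = 1.
Proof. by move=> hB Bx; rewrite /nrm2 /reip hB // eqxx. Qed.

Lemma n2_1_neq0 x : n2 x = 1 -> x != 0.
Proof. by move=> h; apply/eqP => x0; move: h; rewrite x0 n20 => /esym/eqP; rewrite oner_eq0. Qed.

(** Distinct elements have squared distance 2, while two vectors sharing an approximant in D are
    closer than that. Choosing an approximant in D is therefore injective. *)
Lemma orthonormal_countable B : orthonormal_set dot B -> countable B.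
Proof.
move=> hB; have [D /countable_injP[f finj] dD] := Hsep.
have e2 : 0 < 2^-1 :> R by rewrite invr_gt0.
have /choice[d hd] : forall x, exists y, D y /\ n2 (x - y) < 2^-1.
  by move=> x; have [y Dy hy] := dense_approx dotH dD x e2; exists y.
apply/countable_injP; exists (f \o d) => x y /set_mem Bx /set_mem By /= fxy.
have dxy : d x = d y.
  by apply: finj => //; apply/mem_set; [case: (hd x)|case: (hd y)].
apply/eqP/negPn/negP => xy.
have h2 : n2 (x - y) = 2.
  by rewrite n2B (orthonormal_n2 hB Bx) (orthonormal_n2 hB By) /reip hB // (negbTE xy) /= mulr0 subr0.
have [_ h3] := hd x; have [_ h4] := hd y.
have := n2D_le dot (x - d x) (d x - y).
rewrite addrA subrK h2 (n2BC _ (d x)) {2}dxy; lra.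
Qed.

Lemma ex_enum B : orthonormal_set dot B -> exists b, enumerates b B.
Proof.
move=> hB; have /countable_injP[f finj] := orthonormal_countable hB.
(* The inverse of the injection f; indices outside its image receive the padding value 0. *)
pose b k := xget 0 [set x | B x /\ f x = k].
have bP k : b k = 0 \/ B (b k) /\ f (b k) = k.
  by rewrite /b; case: xgetP => [x -> //|]; [right|left].
have bf x : B x -> b (f x) = x.
  move=> Bx; rewrite /b; case: xgetP => [y _ [By fy]|/(_ x)[]] //.
  by apply: finj => //; apply/mem_set.
exists b; split; last first.
  move=> x; split=> [Bx|[x0 [k bk]]].
    split; last by exists (f x); exact: bf.
    exact: n2_1_neq0 (orthonormal_n2 hB Bx).
  by rewrite -bk in x0 *; have [bk0|[]//] := bP k; rewrite bk0 eqxx in x0.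
have bP0 i : B (b i) -> b i != 0 by move=> /(orthonormal_n2 hB)/n2_1_neq0.
move=> i j; have [bi0|[Bi fi]] := bP i; first by rewrite bi0 dot0l eqxx andbF.
rewrite (bP0 i) // andbT.
have [bj0|[Bj fj]] := bP j.
  rewrite bj0 dot0r; case: eqVneq => // ij.
  by have := bP0 i Bi; rewrite ij bj0 eqxx.
rewrite hB //; have [-> |ij] := eqVneq i j; first by rewrite eqxx.
case: eqVneq => // bij; case/eqP: ij.
by rewrite -fi bij fj.
Qed.

Lemma enumerates_in b B k : enumerates b B -> b k = 0 \/ B (b k).
Proof.
move=> [_ h]; have [->|b0] := eqVneq (b k) 0; [by left|right].
by apply/h; split => //; exists k.
Qed.

Lemma enumerates_total b B : orthonormal_basis dot setT B -> enumerates b B ->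
  total dot b.
Proof.
move=> [hB cB] [hb eb] x hx; apply: (@n2_eq0 _ _ dot).
have : closure (span B) x by rewrite cB.
move=> /(closure_span_orth dotH) h; rewrite /nrm2 /reip h // => y /eb[_ [k <-]].
by rewrite dotC hx conjc0.
Qed.

Lemma orthonormal_total B : orthonormal_set dot B ->
  (forall x, (forall y, B y -> dot x y = 0) -> x = 0) ->
  orthonormal_basis dot setT B.
Proof.
move=> hB h; split=> //; apply/seteqP; split => // x _.
have [b eb] := ex_enum hB.
apply: (in_closure_span dotH eb.1) => [k|y hy]; first exact: enumerates_in eb.
rewrite (h y) ?dot0l // => z /eb.2[_ [k <-]]; exact: hy.
Qed.

(** The condition [f 0 = 0] makes the padding harmless; this is how unordered sums over a basis
    become series. *)
Lemma esum_enum b B (f : H -> \bar R) : enumerates b B ->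
  (forall x, (0 <= f x)%E) -> f 0 = 0%E ->
  (\esum_(e in B) f e = \sum_(0 <= k <oo) f (b k))%E.
Proof.
move=> [hb eb] f_ge0 f0.
have -> : B = [set b k | k in (fun k => b k != 0)].
  apply/seteqP; split=> [x /eb[x0 [k bk]]|_ [k bk <-]].
    by exists k => //; rewrite bk.
  by apply/eb; split => //; exists k.
rewrite (esum_pred_image _ _ (fun k => b k != 0)) //.
  rewrite eseries_mkcond; apply: eq_eseriesr => k _.
  by case: eqVneq => // ->.
by move=> i j /set_mem /= bi _ bij; exact: on_inj bij.
Qed.

Lemma orthonormal_basis_enum B : orthonormal_basis dot setT B ->
  exists b, enumerates b B /\ total dot b.
Proof.
move=> hB; have [b eb] := ex_enum hB.1.
by exists b; split => //; exact: enumerates_total eb.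
Qed.

End Enumeration.

(** * The spectral theorem for positive operators of finite trace *)

Section Eigenvector.
Context (R : realType) (H : completeNormedModType R[i])
  (dot : {dot H for Num.conj}).
Local Notation rip := (reip dot).
Local Notation n2 := (nrm2 dot).
Local Notation sq := (sqip dot).
Local Notation positive := (pos_op dot).
Context (dotH : hilbert dot) (h : nat -> H) (hON : on_seq dot h) (htot : total dot h).
Implicit Types (x y z : H).

Section Contraction.
Context (T : {linear H -> H}) (Tpos : positive T)
  (T1 : forall x, n2 (T x) <= n2 x)
  (Tsup : forall e, e < 1 -> exists2 x, n2 x <= 1 & e < n2 (T x))
  (Ttr : (\sum_(0 <= k <oo) (rip (T (h k)) (h k))%:E < +oo)%E).

Lemma iter_dot k l x y : dot (iter k T x) (iter l T y) = dot (iter (k + l) T x) y.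
Proof.
elim: l k => [|l IH] k; first by rewrite addn0.
by rewrite iterS -(pos_sym Tpos) -iterS IH addSnnS.
Qed.

Lemma n2_iter_le k l x : (k <= l)%N -> n2 (iter l T x) <= n2 (iter k T x).
Proof.
move=> /subnK <-; elim: (l - k)%N => [|d IH] //.
by rewrite addSn iterS; apply: le_trans IH.
Qed.

(** The powers of T also have norm 1. For |x| <= 1, |T^p x|^2 = <T^(2p) x, x> <= |T^(2p) x|, so
    doubling the exponent squares the lower bound for [n2]; and ((1 + e) / 2)^2 >= e. *)
Lemma iter_sup j e : 0 <= e -> e < 1 ->
  exists2 x, n2 x <= 1 & e < n2 (iter (2 ^ j) T x).
Proof.
elim: j e => [|j IH] e e0 e1; first by have [x] := Tsup e1; exists x.
have h0 : 0 <= (1 + e) / 2 by lra.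
have h1 : (1 + e) / 2 < 1 by lra.
have [x x1 hx] := IH _ h0 h1.
exists x => //; set p := (2 ^ j)%N in hx *.
have -> : (2 ^ j.+1 = p + p)%N by rewrite expnS mul2n addnn.
have h2 : n2 (iter p T x) ^+ 2 <= n2 (iter (p + p) T x).
  have -> : n2 (iter p T x) = rip (iter (p + p) T x) x by rewrite /nrm2 /reip iter_dot.
  apply: (le_trans (rip_sq _ _ _)); apply: (le_trans (CS _ _ _)).
  by rewrite ler_piMr ?n2_ge0.
apply: lt_le_trans h2; nra.
Qed.

(** The operator norm is at most the Hilbert-Schmidt norm: by symmetry the coefficients of T^p x are
    the <x, T^p h_k>. *)
Lemma hs_ge p x : n2 x <= 1 ->
  ((n2 (iter p T x))%:E <= \sum_(0 <= k <oo) (n2 (iter p T (h k)))%:E)%E.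
Proof.
move=> x1; rewrite -(parseval dotH hON htot).
apply: lee_nneseries => [k _ _|k _]; rewrite lee_fin ?sq_ge0 //.
have -> : sq (iter p T x) (h k) = sq x (iter p T (h k)).
  rewrite !sqE; congr (cabs2 _).
  by have := iter_dot p 0 x (h k); have := iter_dot 0 p x (h k); rewrite addn0 add0n => /= -> ->.
by apply: (le_trans (CS _ _ _)); rewrite ler_piMl ?n2_ge0.
Qed.

(** A bound uniform in p. The previous bounds are available for the exponents 2^p >= p, and the
    norms decrease with the exponent. *)
Lemma hs_ge_half p : ((2^-1)%:E <= \sum_(0 <= k <oo) (n2 (iter p T (h k)))%:E)%E.
Proof.
have h0 : 0 <= 2^-1 :> R by rewrite invr_ge0.
have h1 : 2^-1 < 1 :> R by rewrite invf_lt1 ?ltr1n.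
have [x x1 hx] := @iter_sup p _ h0 h1.
apply: (@le_trans _ _ (n2 (iter (2 ^ p) T x))%:E); first by rewrite lee_fin ltW.
apply: (@le_trans _ _ (n2 (iter p T x))%:E); last exact: hs_ge.
by rewrite lee_fin n2_iter_le // ltnW // ltn_expl.
Qed.

Lemma contraction_rip x : rip (T x) x <= n2 x.
Proof.
rewrite -(@ler_pXn2r _ 2%N) ?nnegrE ?n2_ge0 ?(pos_rip_ge0 Tpos) //.
apply: (le_trans (rip_sq _ _ _)); apply: (le_trans (CS _ _ _)).
by rewrite expr2 ler_wpM2r ?n2_ge0.
Qed.

Lemma hs_fin : (\sum_(0 <= k <oo) (n2 (T (h k)))%:E < +oo)%E.
Proof.
apply: le_lt_trans Ttr; apply: lee_nneseries => [k _ _|k _]; rewrite lee_fin ?n2_ge0 //.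
rewrite -[leRHS]mul1r; apply: (pos_n2 Tpos) => x.
by rewrite mul1r contraction_rip.
Qed.

(** Dominated convergence by hand: if every T^p h_k tended to 0, the first N terms of the
    Hilbert-Schmidt sum would drop below 1/8, while the tail stays below 1/4 for all p >= 1 because
    its terms decrease in p. The sum would be less than 1/2. *)
Lemma iter_not_cvg0 : exists k, ~ ((fun p => n2 (iter p T (h k))) @ \oo --> (0 : R)).
Proof.
apply: contrapT => /forallNP hn.
have hc k : (fun p => n2 (iter p T (h k))) @ \oo --> (0 : R) by apply: contrapT.
have e4 : 0 < 4^-1 :> R by rewrite invr_gt0.
have [N hN] : exists N, (\sum_(N <= k <oo) (n2 (T (h k)))%:E <= (4^-1)%:E)%E.
  have := nneseries_tail_cvg hs_fin (fun k _ => n2_ge0 dot (T (h k))).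
  move=> /fine_cvgP[fin /cvgr_le/(_ _ e4) le4].
  near \oo => N; exists N; rewrite -[leLHS]fineK; first by rewrite lee_fin; near: N.
  by near: N.
have hfin : (fun p => \sum_(0 <= k < N) n2 (iter p T (h k))) @ \oo --> (0 : R).
  elim: (N) => [|n IH].
    by under eq_fun do rewrite big_geq //; exact: cvg_cst.
  rewrite (_ : (fun p => _) = (fun p => \sum_(0 <= k < n) n2 (iter p T (h k))) +
    (fun p => n2 (iter p T (h n)))); last by apply/funext => p; rewrite big_nat_recr.
  suff : (fun p => \sum_(0 <= k < n) n2 (iter p T (h k))) +
    (fun p => n2 (iter p T (h n))) @ \oo --> (0 + 0 : R) by rewrite addr0.
  exact: cvgD.
have e8 : 0 < 8^-1 :> R by rewrite invr_gt0.
have /cvgr_le/(_ _ e8)[P _ hP] := hfin.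
have := hs_ge_half P.+1.
rewrite (@nneseries_split _ _ 0 N); last by move=> k _; rewrite lee_fin n2_ge0.
rewrite add0n sumEFin leNgt => /negP; apply.
apply: (@le_lt_trans _ _ ((8^-1)%:E + (4^-1)%:E)%E); last by rewrite -EFinD lte_fin; lra.
apply: leeD; first by rewrite lee_fin; apply: hP; exact: leqnSn.
apply: le_trans hN; apply: lee_nneseries => [k _ _|k _]; rewrite lee_fin ?n2_ge0 //.
exact: (@n2_iter_le 1 P.+1).
Unshelve. all: by end_near. Qed.

(* ||T^p x||^2 decreases to a limit that is positive for some x, hence T^(2p) x
   is a Cauchy sequence; its limit v satisfies T (T v) = v, and T v + v is fixed. *)
Lemma contraction_eigenvector : exists2 w, w != 0 & T w = w.
Proof.
have [k hk] := iter_not_cvg0; set x := h k in hk.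
pose a p := n2 (iter p T x).
have ac : cvgn a.
  apply: nonincreasing_is_cvgn; first by move=> p q; exact: n2_iter_le.
  by exists 0 => _ [p _ <-]; exact: n2_ge0.
have ale p : limn a <= a p.
  by apply: nonincreasing_cvgn_ge => // p' q'; exact: n2_iter_le.
have a0 : 0 < limn a.
  rewrite lt_neqAle; apply/andP; split.
    by apply/eqP => a0; apply: hk; rewrite a0.
  by apply: limr_ge => //; apply: nearW => p; exact: n2_ge0.
have [v hv] : exists v, hcvg dot (fun p => iter p.*2 T x) v.
  apply: (hcomplete dotH) => e e0.
  have e2 : 0 < e / 2 by rewrite divr_gt0.
  move/cvgrPdist_lt : ac => /(_ _ e2) [N _ hN]; exists N => p q Np Nq.
  (* The squared distance is [a p.*2 + a q.*2 - 2 * a (p + q)]: the first two terms are close to the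
     limit of a, and [a (p + q)] is at least that limit. *)
  rewrite n2B /reip iter_dot.
  have -> : dot (iter (p.*2 + q.*2) T x) x = dot (iter (p + q) T x) (iter (p + q) T x).
    by rewrite iter_dot addnn doubleD.
  have hp := hN p.*2; have hq := hN q.*2; have hpq := ale (p + q)%N.
  have {}hp : a p.*2 < limn a + e / 2.
    have /hp : (N <= p.*2)%N by rewrite -addnn (leq_trans Np) // leq_addr.
    by rewrite /= ltr_norml => /andP[]; lra.
  have {}hq : a q.*2 < limn a + e / 2.
    have /hq : (N <= q.*2)%N by rewrite -addnn (leq_trans Nq) // leq_addr.
    by rewrite /= ltr_norml => /andP[]; lra.
  rewrite -[complex.Re _]/(a (p + q)%N) -!/(a _); lra.
have v0 : v != 0.
  apply: contraTneq a0 => v0; rewrite -leNgt.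
  have := hcvg_n2 hv; rewrite v0 n20 => h0.
  rewrite -(cvg_lim _ h0) //; apply: limr_ge; first exact: cvgP h0.
  by apply: nearW => p; exact: ale.
have T1' x' : n2 (T x') <= 1 * n2 x' by rewrite mul1r.
have TTv : T (T v) = v.
  apply: (@hcvg_unique _ _ dot (fun p => iter p.+1.*2 T x)).
    exact: (hcvg_lin T1' (hcvg_lin T1' hv)).
  by rewrite /hcvg -(cvg_shiftS (fun p => n2 (iter p.*2 T x - v))) in hv.
exists (T v + v); last by rewrite linearD TTv addrC.
apply/eqP => /eqP; rewrite addr_eq0 => /eqP Tv.
have := pos_rip_ge0 Tpos v; rewrite Tv ripNl oppr_ge0 leNgt.
by rewrite (n2_neq0 dot v0).
Qed.

End Contraction.
End Eigenvector.

Section SpectralTheorem.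
Context (R : realType) (H : completeNormedModType R[i])
  (dot : {dot H for Num.conj}).
Local Notation rip := (reip dot).
Local Notation n2 := (nrm2 dot).
Local Notation sq := (sqip dot).
Local Notation positive := (pos_op dot).
Context (dotH : hilbert dot) (h : nat -> H) (hON : on_seq dot h) (htot : total dot h).
Implicit Types (x y z : H) (A : {linear H -> H}).

Definition traceable (A : H -> H) :=
  [/\ positive A, exists M : R, forall x, n2 (A x) <= M * n2 x &
      (\sum_(0 <= k <oo) (rip (A (h k)) (h k))%:E < +oo)%E].

Lemma dot_mulC x y : dot x y * dot y x = (sq x y)%:C.
Proof. by rewrite (dotC dot y) mulrC conj_mul sqE. Qed.

Lemma unit_normalize x : x != 0 -> n2 ((Num.sqrt (n2 x))^-1%:C *: x) = 1.
Proof.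
move=> /(n2_neq0 dot) x0.
by rewrite n2Z cabs2R exprVn sqr_sqrtr ?n2_ge0 // mulVf // gt_eqF.
Qed.

(** Dividing A by its operator norm s, the root of the supremum m of the squared norms on the unit
    ball, gives a contraction of norm 1; its fixed vector is an eigenvector of A for s. *)
Lemma top_eigenvector A : traceable A -> (exists x, A x != 0) ->
  exists s x, [/\ 0 < s, n2 x = 1, A x = s%:C *: x &
    forall y, n2 (A y) <= s ^+ 2 * n2 y].
Proof.
move=> [Apos [M hM] Atr] [x0 Ax0].
pose S := [set n2 (A x) | x in [set x | n2 x <= 1]].
have S0 : S 0 by exists 0 => /=; rewrite ?linear0 n20.
have M0 : 0 <= M.
  have := le_trans (n2_ge0 _ _) (hM x0); rewrite pmulr_lge0 // n2_neq0 //.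
  by apply: contra Ax0 => /eqP ->; rewrite linear0.
have hS : has_sup S.
  split; first by exists 0.
  exists M => _ [x /= x1 <-]; apply: (le_trans (hM x)).
  by rewrite -[leRHS]mulr1 ler_wpM2l.
pose m := sup S.
have mub x : n2 x <= 1 -> n2 (A x) <= m by move=> x1; apply: ub_le_sup; [case: hS|exists x].
have mA x : n2 (A x) <= m * n2 x.
  have [->|xn0] := eqVneq x 0; first by rewrite linear0 n20 mulr0.
  have := mub ((Num.sqrt (n2 x))^-1%:C *: x); rewrite unit_normalize // => /(_ (lexx 1)).
  rewrite linearZ_LR n2Z cabs2R exprVn sqr_sqrtr ?n2_ge0 //.
  by rewrite mulrC ler_pdivrMr // n2_neq0.
have m0 : 0 < m.
  rewrite ltNge; apply/negP => m0; have := n2_neq0 dot Ax0.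
  by rewrite ltNge (le_trans (mA x0)) // mulr_le0_ge0 // n2_ge0.
pose s := Num.sqrt m.
have s0 : 0 < s by rewrite sqrtr_gt0.
have s2 : s ^+ 2 = m by rewrite sqr_sqrtr // ltW.
pose T : {linear H -> H} := (s^-1)%:C \*: A.
have nT x : n2 (T x) = m^-1 * n2 (A x) by rewrite /= n2Z cabs2R exprVn s2.
have [||||w w0 Tw] := @contraction_eigenvector R H dot dotH h hON htot T.
- by move=> x; rewrite /= dotZl mulr_ge0 // ?lecR ?invr_ge0 // ltW.
- by move=> x; rewrite nT mulrC ler_pdivrMr // mulrC.
- move=> e e1; have me : m * e < sup S by move: e1; rewrite -(ltr_pM2l m0) mulr1.
  have [_ [x /= x1 <-] hx] := sup_gt hS.1 me.
  by exists x => //; rewrite nT mulrC ltr_pdivlMr // mulrC.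
- under eq_eseriesr do rewrite /= ripZl EFinM.
  rewrite nneseriesZl; last by move=> k _; rewrite lee_fin (pos_rip_ge0 Apos).
  have tfin : (\sum_(0 <= k <oo) (rip (A (h k)) (h k))%:E)%E \is a fin_num.
    rewrite ge0_fin_numE // nneseries_ge0 // => k _ _; rewrite lee_fin.
    exact: (pos_rip_ge0 Apos).
  by rewrite -(fineK tfin) -EFinM ltry.
have Aw : A w = s%:C *: w.
  by rewrite -{2}Tw /= scalerA -rmorphM divff ?gt_eqF // scale1r.
exists s, ((Num.sqrt (n2 w))^-1%:C *: w); split => //.
- exact: unit_normalize.
- by rewrite linearZ_LR Aw !scalerA mulrC.
- by move=> y; rewrite s2.
Qed.

Section Deflation.
Context (A : {linear H -> H}) (s : R) (f : H).

Definition deflation x : H := A x - (s%:C * dot x f) *: f.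

Lemma deflation_linear : linear deflation.
Proof.
move=> a x y; rewrite /deflation linearP dotDl dotZl mulrDr scalerDl.
rewrite scalerBr scalerA opprD addrACA; congr (_ - _ + _).
by rewrite mulrCA.
Qed.
HB.instance Definition _ := GRing.isLinear.Build R[i] H H _ deflation deflation_linear.

Hypothesis (Atr : traceable A) (s0 : 0 <= s) (Af : A f = s%:C *: f)
  (f1 : n2 f = 1 \/ f = 0).

Lemma deflation_rip x : rip (deflation x) x = rip (A x) x - s * sq x f.
Proof.
rewrite /deflation ripBl; congr (_ - _).
by rewrite /reip dotZl -mulrA dot_mulC -rmorphM.
Qed.

(** Cauchy-Schwarz for the form of A at x and f reads s^2 |<x, f>|^2 <= <A x, x> s, as A f = s f
    with f of norm 1. So the subtracted term s |<x, f>|^2 is at most <A x, x>. *)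
Lemma deflation_pos : positive deflation.
Proof.
have [Apos _ _] := Atr.
move=> x; rewrite /deflation dotBl dotZl -mulrA dot_mulC.
rewrite dot_rip_iip (pos_iip Apos) complexr0 -rmorphM -rmorphB lecR /= subr_ge0.
have [f1' |->] := f1; last by rewrite sq0r mulr0 (pos_rip_ge0 Apos).
have [->|s1] := eqVneq s 0; first by rewrite mul0r (pos_rip_ge0 Apos).
have {s1}s1 : 0 < s by rewrite lt_neqAle eq_sym s1.
rewrite -(ler_pM2l s1) [leRHS]mulrC.
have := pos_CS Apos x f.
rewrite Af ripZl -/(n2 f) f1' mulr1 [X in X <= _](_ : _ = s * (s * sq x f)) //.
by rewrite !sqE (pos_sym Apos) Af dotZr cabs2M cabs2J cabs2R expr2 mulrA.
Qed.

Lemma deflation_traceable : traceable deflation.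
Proof.
have [Apos [M hM] trA] := Atr; split; first exact: deflation_pos.
  exists (2 * (M + s ^+ 2 * n2 f ^+ 2)) => x.
  rewrite /deflation; apply: (le_trans (n2D_le _ _ _)).
  have h1 : s ^+ 2 * sq x f * n2 f <= s ^+ 2 * n2 f ^+ 2 * n2 x.
    have h2 : 0 <= s ^+ 2 * n2 f by rewrite mulr_ge0 ?sqr_ge0 ?n2_ge0.
    by have := ler_wpM2l h2 (CS dot x f); lra.
  by rewrite n2N n2Z cabs2M cabs2R -sqE; have := hM x; lra.
apply: le_lt_trans trA; apply: lee_nneseries => [k _ _|k _]; rewrite lee_fin.
  exact: (pos_rip_ge0 deflation_pos).
by rewrite deflation_rip gerBl mulr_ge0 // sq_ge0.
Qed.

Lemma deflation_trace : (f = 0 -> s = 0) ->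
  (\sum_(0 <= k <oo) (rip (A (h k)) (h k))%:E =
   s%:E + \sum_(0 <= k <oo) (rip (deflation (h k)) (h k))%:E)%E.
Proof.
move=> fs; have -> : s%:E = (\sum_(0 <= k <oo) (s * sq f (h k))%:E)%E.
  under eq_eseriesr do rewrite EFinM.
  rewrite nneseriesZl; last by move=> k _; rewrite lee_fin sq_ge0.
  rewrite (parseval dotH hON htot).
  by have [->|f0] := f1; [rewrite mule1|rewrite fs // mul0e].
rewrite -nneseriesD.
- apply: eq_eseriesr => k _; rewrite deflation_rip -EFinD (sqC _ f).
  by congr (_%:E); ring.
- by move=> k _ _; rewrite lee_fin mulr_ge0 // sq_ge0.
- by move=> k _ _; rewrite lee_fin (pos_rip_ge0 deflation_pos).
Qed.

End Deflation.

(** The last clause makes [p.1] the operator norm. The pair (0, 0) stands for the zero operator, so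
    that the deflation never stops even in finite rank. *)
Definition eigenpair (A : H -> H) (p : R * H) := [/\ 0 <= p.1,
  (n2 p.2 = 1 /\ p.1 != 0) \/ (p.2 = 0 /\ p.1 = 0), A p.2 = p.1%:C *: p.2 &
  forall y, n2 (A y) <= p.1 ^+ 2 * n2 y].

Lemma ex_eigenpair A : traceable A -> exists p, eigenpair A p.
Proof.
move=> trA; have [|h0] := pselect (exists x, A x != 0).
  move=> /(top_eigenvector trA)[s [x [s0 x1 Ax hs]]].
  by exists (s, x); split=> //=; [rewrite ltW|left; rewrite gt_eqF].
exists (0, 0); split=> //=; first by right.
  by rewrite linear0 scaler0.
move=> y; rewrite (_ : A y = 0) ?n20 ?mulr_ge0 ?n2_ge0 ?sqr_ge0 //.
by apply/eqP/negPn/negP => Ay; apply: h0; exists y.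
Qed.

Section Sequence.
Context (A : {linear H -> H}) (Atr : traceable A).
Context (F : {linear H -> H} -> R * H)
  (FP : forall A, traceable A -> eigenpair A (F A)).

Fixpoint dseq n : {linear H -> H} :=
  if n is n'.+1 then deflation (dseq n') (F (dseq n')).1 (F (dseq n')).2 else A.
Let l n := (F (dseq n)).1.
Let f n := (F (dseq n)).2.

Lemma dseqS n x : dseq n.+1 x = dseq n x - ((l n)%:C * dot x (f n)) *: f n.
Proof. by []. Qed.

Lemma dseq_traceable n : traceable (dseq n).
Proof.
elim: n => [|n IH] //; have [l0 h1 Af _] := FP IH.
by apply: deflation_traceable => //; case: h1 => -[]; [left|right].
Qed.

Lemma dseqP n : eigenpair (dseq n) (l n, f n).
Proof. by have := FP (dseq_traceable n); rewrite /l /f; case: (F _). Qed.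

(** If A_n x = 0, then l_n <x, f_n> = <x, A_n f_n> = <A_n x, f_n> = 0, so the subtracted term
    vanishes at x. Thus each eigenvector, once deflated, stays in all later kernels, which gives
    orthogonality. *)
Lemma dseq_kerS n x : dseq n x = 0 -> dseq n.+1 x = 0.
Proof.
move=> h0; rewrite dseqS h0 sub0r.
have [_ _ /= Af _] := dseqP n; have [dpos _ _] := dseq_traceable n.
have -> : (l n)%:C * dot x (f n) = 0; last by rewrite scale0r oppr0.
have -> : (l n)%:C * dot x (f n) = dot x ((l n)%:C *: f n) by rewrite dotZr conjc_real.
by rewrite -Af -(pos_sym dpos) h0 dot0l.
Qed.

Lemma dseq_ker i j : (i < j)%N -> dseq j (f i) = 0.
Proof.
elim: j => // j IH; rewrite ltnS leq_eqVlt => /predU1P[->|/IH/dseq_kerS //].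
have [_ h1 /= Af _] := dseqP j; rewrite dseqS Af.
case: h1 => /= [[f1 _]|[-> _]]; last by rewrite !scaler0 subrr.
by rewrite dotxx f1 mulr1 subrr.
Qed.

Lemma dseq_orth i j : (i < j)%N -> dot (f j) (f i) = 0.
Proof.
move=> ij; have [_ h1 /= Af _] := dseqP j; have [dpos _ _] := dseq_traceable j.
case: h1 => /= [[_ l0]|[-> _]]; last by rewrite dot0l.
apply: (@mulfI _ (l j)%:C); first by apply: contra l0 => /eqP [->].
by rewrite mulr0 -dotZl -Af (pos_sym dpos) dseq_ker // dot0r.
Qed.

Lemma dseq_on : on_seq dot f.
Proof.
move=> i j; have [-> |ij] := eqVneq i j.
  have [_ h1 _ _] := dseqP j; rewrite dotxx /=.
  by case: h1 => /= [[f1 _]|[-> _]]; rewrite ?f1 ?n20 ?eqxx // (n2_1_neq0 f1).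
have [ij'|ji|/eqP] := ltngtP i j; last by rewrite (negbTE ij).
  by rewrite dotC dseq_orth // conjc0.
by rewrite dseq_orth.
Qed.

Lemma dseq_eigen n : A (f n) = (l n)%:C *: f n.
Proof.
have [_ _ /= <- _] := dseqP n.
suff h1 k : (k <= n)%N -> dseq k (f n) = A (f n) by rewrite h1.
elim: k => // k IH kn; rewrite dseqS IH ?(ltnW kn) // dseq_orth // mulr0.
by rewrite scale0r subr0.
Qed.

(** For the unit vector f = f_(n+1): l_(n+1) = <A_(n+1) f, f> <= <A_n f, f> <= |A_n f| <= l_n. *)
Lemma dseq_noninc : nonincreasing_seq l.
Proof.
apply/nonincreasing_seqP => n.
have [l0 _ _ hn] := dseqP n; rewrite /= in l0 hn.
have [_ h1 _ _] := dseqP n.+1; rewrite /= in h1.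
have Af : dseq n.+1 (f n.+1) = (l n.+1)%:C *: f n.+1 by case: (dseqP n.+1).
case: h1 => /= [[f1 _]|[_ ->]] //.
rewrite -(@ler_pXn2r _ 2%N) ?nnegrE //; last by have [] := dseqP n.+1.
have [dpos _ _] := dseq_traceable n.
apply: (@le_trans _ _ (rip (dseq n (f n.+1)) (f n.+1) ^+ 2)).
  rewrite lerXn2r ?nnegrE ?(pos_rip_ge0 dpos) //; first by have [] := dseqP n.+1.
  have -> : l n.+1 = rip (dseq n.+1 (f n.+1)) (f n.+1).
    by rewrite Af ripZl -/(n2 _) f1 mulr1.
  rewrite dseqS ripBl gerBl /reip dotZl -mulrA dot_mulC -rmorphM /=.
  by rewrite mulr_ge0 // sq_ge0.
apply: (le_trans (rip_sq _ _ _)); apply: (le_trans (CS _ _ _)).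
by rewrite f1 mulr1 -[leRHS]mulr1 -f1.
Qed.

(** Each deflation lowers the trace by exactly [l n], and the trace that remains is nonnegative. *)
Lemma dseq_sum n : ((\sum_(0 <= k < n) l k)%:E <=
  \sum_(0 <= k <oo) (rip (A (h k)) (h k))%:E)%E.
Proof.
have -> : (\sum_(0 <= k <oo) (rip (A (h k)) (h k))%:E =
  (\sum_(0 <= k < n) l k)%:E + \sum_(0 <= k <oo) (rip (dseq n (h k)) (h k))%:E)%E.
  elim: n => [|n ->]; first by rewrite big_geq // add0e.
  rewrite big_nat_recr //= EFinD -addeA; congr (_ + _)%E.
  have [l0 h1 Af _] := dseqP n; rewrite (@deflation_trace _ (l n) (f n)) //.
  - exact: dseq_traceable.
  - by case: h1 => -[]; [left|right].
  - by move=> f0; case: h1 => /= [[f1 _]|[]//]; move: f1; rewrite f0 n20 => /esym/eqP; rewrite oner_eq0.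
rewrite leeDl // nneseries_ge0 // => k _ _; rewrite lee_fin.
by have [dpos _ _] := dseq_traceable n; exact: (pos_rip_ge0 dpos).
Qed.

Lemma dseq_cvg0 : l @ \oo --> (0 : R).
Proof.
have [_ _ trA] := Atr; apply: (@cvg_series_cvg_0 _ R^o); apply: nnseries_is_cvg.
  by move=> n; have [] := dseqP n.
apply: le_lt_trans trA; apply: lime_le.
  by apply: is_cvg_nneseries => n _ _; rewrite lee_fin; have [] := dseqP n.
by apply: nearW => n; rewrite sumEFin; exact: dseq_sum.
Qed.

(** Such an x is not affected by the deflations, so |A x| = |A_n x| <= l_n |x|, which tends to 0. *)
Lemma dseq_total x : (forall n, dot x (f n) = 0) -> A x = 0.
Proof.
move=> hx; have dA n : dseq n x = A x.
  by elim: n => // n IH; rewrite dseqS IH hx mulr0 scale0r subr0.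
apply: (@n2_eq0 _ _ dot); apply/eqP; rewrite eq_le n2_ge0 andbT.
have h1 : (fun n => l n ^+ 2 * n2 x) @ \oo --> (0 : R).
  suff : (fun n => l n ^+ 2 * n2 x) @ \oo --> (0 * 0 * n2 x : R) by rewrite !mul0r.
  apply: cvgM; last exact: cvg_cst.
  by apply: cvgM; exact: dseq_cvg0.
rewrite -(cvg_lim _ h1) //; apply: limr_ge; first exact: cvgP h1.
by apply: nearW => n; have [_ _ _ /(_ x)] := dseqP n; rewrite dA.
Qed.
End Sequence.

(** The [f n] need not span the kernel of A, so the last conclusion is about A x and does not claim
    totality. *)
Theorem spectral_sequence A : traceable A ->
  exists (l : nat -> R) (f : nat -> H),
  [/\ nonincreasing_seq l, forall n, 0 <= l n, l @ \oo --> (0 : R) & on_seq dot f] /\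
  [/\ forall n, f n = 0 <-> l n = 0, forall n, A (f n) = (l n)%:C *: f n &
      forall x, (forall n, dot x (f n) = 0) -> A x = 0].
Proof.
move=> trA.
have /choice[F FP] : forall A : {linear H -> H}, exists p, traceable A -> eigenpair A p.
  move=> B; have [/ex_eigenpair[p]|nB] := pselect (traceable B); first by exists p.
  by exists (0, 0).
exists (fun n => (F (dseq A F n)).1), (fun n => (F (dseq A F n)).2); split; split.
- exact: dseq_noninc.
- by move=> n; have [] := dseqP trA FP n.
- exact: dseq_cvg0.
- exact: dseq_on.
- move=> n; have [_ h1 _ _] := dseqP trA FP n.
  case: h1 => /= [[f1 l0]|[-> ->]//]; split => h0; first by have := n2_1_neq0 f1; rewrite h0 eqxx.
  by rewrite h0 eqxx in l0.
- exact: dseq_eigen.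
- exact: dseq_total.
Qed.

End SpectralTheorem.

(** * Eigenbases and the eigenvalue sequence *)

Section Cardinality.
Context (R : realType) (T : choiceType).

Lemma esum1_finite (B : set T) : finite_set B ->
  (\esum_(e in B) 1%:E = (size (finmap.enum_fset (fset_set B)))%:R%:E :> \bar R)%E.
Proof.
move=> fB; rewrite esum_fset // fsbig_finite //=.
elim: (finmap.enum_fset _) => [|x s IH]; first by rewrite big_nil.
by rewrite big_cons IH -EFinD /= -natr1 addrC.
Qed.

Lemma esum1_lty (B : set T) : (\esum_(e in B) 1%:E < +oo :> \bar R)%E -> finite_set B.
Proof.
move=> hB; apply: contrapT => iB.
have : (0 <= \esum_(e in B) 1%:E :> \bar R)%E by apply: esum_ge0.
move: hB; case E : (\esum_(e in B) _)%E => [r| |] // _ _.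
have [X XB nX] := infinite_set_fset (Num.truncn r).+1 iB.
have : ((size (finmap.enum_fset X))%:R%:E <= r%:E :> \bar R)%E.
  have fX : finite_set [set` X] by exact: finite_fset.
  rewrite -E -{1}(set_fsetK X); apply: esum_ge; exists [set` X]; first by split.
  by rewrite -esum_fset ?esum1_finite.
rewrite lee_fin leNgt => /negP; apply.
by rewrite (lt_le_trans (truncnS_gt r)) // ler_nat.
Qed.

End Cardinality.

Section DiagonalForm.
Context (R : realType) (H : completeNormedModType R[i])
  (dot : {dot H for Num.conj}).
Local Notation rip := (reip dot).
Local Notation n2 := (nrm2 dot).
Local Notation sq := (sqip dot).
Local Notation positive := (pos_op dot).
Context (dotH : hilbert dot) (A : {linear H -> H}) (Apos : positive A).

Lemma diag_rip b (m : nat -> R) : on_seq dot b -> total dot b ->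
  (forall k, A (b k) = (m k)%:C *: b k) -> forall x,
  ((rip (A x) x)%:E = \sum_(0 <= k <oo) (m k * sq x (b k))%:E)%E.
Proof.
move=> bON btot Ab x; apply/esym/EFin_series.
have := rip_expansion dotH bON btot (x := A x) (y := x).
have -> // : (fun k => complex.Re (dot (A x) (b k) * dot (b k) x)) =
  (fun k => m k * sq x (b k)).
apply/funext => k; rewrite (pos_sym Apos) Ab dotZr conjc_real -mulrA dot_mulC.
by rewrite -rmorphM.
Qed.

(** The trace does not depend on the basis: both sides are the double sum of m_k |<h_j, b_k>|^2,
    summed in either order. *)
Lemma diag_trace h b (m : nat -> R) : on_seq dot h -> total dot h ->
  on_seq dot b -> total dot b ->
  (forall k, A (b k) = (m k)%:C *: b k) -> (forall k, 0 <= m k) ->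
  (\sum_(0 <= k <oo) (rip (A (h k)) (h k))%:E =
   \sum_(0 <= k <oo) (m k * n2 (b k))%:E)%E.
Proof.
move=> hON htot bON btot Ab m0; under eq_eseriesr do rewrite (diag_rip bON btot Ab).
rewrite nneseries_interchange; last by move=> i j; rewrite lee_fin mulr_ge0 ?sq_ge0.
apply: eq_eseriesr => k _; under eq_eseriesr do rewrite EFinM.
rewrite nneseriesZl; last by move=> i _; rewrite lee_fin sq_ge0.
under eq_eseriesr do rewrite sqC.
by rewrite (parseval dotH hON htot).
Qed.

End DiagonalForm.

Section Eigenbasis.
Context (R : realType) (H : completeNormedModType R[i])
  (dot : {dot H for Num.conj}).
Local Notation rip := (reip dot).
Local Notation n2 := (nrm2 dot).
Local Notation sq := (sqip dot).
Local Notation positive := (pos_op dot).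
Local Notation span := (@Defs.span R H).
Local Notation eigsp := (@Defs.eigenspace R H).
Context (dotH : hilbert dot) (Hsep : separable_space H).
Context (h : nat -> H) (hON : on_seq dot h) (htot : total dot h).
Context (A : {linear H -> H}) (Atr : traceable dot h A).
Implicit Types (x y z : H) (B W : set H) (b : nat -> H).

Let Apos : positive A. Proof. by case: Atr. Qed.

Lemma eig_orth c d x y : c != d -> eigsp A c x -> eigsp A d y -> dot x y = 0.
Proof.
move=> cd /= Ax Ay; have := pos_sym Apos x y.
rewrite Ax Ay dotZl dotZr conjc_real => /eqP; rewrite -subr_eq0 -mulrBl mulf_eq0.
case/orP => /eqP // h0; case/eqP: cd; apply/eqP; rewrite -subr_eq0.
by move: h0; rewrite -rmorphB => -[->].
Qed.

(** Being an eigenvector for c is orthogonality to all A y - c y, a condition that passes to the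
    closed span. *)
Lemma closure_eig B c : B `<=` eigsp A c -> closure (span B) `<=` eigsp A c.
Proof.
move=> Bc x cx /=; apply: (@dot_eq _ _ dot) => y.
have := closure_span_orth dotH (y := A y - c%:C *: y) _ cx.
rewrite dotBr -(pos_sym Apos) dotZr conjc_real dotZl => h0.
apply/eqP; rewrite -subr_eq0 h0 // => z /Bc /= Az.
by rewrite dotBr -(pos_sym Apos) Az dotZl dotZr conjc_real subrr.
Qed.

Lemma expansion_closure B b x : enumerates dot b B -> closure (span B) x ->
  hcvg dot (psum (fun k => dot x (b k)) b) x.
Proof.
move=> eb cx; have [p hp hk] := projection dotH eb.1 x.
suff xp : x = p by rewrite [X in hcvg _ _ X]xp.
have cp : closure (span B) p.
  by apply: hcvg_closure hp => // n; apply: span_psum => k; exact: enumerates_in eb.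
have hB y : B y -> dot y (x - p) = 0.
  by move=> /eb.2[_ [k <-]]; rewrite dotC hk conjc0.
have hcl := closure_span_orth dotH hB.
apply/eqP; rewrite -subr_eq0; apply/eqP/(@n2_eq0 _ _ dot).
by rewrite /nrm2 /reip dotBl hcl // hcl // subrr.
Qed.

(* Both sides are the sum of |<e, e'>|^2 over e in B1 and e' in B2. *)
Lemma basis_esum1 W B1 B2 :
  orthonormal_basis dot W B1 -> orthonormal_basis dot W B2 ->
  (\esum_(e in B1) 1%:E = \esum_(e in B2) 1%:E :> \bar R)%E.
Proof.
move=> [ob1 c1] [ob2 c2].
have [b1 e1] := ex_enum dotH Hsep ob1; have [b2 e2] := ex_enum dotH Hsep ob2.
have hn (B : set H) : orthonormal_set dot B ->
    (\esum_(e in B) 1%:E = \esum_(e in B) (n2 e)%:E :> \bar R)%E.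
  by move=> oB; apply: eq_esum => e Be; rewrite (orthonormal_n2 oB Be).
have hp b b' (B B' : set H) : enumerates dot b B -> enumerates dot b' B' ->
    closure (span B) = closure (span B') -> forall k,
    ((n2 (b k))%:E = \sum_(0 <= j <oo) (sq (b k) (b' j))%:E)%E.
  move=> eb eb' cB k; apply/esym/EFin_series.
  have ck : closure (span B') (b k).
    have [->|Bb] := enumerates_in k eb; last first.
      by rewrite -cB; apply: subset_closure; exact: sub_span.
    by apply: subset_closure; exact: span0.
  have := hcvg_n2 (expansion_closure eb' ck).
  under eq_fun do rewrite (n2_psum eb'.1 (fun j => @dot_b0 _ _ dot b' (b k) j)).
  by rewrite seriesEord.
rewrite !hn // (esum_enum e1) ?(esum_enum e2) ?n20 //; last first.
- by move=> x; rewrite lee_fin n2_ge0.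
- by move=> x; rewrite lee_fin n2_ge0.
under eq_eseriesr do rewrite (hp _ _ _ _ e1 e2) ?c1 //.
rewrite nneseries_interchange; last by move=> i j; rewrite lee_fin sq_ge0.
apply: eq_eseriesr => j _; rewrite (hp _ _ _ _ e2 e1) ?c1 //.
by apply: eq_eseriesr => k _; rewrite sqC.
Qed.

Lemma basis_card W B1 B2 :
  orthonormal_basis dot W B1 -> orthonormal_basis dot W B2 ->
  finite_set B1 -> (B1 #= B2)%card.
Proof.
move=> h1 h2 f1; have he := basis_esum1 h1 h2.
have f2 : finite_set B2.
  by apply: (@esum1_lty R); rewrite -he (esum1_finite _ f1) ltry.
apply/(fcard_eq f1 f2)/eqP; rewrite -(eqr_nat R); apply/eqP.
by move: he; rewrite (esum1_finite _ f1) (esum1_finite _ f2) => -[].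
Qed.

Section FromSequence.
Context (l : nat -> R) (f : nat -> H) (l_ge0 : forall n, 0 <= l n)
  (l_ninc : nonincreasing_seq l) (fON : on_seq dot f)
  (fl0 : forall n, f n = 0 <-> l n = 0)
  (Af : forall n, A (f n) = (l n)%:C *: f n)
  (ker : forall x, (forall n, dot x (f n) = 0) -> A x = 0).

(** Let y be the residual of an eigenvector after projection on the f_n with l_n = c. It is
    orthogonal to these f_n by construction and to the others as an eigenvector for another
    eigenvalue. Hence A y = 0, while A y = c y with c > 0. *)
Lemma seq_eigspace_basis c : 0 < c ->
  orthonormal_basis dot (eigsp A c) (f @` [set n | l n = c]).
Proof.
move=> c0; set B := _ @` _.
have f0 n : l n = c -> f n != 0.
  by move=> lc; apply/eqP => /fl0; rewrite lc => /eqP; rewrite gt_eqF.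
have oB : orthonormal_set dot B.
  move=> _ _ [i /= li <-] [j /= lj <-]; rewrite fON (f0 i) // andbT.
  congr (_%:R); have [-> |ij] := eqVneq i j; first by rewrite eqxx.
  by case: eqVneq => // fij; case/eqP: ij; apply: (on_inj fON _ fij); exact: f0.
have cB : closure (span B) `<=` eigsp A c.
  by apply: closure_eig => _ [n /= ln <-]; rewrite /Defs.eigenspace /= Af ln.
split => //; apply/seteqP; split=> // x xc.
pose b n := if l n == c then f n else 0.
have bON : on_seq dot b.
  move=> i j; rewrite /b; case: ifP => li; last by rewrite dot0l eqxx andbF.
  case: ifP => lj; first exact: fON.
  by rewrite dot0r; case: eqVneq => // ij; rewrite -ij li in lj.
have bB k : b k = 0 \/ B (b k).
  by rewrite /b; case: eqP => lk; [right; exists k|left].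
have [p hp hk] := projection dotH bON x.
have cp : closure (span B) p by apply: hcvg_closure hp => // n; exact: span_psum.
suff -> : x = p by [].
apply/eqP; rewrite -subr_eq0; apply/eqP; set y := x - p.
have yc : A y = c%:C *: y.
  by rewrite /y linearB /= xc (cB _ cp) scalerBr.
have Ay : A y = 0.
  apply: ker => n; have [lc|lc] := eqVneq (l n) c.
    by have := hk n; rewrite /b lc eqxx.
  by apply: (@eig_orth c (l n)); [rewrite eq_sym|exact: yc|exact: Af].
move: Ay; rewrite yc => /eqP; rewrite scaler_eq0 => /orP[/eqP[c0']|/eqP //].
by rewrite c0' ltxx in c0.
Qed.

Lemma seq_is_eigenvalue_seq : is_eigenvalue_seq dot A l.
Proof.
split => // c c0; exists (f @` [set n | l n = c]); first exact: seq_eigspace_basis.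
apply: card_esym; apply: inj_card_eq => i j /set_mem /= li _ fij.
by apply: (on_inj fON _ fij); apply/eqP => /fl0; rewrite li => /eqP; rewrite gt_eqF.
Qed.

(* The f n are completed by a maximal orthonormal set orthogonal to all of them. *)
Lemma seq_ex_eigenbasis : exists B, orthonormal_basis dot setT B /\
  forall e, B e -> exists c : R, eigsp A c e.
Proof.
pose P (X : set H) := orthonormal_set dot X /\ forall x, X x -> forall n, dot x (f n) = 0.
have [F FP Ftot|X [[oX kX] Xmax]] := @Zorn_bigcup H P.
  split; last by move=> x [X FX Xx]; exact: (FP _ FX).2.
  move=> x y [X FX Xx] [Y FY Yy]; have [XY|YX] := Ftot _ _ FX FY.
    by apply: (FP _ FY).1 => //; exact: XY.
  by apply: (FP _ FX).1 => //; exact: YX.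
pose B := X `|` [set x | x != 0 /\ exists n, f n = x].
have oB : orthonormal_set dot B.
  move=> x y [Xx|[x0 [n fn]]] [Xy|[y0 [m fm]]].
  - exact: oX.
  - rewrite -fm kX //; case: eqVneq => // xm; move: (kX _ Xx m).
    by rewrite xm dotxx (on_neq0 fON) ?fm // => /eqP; rewrite oner_eq0.
  - rewrite -fn dotC kX // conjc0; case: eqVneq => // ym; move: (kX _ Xy n).
    by rewrite -ym dotxx (on_neq0 fON) ?fn // => /eqP; rewrite oner_eq0.
  - rewrite -fn -fm fON fn x0 andbT; congr (_%:R).
    have [nm|nm] := eqVneq n m; first by rewrite -fn nm eqxx.
    by case: eqVneq => // xy; case/eqP: nm; apply: (on_inj fON); rewrite fn.
exists B; split; last first.
  move=> e [Xe|[_ [n <-]]]; last by exists (l n); exact: Af.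
  by exists 0; rewrite /Defs.eigenspace /= (_ : 0%:C = 0) // scale0r; apply: ker; exact: kX.
apply: (orthonormal_total dotH Hsep oB) => z hz.
apply/eqP/negPn/negP => z0.
pose u := (Num.sqrt (n2 z))^-1%:C *: z.
have u1 : n2 u = 1 by exact: unit_normalize.
have uB y : B y -> dot u y = 0 by move=> By; rewrite dotZl hz // mulr0.
have Xu : ~ X u.
  by move=> Xu; have := uB u (or_introl Xu); rewrite dotxx u1 => /eqP; rewrite oner_eq0.
apply: (Xmax (X `|` [set u])).
  by split; [left|move=> /(_ u); apply: contra_not Xu; apply; right].
split.
  move=> x y [Xx|->] [Xy|->]; first exact: oX.
  - rewrite dotC uB; last by left.
    by rewrite conjc0; case: eqVneq => // xu; rewrite xu in Xx.
  - by rewrite uB; [case: eqVneq => // xu; rewrite -xu in Xy|left].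
  - by rewrite dotxx u1 eqxx.
move=> x [Xx|->] n; first exact: kX.
have [->|fn0] := eqVneq (f n) 0; first by rewrite dot0r.
by apply: uB; right; split => //; exists n.
Qed.

End FromSequence.

Lemma is_eigenvalue_seqP : is_eigenvalue_seq dot A (eigenvalue_seq dot A).
Proof.
have [l [f [[ninc l0 _ fON] [fl0 Af ker]]]] := spectral_sequence dotH hON htot Atr.
by apply: (@xgetPex _ _ (is_eigenvalue_seq dot A)); exists l;
  apply: (seq_is_eigenvalue_seq (f := f)).
Qed.

Lemma eigenbasisP : orthonormal_basis dot setT (eigenbasis dot A) /\
  forall e, eigenbasis dot A e -> exists c : R, eigsp A c e.
Proof.
have [l [f [[ninc l0 _ fON] [fl0 Af ker]]]] := spectral_sequence dotH hON htot Atr.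
have [B hB] : exists B, orthonormal_basis dot setT B /\
    forall e, B e -> exists c : R, eigsp A c e by apply: (seq_ex_eigenbasis (l := l) (f := f)).
by apply: (@xgetPex _ _ [set B | orthonormal_basis dot setT B /\ _]); exists B.
Qed.

Local Notation B := (eigenbasis dot A).
Local Notation lam := (fun e => rip (A e) e).

Lemma eigenbasis_lam e : B e -> A e = (lam e)%:C *: e.
Proof.
move=> Be; have [c Ae] := eigenbasisP.2 _ Be.
rewrite Ae ripZl -/(n2 e) (orthonormal_n2 eigenbasisP.1.1 Be) mulr1 //.
Qed.

Lemma eigenbasis_trace : (\esum_(e in B) (lam e)%:E =
  \sum_(0 <= k <oo) (rip (A (h k)) (h k))%:E)%E.
Proof.
have [oB _] := eigenbasisP.
have [b [eb btot]] := orthonormal_basis_enum dotH Hsep oB.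
have Ab k : A (b k) = (lam (b k))%:C *: b k.
  have [->|] := enumerates_in k eb; first by rewrite linear0 scaler0.
  exact: eigenbasis_lam.
rewrite (esum_enum eb); last by rewrite linear0 /reip dot0l.
  rewrite (diag_trace dotH Apos hON htot eb.1 btot Ab) => [|k]; last exact: (pos_rip_ge0 Apos).
  apply: eq_eseriesr => k _; congr (_%:E).
  by rewrite (on_n2 eb.1); case: eqVneq => [->|_]; rewrite ?mulr1 // linear0 /reip dot0l mul0r.
by move=> x; rewrite lee_fin (pos_rip_ge0 Apos).
Qed.

(** In the expansion of an eigenvector for c, the basis vectors with another eigenvalue have
    coefficient 0. *)
Lemma eigenbasis_eigspace c :
  orthonormal_basis dot (eigsp A c) [set e | B e /\ lam e = c].
Proof.
have [[oB cB] eB] := eigenbasisP.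
have oC : orthonormal_set dot [set e | B e /\ lam e = c].
  by move=> x y [Bx _] [By _]; exact: oB.
split => //; apply/seteqP; split.
  by apply: closure_eig => e [Be <-]; exact: eigenbasis_lam.
move=> x xc; have [b eb] := ex_enum dotH Hsep oC.
apply: (in_closure_span dotH eb.1) => [k|y hy]; first exact: enumerates_in eb.
have [b' [eb' btot']] := orthonormal_basis_enum dotH Hsep eigenbasisP.1.
rewrite dotC (hcvg_dot0 (expansion dotH eb'.1 btot' x)) ?conjc0 // => n.
rewrite /psum linear_sumlz big1 // => k _.
rewrite -[LHS]/(dot (dot x (b' k) *: b' k) y) dotZl.
have [->|Bk] := enumerates_in k eb'; first by rewrite dot0l mulr0.
have [lk|lk] := eqVneq (lam (b' k)) c.
  have /eb.2[_ [j <-]] : [set e | B e /\ lam e = c] (b' k) by [].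
  by rewrite (dotC _ _ y) hy conjc0 mulr0.
by rewrite (@eig_orth c (lam (b' k)) x) ?mul0r // 1?eq_sym //; exact: eigenbasis_lam.
Qed.

(** The values c > 0 are treated one at a time. The sequence takes the value c as often as some
    orthonormal basis of the eigenspace has elements, and two such bases have the same finite number
    of elements, as c times that number is at most the trace. The bijections for the single values
    are glued along the value [l i]. *)
Lemma eigenvalue_bijection : exists f : nat -> H,
  set_bij [set i | 0 < eigenvalue_seq dot A i] [set e | B e /\ 0 < lam e] f /\
  forall i, 0 < eigenvalue_seq dot A i -> lam (f i) = eigenvalue_seq dot A i.
Proof.
set l := eigenvalue_seq dot A; have [_ l0 hl] := is_eigenvalue_seqP.
have /choice[g hg] : forall c : R, exists g : nat -> H, 0 < c ->
    set_bij [set i | l i = c] [set e | B e /\ lam e = c] g.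
  move=> c; have [c0|_] := ltP 0 c; last by exists (fun=> 0).
  have [B' hB' cB'] := hl _ c0.
  suff /card_set_bijP[g hg] : ([set i | l i = c] #= [set e | B e /\ lam e = c])%card.
    by exists g.
  apply: (card_eq_trans cB'); apply: card_esym.
  apply: (basis_card (eigenbasis_eigspace c) hB'); apply: (@esum1_lty R).
  have oC := (eigenbasis_eigspace c).1; set C := [set e | _] in oC *.
  have [b eb] := ex_enum dotH Hsep oC.
  have hC : (\esum_(e in C) (lam e)%:E = c%:E * \esum_(e in C) 1%:E)%E.
    have -> : (\esum_(e in C) 1%:E = \esum_(e in C) (n2 e)%:E :> \bar R)%E.
      by apply: eq_esum => e Ce; rewrite (orthonormal_n2 oC Ce).
    rewrite !(esum_enum eb) ?n20 ?linear0 ?rip0l // -?nneseriesZl.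
    - apply: eq_eseriesr => k _; rewrite -EFinM; congr (_%:E).
      have [->|[Bk lk]] := enumerates_in k eb; first by rewrite linear0 rip0l n20 mulr0.
      by rewrite lk (orthonormal_n2 oC) // mulr1.
    - by move=> k _; rewrite lee_fin n2_ge0.
    - by move=> x; rewrite lee_fin n2_ge0.
    - by move=> x; rewrite lee_fin (pos_rip_ge0 Apos).
  have : (\esum_(e in C) (lam e)%:E < +oo)%E.
    have [_ _] := Atr; apply: le_lt_trans; rewrite -eigenbasis_trace.
    rewrite (_ : C = B `&` [set e | lam e = c]) // esum_mkcondr.
    apply: le_esum => e _; case: ifP => // _.
    by rewrite lee_fin (pos_rip_ge0 Apos).
  rewrite hC; case: (\esum_(e in C) _)%E => // [r _|]; first exact: ltry.
  by rewrite mulry gtr0_sg // mul1e.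
exists (fun i => g (l i) i); split; last first.
  by move=> i li; have [/(_ i erefl)[]] := hg _ li.
split.
- move=> i /= li; have [/(_ i erefl)[Bi lami] _ _] := hg _ li.
  by rewrite /= lami.
- move=> i j /set_mem /= li /set_mem /= lj gij.
  have [/(_ i erefl)[_ lami] ginj _] := hg _ li.
  have [/(_ j erefl)[_ lamj] _ _] := hg _ lj.
  have lij : l i = l j by rewrite -lami -lamj gij.
  by apply: ginj; rewrite ?inE //= gij lij.
- move=> e /= [Be lame]; have [_ _ /(_ e (conj Be erefl))[i /= li gi]] := hg _ lame.
  by exists i; rewrite /= li.
Qed.

End Eigenbasis.

(** * Projection-valued measures *)

Section ProjectionValuedMeasures.
Context (R : realType) (H : completeNormedModType R[i])
  (dot : {dot H for Num.conj}).
Local Notation rip := (reip dot).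
Local Notation n2 := (nrm2 dot).
Context (dotH : hilbert dot).
Implicit Types (x y z : H) (S T : set R) (E : set R -> H -> H).
Local Notation pvm := (projection_valued_measure dot).

Import HBNNSimple.

(** Needed because [scalar_measure] is a bare set function, arbitrary on non-measurable sets; the
    integral consults it only on preimages of points under measurable simple functions. *)
Lemma eq_setfun_integral (m1 m2 : set R -> \bar R) (f : R -> \bar R) :
  (forall S, measurable S -> m1 S = m2 S) ->
  (\int[m1]_t f t = \int[m2]_t f t)%E.
Proof.
move=> m12; have hs (h : {nnsfun R >-> R}) : sintegral m1 h = sintegral m2 h.
  by apply: eq_fsbigr => r _; rewrite m12.
rewrite /integral.
by congr (ereal_sup _ - ereal_sup _)%E; apply/seteqP; split => _ [h hf <-];
  exists h => //; rewrite hs.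
Qed.

Lemma pvm_sym E S : pvm E -> measurable S ->
  forall x y, dot (E S x) y = dot x (E S y).
Proof. by move=> [hE _ _ _] /hE[]. Qed.
Lemma pvm_idem E S : pvm E -> measurable S -> forall x, E S (E S x) = E S x.
Proof. by move=> [hE _ _ _] /hE[]. Qed.
Lemma pvm_linear E S : pvm E -> measurable S -> linear (E S).
Proof. by move=> [hE _ _ _] /hE[]. Qed.

Lemma pvm_rip E S x : pvm E -> measurable S -> rip (E S x) x = n2 (E S x).
Proof. by move=> hE mS; rewrite /nrm2 /reip -(pvm_sym hE mS) pvm_idem. Qed.

Lemma pvmB E S x y : pvm E -> measurable S -> E S (x - y) = E S x - E S y.
Proof.
by move=> hE mS; have h := pvm_linear hE mS (-1) y x; rewrite !scaleN1r in h; rewrite addrC h addrC.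
Qed.
Lemma pvmD E S x y : pvm E -> measurable S -> E S (x + y) = E S x + E S y.
Proof. by move=> hE mS; have := pvm_linear hE mS 1 x y; rewrite !scale1r. Qed.
Lemma pvm0 E S : pvm E -> measurable S -> E S 0 = 0.
Proof. by move=> hE mS; have := pvmB 0 0 hE mS; rewrite !subrr. Qed.

Lemma scalar_measureE E S x : pvm E -> measurable S ->
  scalar_measure dot E x S = (n2 (E S x))%:E.
Proof. by move=> hE mS; rewrite -pvm_rip. Qed.

(** Agrees with [scalar_measure] on measurable sets but is nonnegative on every set, as the measure
    structure demands. The proof [hE] is carried along for the measure instance. *)
Definition pvm_measure E (hE : pvm E) x : set R -> \bar R := fun S => (n2 (E S x))%:E.

Lemma pvm_measure0 E (hE : pvm E) x : pvm_measure hE x set0 = 0%E.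
Proof. by have [_ h0 _ _] := hE; rewrite /pvm_measure h0 n20. Qed.
Lemma pvm_measure_ge0 E (hE : pvm E) x S : (0 <= pvm_measure hE x S)%E.
Proof. by rewrite lee_fin n2_ge0. Qed.
Lemma pvm_measure_sigma E (hE : pvm E) x : semi_sigma_additive (pvm_measure hE x).
Proof.
have [_ _ _ /(_ x) hs] := hE; move=> F mF tF mUF.
have := hs F mF tF mUF.
rewrite scalar_measureE //; under eq_fun do under eq_bigr do rewrite scalar_measureE //.
by [].
Qed.
HB.instance Definition _ E hE x := isMeasure.Build _ _ _ (@pvm_measure E hE x)
  (pvm_measure0 hE x) (pvm_measure_ge0 hE x) (@pvm_measure_sigma E hE x).

Section Fixed.
Context (E : set R -> H -> H) (hE : pvm E).
Local Notation mu := (pvm_measure hE).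

Lemma scalar_integral x (f : R -> \bar R) :
  (\int[scalar_measure dot E x]_t f t = \int[mu x]_t f t)%E.
Proof. by apply: eq_setfun_integral => S mS; rewrite scalar_measureE. Qed.

Lemma pvm_setT x : E setT x = x.
Proof. by have [_ _ -> _] := hE. Qed.

Lemma pvm_addU S T x : measurable S -> measurable T -> S `&` T = set0 ->
  n2 (E (S `|` T) x) = n2 (E S x) + n2 (E T x).
Proof.
move=> mS mT ST; have := measureU (mu x) mS mT ST.
by rewrite /= /pvm_measure -EFinD => -[].
Qed.

Lemma pvm_mono S T x : measurable S -> measurable T -> S `<=` T ->
  n2 (E S x) <= n2 (E T x).
Proof.
move=> mS mT ST; rewrite -lee_fin -!/(mu x _).
by apply: le_measure; rewrite ?inE.
Qed.

Lemma pvm_le S x : measurable S -> n2 (E S x) <= n2 x.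
Proof. by move=> mS; rewrite -{2}(pvm_setT x); apply: pvm_mono. Qed.

(** For y = E T x, additivity gives |E (S u T) y|^2 = |E S y|^2 + |y|^2, and the left-hand side is
    at most |y|^2. *)
Lemma pvm_disj S T x : measurable S -> measurable T -> S `&` T = set0 ->
  E S (E T x) = 0.
Proof.
move=> mS mT ST; apply: (@n2_eq0 _ _ dot).
have := pvm_addU (E T x) mS mT ST; rewrite (pvm_idem hE) //.
have := pvm_le (E T x) (measurableU _ _ mS mT); have := n2_ge0 dot (E S (E T x)); lra.
Qed.

Lemma pvm_sub S T x : measurable S -> measurable T -> S `<=` T ->
  E S (E T x) = E S x.
Proof.
move=> mS mT ST; apply/esym/eqP; rewrite -subr_eq0 -pvmB //.
apply/eqP/(@n2_eq0 _ _ dot)/eqP; rewrite eq_le n2_ge0 andbT.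
by rewrite (le_trans (pvm_mono _ mS mT ST)) // pvmB // pvm_idem // subrr n20.
Qed.

Lemma pvm_C S x : measurable S -> E (~` S) x = x - E S x.
Proof.
move=> mS; have mC := measurableC mS; have SC : S `&` ~` S = set0 by rewrite setICr.
have h := pvm_addU x mS mC SC; rewrite setUCr pvm_setT in h.
apply/eqP; rewrite -subr_eq0; apply/eqP/(@n2_eq0 _ _ dot).
rewrite n2B ripBr n2B (ripC _ x (E S x)) (ripC _ (E (~` S) x)).
rewrite (ripC _ x (E (~` S) x)) !pvm_rip //.
have -> : rip (E (~` S) x) (E S x) = 0; last lra.
by rewrite /reip pvm_sym // pvm_disj ?dot0r // setICl.
Qed.

Lemma pvm_bigcup0 x (F : nat -> set R) : (forall n, measurable (F n)) ->
  (forall n, E (F n) x = 0) -> E (\bigcup_n F n) x = 0.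
Proof.
move=> mF h0; apply: (@n2_eq0 _ _ dot); apply: EFin_inj.
have : (mu x).-negligible (\bigcup_n F n).
  apply: negligible_bigcup => n; apply/negligibleP => //.
  by rewrite /= /pvm_measure h0 n20.
by move=> /negligibleP; apply; exact: bigcup_measurable.
Qed.

Lemma pvm_null_integral S x (f : R -> \bar R) : measurable S ->
  measurable_fun [set: R] f -> E S x = 0 -> (\int[mu x]_(t in S) f t = 0)%E.
Proof.
move=> mS mf h0; apply: null_set_integral => //.
  exact: measurable_funTS.
by rewrite /= /pvm_measure h0 n20.
Qed.

(** The measure at E S x is the measure at x restricted to S. *)
Lemma pvm_restrict S x (f : R -> \bar R) : measurable S -> measurable_fun [set: R] f ->
  (\int[mu (E S x)]_t f t = \int[mu x]_(t in S) f t)%E.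
Proof.
move=> mS mf; have mC := measurableC mS.
rewrite -(setUv S) integral_setU ?setUv //; last first.
  by rewrite disj_set2E setICr.
rewrite (pvm_null_integral mC) ?adde0 //; last by apply: pvm_disj => //; rewrite setICl.
by apply: eq_measure_integral => A mA AS; rewrite /= /pvm_measure pvm_sub.
Qed.

Lemma pvm_integral_split S x (f : R -> \bar R) : measurable S -> measurable_fun [set: R] f ->
  (\int[mu x]_t f t = \int[mu (E S x)]_t f t + \int[mu (E (~` S) x)]_t f t)%E.
Proof.
move=> mS mf; have mC := measurableC mS.
rewrite !pvm_restrict // -[in LHS](setUv S) integral_setU ?setUv //.
by rewrite disj_set2E setICr.
Qed.

End Fixed.
End ProjectionValuedMeasures.

(** * Spectral measures of symmetric operators *)

Section SpectralMeasures.
Context (R : realType) (H : completeNormedModType R[i])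
  (dot : {dot H for Num.conj}).
Local Notation rip := (reip dot).
Local Notation iip := (imip dot).
Local Notation n2 := (nrm2 dot).
Local Notation positive := (pos_op dot).
Context (dotH : hilbert dot).
Implicit Types (x y z : H) (S T : set R) (G : operator H).

(** The common ground of the unbounded operator of (ii) and of states as everywhere defined
    operators, so that both are served by the same lemmas. *)
Definition symmetric_operator G := 
  [/\ dom G 0, (forall (a : R[i]) x y, dom G x -> dom G y ->
          dom G (a *: x + y) /\ G (a *: x + y) = a *: G x + G y) &
      forall x y, dom G x -> dom G y -> dot (G x) y = dot x (G y)].

Context (G : operator H) (Gsym : symmetric_operator G).
Context (E : set R -> H -> H) (GE : is_spectral_measure dot G E).

Lemma spectral_pvm : projection_valued_measure dot E.
Proof. by have [] := GE. Qed.
Let hE := spectral_pvm.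
Local Notation mu := (pvm_measure hE).

Lemma symD x y : dom G x -> dom G y -> dom G (x + y) /\ G (x + y) = G x + G y.
Proof.
by move=> dx dy; have [_ h _] := Gsym; have := h 1 x y dx dy; rewrite !scale1r.
Qed.
Lemma symZ (a : R[i]) x : dom G x -> dom G (a *: x) /\ G (a *: x) = a *: G x.
Proof.
move=> dx; have [h0 h _] := Gsym.
have G0 : G 0 = 0.
  have [_] := h 1 0 0 h0 h0; rewrite !scale1r addr0 => /esym/eqP.
  by rewrite -subr_eq0 addrK => /eqP.
by have := h a x 0 dx h0; rewrite !addr0 G0 addr0.
Qed.

Lemma spectral_domE x : dom G x <-> (\int[mu x]_t (t ^+ 2)%:E < +oo)%E.
Proof. by have [_ -> _] := GE; rewrite /= (scalar_integral hE). Qed.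

Lemma spectral_expect x : dom G x -> ((rip (G x) x)%:E = \int[mu x]_t t%:E)%E.
Proof. by have [_ _ h] := GE; move=> /h; rewrite (scalar_integral hE). Qed.

Lemma measurable_id_EFin : measurable_fun [set: R] (fun t : R => t%:E).
Proof. exact/measurable_EFinP. Qed.
Lemma measurable_sqr_EFin : measurable_fun [set: R] (fun t : R => (t ^+ 2)%:E).
Proof. by apply/measurable_EFinP; exact: measurable_funX. Qed.

Lemma spectral_dom_proj S x : measurable S -> dom G x -> dom G (E S x).
Proof.
move=> mS /spectral_domE dx; apply/spectral_domE.
rewrite (pvm_restrict hE) //; last exact: measurable_sqr_EFin.
apply: le_lt_trans dx; apply: ge0_subset_integral => //.
  exact: measurable_sqr_EFin.
by move=> t _; rewrite lee_fin sqr_ge0.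
Qed.

Lemma spectral_dom_bounded S x (c : R) : measurable S ->
  (forall t, S t -> t ^+ 2 <= c) -> dom G (E S x).
Proof.
move=> mS hc; apply/spectral_domE.
rewrite (pvm_restrict hE) //; last exact: measurable_sqr_EFin.
apply: (@le_lt_trans _ _ (\int[mu x]_(t in S) (cst c%:E) t)%E).
  apply: ge0_le_integral => //.
  - by move=> t _; rewrite lee_fin sqr_ge0.
  - by apply: measurable_funTS; exact: measurable_sqr_EFin.
by rewrite integral_cst // /= /pvm_measure -EFinM ltry.
Qed.

Lemma spectral_integrable x : dom G x -> (mu x).-integrable [set: R] (fun t : R => t%:E).
Proof.
move=> /spectral_domE dx.
apply: (@le_integrable _ _ _ _ _ _ _ (fun t : R => (t ^+ 2)%:E + 1)%E) => //.
- exact: measurable_id_EFin.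
- move=> t _ /=; rewrite lee_fin [leRHS]ger0_norm ?addr_ge0 ?sqr_ge0 //.
  have := sqr_ge0 (`|t| - 1); rewrite sqrrB real_normK ?num_real // expr1n.
  by have := normr_ge0 t; lra.
apply: integrableD => //.
  apply/integrableP; split; first exact: measurable_sqr_EFin.
  by under eq_integral do rewrite gee0_abs ?lee_fin ?sqr_ge0 //.
apply/integrableP; split => //.
under eq_integral do rewrite gee0_abs //.
by rewrite integral_cst // mul1e /= /pvm_measure ltry.
Qed.

Lemma spectral_cross S x : measurable S -> dom G x ->
  rip (G (E S x)) (E (~` S) x) = 0.
Proof.
move=> mS dx; have mC := measurableC mS.
have dy := spectral_dom_proj mS dx; have dy' := spectral_dom_proj mC dx.
have xE : x = E S x + E (~` S) x by rewrite (pvm_C hE) // addrC subrK.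
have h1 : rip (G x) x = rip (G (E S x)) (E S x) + rip (G (E (~` S) x)) (E (~` S) x).
  apply: EFin_inj; rewrite EFinD !spectral_expect //.
  by apply: pvm_integral_split => //; exact: measurable_id_EFin.
have [_ Gx] := symD dy dy'; rewrite -xE in Gx.
have [_ _ hs] := Gsym.
have h2 : rip (G x) x = rip (G (E S x) + G (E (~` S) x)) (E S x + E (~` S) x).
  by rewrite -Gx -xE.
move: h2; rewrite h1 !(ripDl, ripDr).
have -> : rip (G (E (~` S) x)) (E S x) = rip (G (E S x)) (E (~` S) x).
  by rewrite ripC /reip -hs.
lra.
Qed.

Lemma spectral_rip S x : measurable S -> dom G x ->
  ((rip (G x) (E S x))%:E = \int[mu x]_(t in S) t%:E)%E.
Proof.
move=> mS dx; have mC := measurableC mS.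
have dy := spectral_dom_proj mS dx; have dy' := spectral_dom_proj mC dx.
have xE : x = E S x + E (~` S) x by rewrite (pvm_C hE) // addrC subrK.
rewrite -(pvm_restrict hE x mS measurable_id_EFin).
rewrite -spectral_expect //; have [_ Gx] := symD dy dy'; rewrite -xE in Gx.
rewrite Gx ripDl; have [_ _ hs] := Gsym.
have -> : rip (G (E (~` S) x)) (E S x) = 0; last by rewrite addr0.
by rewrite /reip hs // -[LHS]/(rip _ _) ripC spectral_cross.
Qed.

Lemma spectral_upper S x (c : R) : measurable S -> dom G x ->
  (forall t, S t -> t <= c) -> rip (G x) (E S x) <= c * n2 (E S x).
Proof.
move=> mS dx hc; rewrite -lee_fin spectral_rip // EFinM.
rewrite -[leRHS](integral_cst (mu x) mS).
apply: le_integral => //.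
- apply: integrableS (spectral_integrable dx) => //.
- apply/integrableP; split => //.
  under eq_integral do rewrite /=.
  by rewrite integral_cst // /= /pvm_measure -EFinM ltry.
- by move=> t /set_mem St; rewrite lee_fin hc.
Qed.

Lemma spectral_lower S x (c : R) : measurable S -> dom G x ->
  (forall t, S t -> c <= t) -> c * n2 (E S x) <= rip (G x) (E S x).
Proof.
move=> mS dx hc; rewrite -lee_fin spectral_rip // EFinM.
rewrite -[leLHS](integral_cst (mu x) mS).
apply: le_integral => //.
- apply/integrableP; split => //.
  under eq_integral do rewrite /=.
  by rewrite integral_cst // /= /pvm_measure -EFinM ltry.
- apply: integrableS (spectral_integrable dx) => //.
- by move=> t /set_mem St; rewrite lee_fin hc.
Qed.

Section Eigenvector.
Context (e : H) (g : R) (de : dom G e) (Ge : G e = g%:C *: e).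

Let rip_eig S : measurable S -> rip (G e) (E S e) = g * n2 (E S e).
Proof. by move=> mS; rewrite Ge ripZl ripC (pvm_rip _ hE). Qed.

(** On S = [g + 1/(n+1), +oo[ the lower bound gives (g + 1/(n+1)) |E S e|^2 <= <G e, E S e> = g |E S
    e|^2, hence E S e = 0; then n varies. The half-line below g is symmetric. *)
Lemma eigenvector_above : E `]g, +oo[%classic e = 0.
Proof.
have -> : `]g, +oo[%classic = \bigcup_n `[g + n.+1%:R^-1, +oo[%classic :> set R.
  apply/seteqP; split=> [t|t [n _]] /=; rewrite !in_itv /= !andbT.
    by move=> /ltr_add_invr[n hn]; exists n => //=; rewrite in_itv /= andbT ltW.
  by apply: lt_le_trans; rewrite ltrDl invr_gt0.
apply: (pvm_bigcup0 hE) => n; first exact: measurable_itv.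
apply: (@n2_eq0 _ _ dot); apply/eqP; rewrite eq_le n2_ge0 andbT.
have mS : measurable (`[g + n.+1%:R^-1, +oo[%classic : set R) by exact: measurable_itv.
have := @spectral_lower _ e (g + n.+1%:R^-1) mS de.
rewrite rip_eig // mulrDl gerDl => h.
have n0 : 0 < n.+1%:R^-1 :> R by rewrite invr_gt0.
by rewrite -(pmulr_rle0 _ n0) h // => t /=; rewrite in_itv /= andbT.
Qed.

Lemma eigenvector_below : E `]-oo, g[%classic e = 0.
Proof.
have -> : `]-oo, g[%classic = \bigcup_n `]-oo, g - n.+1%:R^-1]%classic :> set R.
  apply/seteqP; split=> [t|t [n _]] /=; rewrite !in_itv /=.
    by move=> /ltr_add_invr[n hn]; exists n => //=; rewrite in_itv /= lerBrDr ltW.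
  by move=> /le_lt_trans; apply; rewrite gtrDl oppr_lt0 invr_gt0.
apply: (pvm_bigcup0 hE) => n; first exact: measurable_itv.
apply: (@n2_eq0 _ _ dot); apply/eqP; rewrite eq_le n2_ge0 andbT.
have mS : measurable (`]-oo, g - n.+1%:R^-1]%classic : set R) by exact: measurable_itv.
have := @spectral_upper _ e (g - n.+1%:R^-1) mS de.
rewrite rip_eig // mulrBl lerDl oppr_ge0 => h.
have n0 : 0 < n.+1%:R^-1 :> R by rewrite invr_gt0.
by rewrite -(pmulr_rle0 _ n0) h // => t /=; rewrite in_itv /=.
Qed.

Lemma eigenvector_notin S : measurable S -> ~ S g -> E S e = 0.
Proof.
move=> mS Sg.
have m1 : measurable (`]g, +oo[%classic : set R) by exact: measurable_itv.
have m2 : measurable (`]-oo, g[%classic : set R) by exact: measurable_itv.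
have h0 : E (`]-oo, g[%classic `|` `]g, +oo[%classic) e = 0.
  apply: (@n2_eq0 _ _ dot); rewrite (pvm_addU hE) //.
    by rewrite eigenvector_above eigenvector_below n20 addr0.
  apply/seteqP; split => // t [] /=; rewrite !in_itv /= andbT => h1 h2.
  by have := lt_trans h1 h2; rewrite ltxx.
rewrite -(pvm_sub hE e mS (measurableU _ _ m2 m1)).
  by rewrite h0 (pvm0 hE).
move=> t St /=; rewrite !in_itv /= andbT.
by case: (ltgtP t g) => [|| tg]; [left|right|rewrite tg in St].
Qed.

Lemma eigenvector_in S : measurable S -> S g -> E S e = e.
Proof.
move=> mS Sg; have := pvm_C hE e mS.
rewrite (eigenvector_notin (measurableC mS)); last by move=> h; exact: h.
by move/esym/eqP; rewrite subr_eq0 => /eqP.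
Qed.
End Eigenvector.

Section PositiveOperator.
Context (Gpos : forall x, dom G x -> 0 <= dot (G x) x) (Gdense : dense (dom G)).

(** The negative half-line is exhausted by bounded intervals away from 0. On such an interval y = E
    S x lies in the domain, and 0 <= <G y, y> <= - |y|^2 / (n+1). *)
Lemma positive_spectrum x : E `]-oo, 0[%classic x = 0.
Proof.
have -> : `]-oo, 0[%classic = \bigcup_n `[- n%:R, - n.+1%:R^-1]%classic :> set R.
  apply/seteqP; split=> [t|t [n _]] /=; rewrite !in_itv /=; last first.
    by move=> /andP[_ /le_lt_trans]; apply; rewrite oppr_lt0 invr_gt0.
  move=> t0; have s0 : 0 < - t by rewrite oppr_gt0.
  pose n := maxn (Num.truncn (- t)).+1 (Num.truncn (- t)^-1).+1.
  exists n => //=; rewrite in_itv /=; apply/andP; split.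
    rewrite lerNl (le_trans (ltW (truncnS_gt _))) // ler_nat leq_max leqnn //.
  rewrite lerNr -[leRHS]invrK lef_pV2 ?posrE ?invr_gt0 //.
  rewrite (le_trans (ltW (truncnS_gt _))) // ler_nat ltnW // ltnS leq_max leqnn orbT //.
apply: (pvm_bigcup0 hE) => n; first exact: measurable_itv.
set S := `[_, _]%classic.
have mS : measurable S by exact: measurable_itv.
have dS : dom G (E S x).
  apply: (@spectral_dom_bounded _ _ (n%:R ^+ 2)) => // t.
  rewrite /S /= in_itv /= => /andP[t1 t2].
  rewrite -[t ^+ 2]sqrrN lerXn2r ?nnegrE //; last by rewrite lerNl.
  by rewrite oppr_ge0 (le_trans t2) // oppr_le0 invr_ge0.
apply: (@n2_eq0 _ _ dot); apply/eqP; rewrite eq_le n2_ge0 andbT.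
have := @spectral_upper S (E S x) (- n.+1%:R^-1) mS dS.
rewrite (pvm_idem hE) // => h.
have : 0 <= rip (G (E S x)) (E S x).
  by have := Gpos dS; rewrite /reip lecE => /andP[].
have n0 : 0 < n.+1%:R^-1 :> R by rewrite invr_gt0.
rewrite -(pmulr_rle0 _ n0) -oppr_ge0 -mulNr => /le_trans; apply; apply: h => t.
by rewrite /S /= in_itv /= => /andP[].
Qed.

Section Truncation.
Context (S : set R) (mS : measurable S) (c : R) (c0 : 0 <= c)
  (Sc : forall t, S t -> 0 <= t <= c).

Definition truncation x : H := G (E S x).

Let dS x : dom G (E S x).
Proof.
apply: (@spectral_dom_bounded _ _ (c ^+ 2)) => // t /Sc /andP[t0 tc].
by rewrite lerXn2r.
Qed.

Lemma truncation_linear : linear truncation.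
Proof.
move=> a x y; rewrite /truncation (pvm_linear hE) //.
by have [_ /(_ a (E S x) (E S y) (dS x) (dS y))[]] := Gsym.
Qed.
Definition truncation_op : {linear H -> H} := HB.pack truncation
  (GRing.isLinear.Build R[i] H H _ truncation truncation_linear).

(** G maps the range of E S to itself. For v in the domain, [spectral_cross] at E S x + E
    (~[S) v shows that E (~] S) (G (E S x)) is orthogonal to v; the domain is dense. *)
Lemma truncation_range x : E S (truncation x) = truncation x.
Proof.
have mC := measurableC mS.
suff : E (~` S) (truncation x) = 0.
  by rewrite (pvm_C hE) // => /eqP; rewrite subr_eq0 => /eqP.
set z := E _ _; apply: (@n2_eq0 _ _ dot).
have zdom : forall v, dom G v -> dot v z = 0.
  suff h v : dom G v -> rip v z = 0.
    move=> v dv; rewrite dot_rip_iip h // -[iip v z]opprK -iipC iip_rip.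
    have [dv' _] := symZ 'i dv; rewrite (ripC _ z) h // oppr0 //.
  move=> dv; rewrite ripC /z /reip (pvm_sym hE) //.
  have SC : S `&` ~` S = set0 by rewrite setICr.
  have dv' := spectral_dom_proj mC dv.
  have [dx _] := symD (dS x) dv'.
  have := spectral_cross mS dx.
  rewrite !(pvmD _ _ hE) // (pvm_idem hE) // (pvm_disj hE) // addr0.
  by rewrite (pvm_disj hE) ?setICl // add0r (pvm_idem hE).
have : closure (dom G) z by move/dense_closure: Gdense => ->.
by rewrite /nrm2 /reip => /(closure_orth dotH zdom) ->.
Qed.

Lemma truncation_dot x : dot (truncation x) x = dot (G (E S x)) (E S x).
Proof. by rewrite -(pvm_sym hE) // truncation_range. Qed.

Lemma truncation_pos : positive truncation.
Proof. by move=> x; rewrite truncation_dot; exact: Gpos. Qed.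

Lemma truncation_rip x : ((rip (truncation x) x)%:E = \int[mu x]_(t in S) t%:E)%E.
Proof.
rewrite /reip truncation_dot -[complex.Re _]/(rip _ _) spectral_expect //.
by rewrite (pvm_restrict hE) //; exact: measurable_id_EFin.
Qed.

Lemma truncation_le x : rip (truncation x) x <= c * n2 x.
Proof.
rewrite /reip truncation_dot -[complex.Re _]/(rip _ _).
have := @spectral_upper S (E S x) c mS (dS x); rewrite (pvm_idem hE) // => h.
apply: (@le_trans _ _ (c * n2 (E S x))); first by apply: h => t /Sc /andP[].
by rewrite ler_wpM2l // (pvm_le hE).
Qed.

Lemma truncation_bounded x : n2 (truncation x) <= c ^+ 2 * n2 x.
Proof.
apply: (le_trans (pos_n2 (A := truncation_op) truncation_pos truncation_le x)).
by rewrite expr2 -mulrA ler_wpM2l // truncation_le.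
Qed.

End Truncation.
End PositiveOperator.
End SpectralMeasures.

(** * Traces *)

Section Traces.
Context (R : realType) (H : completeNormedModType R[i])
  (dot : {dot H for Num.conj}).
Local Notation rip := (reip dot).
Local Notation n2 := (nrm2 dot).
Local Notation positive := (pos_op dot).
Context (dotH : hilbert dot).
Context (h : nat -> H) (hh : enumerates dot h (hbasis dot)) (htot : total dot h).
Implicit Types (x y z : H) (q : H -> \bar R).

Lemma usum_ge0 (B : set H) q : (forall e, B e -> (0 <= q e)%E) ->
  usum B q = (\esum_(e in B) q e)%E.
Proof.
move=> q0; rewrite /usum [X in (_ - X)%E](_ : _ = 0%E) ?sube0.
  by apply: eq_esum => e Be; rewrite (ge0_funeposE q0) ?inE.
by apply: esum1 => e Be; rewrite (ge0_funenegE q0) ?inE.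
Qed.

Lemma trace_ge0 q : (forall e, (0 <= q e)%E) -> q 0 = 0%E ->
  trace dot q = (\sum_(0 <= k <oo) q (h k))%E.
Proof. by move=> q0 q00; rewrite /trace usum_ge0 // (esum_enum hh). Qed.

Section DiagonalState.
Context (rho : {linear H -> H}) (rho_pos : positive rho).
Context (b : nat -> H) (bON : on_seq dot b) (btot : total dot b).
Context (l : nat -> R) (l0 : forall k, 0 <= l k)
  (rhob : forall k, rho (b k) = (l k)%:C *: b k).

(** By symmetry of A, both sides are the double sum of l_k |<h_j, A b_k>|^2. *)
Lemma trace_form (A : {linear H -> H}) :
  (forall x y, dot (A x) y = dot x (A y)) ->
  (\sum_(0 <= j <oo) (rip (rho (A (h j))) (A (h j)))%:E =
   \sum_(0 <= k <oo) (l k * n2 (A (b k)))%:E)%E.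
Proof.
move=> As; under eq_eseriesr do rewrite (diag_rip dotH rho_pos bON btot rhob).
rewrite nneseries_interchange; last by move=> i j; rewrite lee_fin mulr_ge0 ?sq_ge0.
apply: eq_eseriesr => k _.
under eq_eseriesr => j _ do rewrite !sqE As -sqE sqC EFinM.
rewrite nneseriesZl; last by move=> i _; rewrite lee_fin sq_ge0.
by rewrite (parseval dotH hh.1 htot).
Qed.

Context (A : {linear H -> H}) (A_pos : positive A) (M : R)
  (A_bnd : forall x, n2 (A x) <= M * n2 x)
  (lsum : (\sum_(0 <= k <oo) (l k * n2 (b k))%:E < +oo)%E).

(* 4 Re <rho e, A e> is the difference of the quadratic form of rho at e + A e
   and at e - A e, both of which have a finite trace. *)
Lemma tr_mul : tr dot (fun x => A (rho x)) =
  (\sum_(0 <= k <oo) (l k * rip (A (b k)) (b k))%:E)%E.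
Proof.
pose P : {linear H -> H} := @idfun H \+ A.
pose N : {linear H -> H} := @idfun H \- A.
pose p e := (4^-1 * rip (rho (P e)) (P e))%:E : \bar R.
pose n e := (4^-1 * rip (rho (N e)) (N e))%:E : \bar R.
have i4 : 0 <= 4^-1 :> R by rewrite invr_ge0.
have p0 e : (0 <= p e)%E by rewrite lee_fin mulr_ge0 // (pos_rip_ge0 rho_pos).
have n0 e : (0 <= n e)%E by rewrite lee_fin mulr_ge0 // (pos_rip_ge0 rho_pos).
have Ps x y : dot (P x) y = dot x (P y).
  by rewrite /= dotDl dotDr (pos_sym A_pos).
have Ns x y : dot (N x) y = dot x (N y).
  by rewrite /= dotBl dotBr (pos_sym A_pos).
have hform (Q : {linear H -> H}) : (forall x y, dot (Q x) y = dot x (Q y)) ->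
    (\esum_(e in hbasis dot) (4^-1 * rip (rho (Q e)) (Q e))%:E =
     \sum_(0 <= k <oo) (4^-1 * (l k * n2 (Q (b k))))%:E)%E.
  move=> Qs; rewrite (esum_enum hh).
  - under eq_eseriesr do rewrite EFinM.
    rewrite nneseriesZl; last by move=> i _; rewrite lee_fin (pos_rip_ge0 rho_pos).
    rewrite trace_form // -nneseriesZl //.
    by move=> i _; rewrite lee_fin mulr_ge0 ?n2_ge0.
  - by move=> x; rewrite lee_fin mulr_ge0 // (pos_rip_ge0 rho_pos).
  - by rewrite !linear0 rip0l mulr0.
have hfin (Q : {linear H -> H}) : (forall x y, dot (Q x) y = dot x (Q y)) ->
    (exists2 K : R, 0 <= K & forall x, n2 (Q x) <= K * n2 x) ->
    (\esum_(e in hbasis dot) (4^-1 * rip (rho (Q e)) (Q e))%:E < +oo)%E.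
  move=> Qs [K K0 hK]; rewrite hform //.
  apply: (@le_lt_trans _ _ (\sum_(0 <= k <oo) (4^-1 * K)%:E * (l k * n2 (b k))%:E)%E).
    apply: lee_nneseries => [k _ _|k _]; first by rewrite lee_fin !mulr_ge0 ?n2_ge0.
    rewrite -EFinM lee_fin -mulrA ler_wpM2l //.
    by rewrite (mulrCA K) ler_wpM2l.
  rewrite nneseriesZl; last by move=> i _; rewrite lee_fin mulr_ge0 ?n2_ge0.
  by apply: lte_mul_pinfty => //; rewrite lee_fin mulr_ge0.
have M0 : 0 <= Num.max M 0 by rewrite le_max lexx orbT.
have hM x : n2 (A x) <= Num.max M 0 * n2 x.
  by apply: (le_trans (A_bnd x)); rewrite ler_wpM2r ?n2_ge0 // le_max lexx.
have Pf : (\esum_(e in hbasis dot) p e < +oo)%E.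
  apply: hfin => //; exists (2 * (1 + Num.max M 0)) => [|x]; first by rewrite mulr_ge0 ?addr_ge0.
  by apply: (le_trans (n2D_le _ _ _)); have := hM x; lra.
have Nf : (\esum_(e in hbasis dot) n e < +oo)%E.
  apply: hfin => //; exists (2 * (1 + Num.max M 0)) => [|x]; first by rewrite mulr_ge0 ?addr_ge0.
  by apply: (le_trans (n2D_le _ _ _)); rewrite n2N; have := hM x; lra.
have -> : tr dot (fun x => A (rho x)) = usum (hbasis dot) (p \- n)%E.
  congr usum; apply/funext => e; rewrite /expect /p /n -EFinB; congr (_%:E).
  have hA : rip (A (rho e)) e = rip (rho e) (A e) by rewrite /reip (pos_sym A_pos).
  rewrite -[complex.Re _]/(rip (A (rho e)) e) hA -[P e]/(e + A e) -[N e]/(e - A e).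
  rewrite linearD linearB !(ripDl, ripDr, ripBl, ripBr, ripNl, ripNr).
  by rewrite (pos_rip_sym rho_pos (A e) e); field.
rewrite /usum esumB /summable //; last 2 first.
- by under eq_esum do rewrite gee0_abs //.
- by under eq_esum do rewrite gee0_abs //.
rewrite !hform // in Pf Nf *.
(* Termwise |b + A b|^2 = |b - A b|^2 + 4 <A b, b>; all series are nonnegative, and the subtracted
   one is finite. *)
have -> : (\sum_(0 <= k <oo) (4^-1 * (l k * n2 (P (b k))))%:E =
    \sum_(0 <= k <oo) (l k * rip (A (b k)) (b k))%:E +
    \sum_(0 <= k <oo) (4^-1 * (l k * n2 (N (b k))))%:E)%E.
  rewrite -nneseriesD.
  - apply: eq_eseriesr => k _; rewrite -EFinD; congr (_%:E).
    by rewrite /= n2B n2D (ripC _ (b k) (A (b k))); field.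
  - by move=> k _ _; rewrite lee_fin mulr_ge0 // (pos_rip_ge0 A_pos).
  - by move=> k _ _; rewrite lee_fin !mulr_ge0 ?n2_ge0.
rewrite addeK // ge0_fin_numE //; apply: nneseries_ge0 => k _ _.
by rewrite lee_fin !mulr_ge0 ?n2_ge0.
Qed.

End DiagonalState.
End Traces.

(** * Diagonal operators *)

Section AtomicMeasures.
Context (R : realType).
Implicit Types (c g : nat -> R) (f : R -> \bar R).

Definition atomic c (c0 : forall k, 0 <= c k) g : set R -> \bar R :=
  mseries (fun k => mscale (NngNum (c0 k)) (dirac (g k))) 0.
HB.instance Definition _ c (c0 : forall k, 0 <= c k) g := Measure.on (atomic c0 g).

Lemma atomicE c (c0 : forall k, 0 <= c k) g S :
  atomic c0 g S = (\sum_(0 <= k <oo) (c k * \1_S (g k))%:E)%E.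
Proof. by []. Qed.

Lemma ge0_atomic_integral c (c0 : forall k, 0 <= c k) g f :
  measurable_fun [set: R] f -> (forall t, (0 <= f t)%E) ->
  (\int[atomic c0 g]_t f t = \sum_(0 <= k <oo) (c k)%:E * f (g k))%E.
Proof.
move=> mf f0; rewrite ge0_integral_measure_series //.
apply: eq_eseriesr => k _; rewrite ge0_integral_mscale //= integral_dirac //.
by rewrite diracT mul1e.
Qed.

(** Nonnegativity of f is asked only at the atoms, because functions such as [- (t * ln t)] change
    sign on the line; the negative part is null for the measure. *)
Lemma atomic_integral (m : set R -> \bar R) c g f : (forall k, 0 <= c k) ->
  (forall S, measurable S -> m S = \sum_(0 <= k <oo) (c k * \1_S (g k))%:E)%E ->
  measurable_fun [set: R] f -> (forall k, (0 <= f (g k))%E) ->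
  (\int[m]_t f t = \sum_(0 <= k <oo) (c k)%:E * f (g k))%E.
Proof.
move=> c0 hm mf f0.
have -> : (\int[m]_t f t = \int[atomic c0 g]_t f t)%E by exact: eq_setfun_integral.
rewrite integralE !ge0_atomic_integral //; last 2 first.
- exact: measurable_funeneg.
- exact: measurable_funepos.
rewrite [X in (_ - X)%E]eseries0 ?sube0.
  apply: eq_eseriesr => k _; congr (_ * _)%E.
  by rewrite (@ge0_funeposE _ _ [set g k]) ?inE // => _ ->.
move=> k _ _; rewrite (@ge0_funenegE _ _ [set g k]) ?inE ?mule0 // => _ ->.
exact: f0.
Qed.

End AtomicMeasures.

Section DiagonalOperators.
Context (R : realType) (H : completeNormedModType R[i])
  (dot : {dot H for Num.conj}).
Local Notation rip := (reip dot).
Local Notation iip := (imip dot).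
Local Notation sq := (sqip dot).
Context (dotH : hilbert dot) (b : nat -> H) (bON : on_seq dot b) (btot : total dot b).
Implicit Types (x y z : H) (m g : nat -> R) (S : set R) (G : operator H).

Lemma conj_realM (c : R) (a : R[i]) : (c%:C * a)^*%C = c%:C * a^*%C.
Proof. by rewrite rmorphM; congr (_ * _); exact: conjc_real. Qed.

(* Equal to 0 outside diag_dom m. *)
Definition diag m x : H := xget 0 [set y | forall k, dot y (b k) = (m k)%:C * dot x (b k)].
Definition diag_dom m : set H :=
  [set x | (\sum_(0 <= k <oo) (m k ^+ 2 * sq x (b k))%:E < +oo)%E].

Lemma diag_dot m x k : diag_dom m x -> dot (diag m x) (b k) = (m k)%:C * dot x (b k).
Proof.
move=> hs; rewrite /diag; case: xgetP => [y _ //|/= hn].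
have [||y _ hy] := riesz_fischer dotH bON (c := fun k => (m k)%:C * dot x (b k)).
- by move=> j bj; rewrite bj dot0r mulr0.
- apply: le_lt_trans hs; apply: lee_nneseries => [j _ _|j _].
    by rewrite lee_fin cabs2_ge0.
  by rewrite lee_fin cabs2M cabs2R.
by case: (hn y).
Qed.

Lemma diag_unique m x y : diag_dom m x ->
  (forall k, dot y (b k) = (m k)%:C * dot x (b k)) -> diag m x = y.
Proof. by move=> dx hy; apply: (on_ext btot) => k; rewrite diag_dot. Qed.

Lemma diag_dom_lin m (a : R[i]) x y : diag_dom m x -> diag_dom m y ->
  diag_dom m (a *: x + y).
Proof.
move=> dx dy; rewrite /diag_dom /=.
have hx : (\sum_(0 <= k <oo) (2 * cabs2 a)%:E * (m k ^+ 2 * sq x (b k))%:E < +oo)%E.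
  rewrite nneseriesZl; last by move=> k _; rewrite lee_fin mulr_ge0 ?sqr_ge0 ?sq_ge0.
  by apply: lte_mul_pinfty => //; rewrite lee_fin mulr_ge0 ?cabs2_ge0.
have hy : (\sum_(0 <= k <oo) 2%:E * (m k ^+ 2 * sq y (b k))%:E < +oo)%E.
  rewrite nneseriesZl; last by move=> k _; rewrite lee_fin mulr_ge0 ?sqr_ge0 ?sq_ge0.
  exact: lte_mul_pinfty.
apply: le_lt_trans (lte_add_pinfty hx hy); rewrite -nneseriesD.
- apply: lee_nneseries => [k _ _|k _]; first by rewrite lee_fin mulr_ge0 ?sqr_ge0 ?sq_ge0.
  rewrite -!EFinM -EFinD lee_fin.
  have : sq (a *: x + y) (b k) <= 2 * (cabs2 a * sq x (b k) + sq y (b k)).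
    rewrite -sqZl /sqip !(ripDl, iipDl).
    have := sqr_ge0 (rip (a *: x) (b k) - rip y (b k)).
    have := sqr_ge0 (iip (a *: x) (b k) - iip y (b k)); nra.
  by move=> /(ler_wpM2l (sqr_ge0 (m k))); lra.
- by move=> k _ _; apply: mule_ge0; rewrite lee_fin mulr_ge0 ?sqr_ge0 ?sq_ge0 ?cabs2_ge0.
- by move=> k _ _; rewrite -EFinM lee_fin mulr_ge0 // mulr_ge0 ?sqr_ge0 ?sq_ge0.
Qed.

Lemma diag_lin m (a : R[i]) x y : diag_dom m x -> diag_dom m y ->
  diag m (a *: x + y) = a *: diag m x + diag m y.
Proof.
move=> dx dy; apply: diag_unique; first exact: diag_dom_lin.
by move=> k; rewrite !dotDl !dotZl !diag_dot // mulrDr mulrCA.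
Qed.

Lemma diag_dom_bounded m (M : R) x : (forall k, m k ^+ 2 <= M) -> diag_dom m x.
Proof.
move=> hM; have M0 : 0 <= M by apply: le_trans (hM 0%N); exact: sqr_ge0.
apply: (@le_lt_trans _ _ (\sum_(0 <= k <oo) M%:E * (sq x (b k))%:E)%E).
  apply: lee_nneseries => [k _ _|k _]; first by rewrite lee_fin mulr_ge0 ?sqr_ge0 ?sq_ge0.
  by rewrite -EFinM lee_fin ler_wpM2r ?sq_ge0.
rewrite nneseriesZl; last by move=> k _; rewrite lee_fin sq_ge0.
by rewrite (parseval dotH bON btot) -EFinM ltry.
Qed.

Lemma diag_dom_b m k : diag_dom m (b k).
Proof.
rewrite /diag_dom /= (@nneseriesD1 _ _ k xpredT) //; last first.
  by move=> j _; rewrite lee_fin mulr_ge0 ?sqr_ge0 ?sq_ge0.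
rewrite eseries0 ?adde0 ?ltry // => j _ jk.
by rewrite sqE (on_orth bON) 1?eq_sym // /cabs2 /= expr0n addr0 mulr0.
Qed.

Lemma diag_b m k : diag m (b k) = (m k)%:C *: b k.
Proof.
apply: diag_unique; first exact: diag_dom_b.
move=> j; rewrite dotZl; have [->//|kj] := eqVneq k j.
by rewrite (on_orth bON kj) !mulr0.
Qed.

Lemma rip_eq_dot x y x' y' :
  (forall k, dot x (b k) * dot (b k) y = dot x' (b k) * dot (b k) y') -> rip x y = rip x' y'.
Proof.
move=> he; have h1 := rip_expansion dotH bON btot (x := x) (y := y).
have h2 := rip_expansion dotH bON btot (x := x') (y := y').
rewrite -(cvg_lim _ h1) // -(cvg_lim _ h2) //; congr (limn _); congr series.
by apply/funext => k; rewrite he.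
Qed.

(** The real parts agree term by term in the expansions; ['i *: y] in place of y yields the
    imaginary parts. *)
Lemma diag_sym m x y : diag_dom m x -> diag_dom m y ->
  dot (diag m x) y = dot x (diag m y).
Proof.
suff h z : forall x, diag_dom m x -> diag_dom m z -> rip (diag m x) z = rip x (diag m z).
  move=> dx dy; rewrite !dot_rip_iip h // !iip_rip.
  have d0 : diag_dom m 0.
    by rewrite /diag_dom /= eseries0 ?ltry // => k _ _; rewrite sq0l mulr0.
  have := diag_lin 'i dy d0; have := diag_dom_lin 'i dy d0; rewrite !addr0 => diy.
  rewrite (_ : diag m 0 = 0) ?addr0 => [<-|]; first by rewrite h.
  by apply: diag_unique => // k; rewrite !dot0l mulr0.
move=> {}x dx dz; apply: rip_eq_dot => k.
have hk : dot (b k) (diag m z) = (m k)%:C * dot (b k) z.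
  by rewrite (dotC _ (b k)) diag_dot // conj_realM -dotC.
by rewrite diag_dot // hk; ring.
Qed.

Lemma diag_rip_series m x : diag_dom m x -> (forall k, 0 <= m k) ->
  ((rip (diag m x) x)%:E = \sum_(0 <= k <oo) (m k * sq x (b k))%:E)%E.
Proof.
move=> dx m0; apply/esym/EFin_series.
have := rip_expansion dotH bON btot (x := diag m x) (y := x).
have -> // : (fun k => complex.Re (dot (diag m x) (b k) * dot (b k) x)) =
  (fun k => m k * sq x (b k)).
by apply/funext => k; rewrite diag_dot // -mulrA dot_mulC -rmorphM.
Qed.

Lemma diag_ge0 m x : diag_dom m x -> (forall k, 0 <= m k) -> 0 <= dot (diag m x) x.
Proof.
move=> dx m0; have hr : 0 <= rip (diag m x) x.
  rewrite -lee_fin diag_rip_series // nneseries_ge0 // => k _ _.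
  by rewrite lee_fin mulr_ge0 ?sq_ge0.
have hi : iip (diag m x) x = 0.
  have := diag_sym dx dx; rewrite (dotC _ x) dot_rip_iip /= => -[h].
  by lra.
by rewrite dot_rip_iip hi lecE /= eqxx.
Qed.

Section SpectralMeasure.
Context (g : nat -> R) (g0 : forall k, 0 <= g k).

Definition diag_pvm S : H -> H := diag (fun k => \1_S (g k)).

Lemma indic_bounded S k : (\1_S (g k) : R) ^+ 2 <= 1.
Proof. by rewrite indicE; case: (_ \in _); rewrite ?expr1n ?expr0n. Qed.

Let dS S x : diag_dom (fun k => \1_S (g k)) x.
Proof. by apply: (@diag_dom_bounded _ 1) => k; exact: indic_bounded. Qed.

Lemma diag_pvm_measure S x :
  scalar_measure dot diag_pvm x S = (\sum_(0 <= k <oo) (sq x (b k) * \1_S (g k))%:E)%E.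
Proof.
rewrite /scalar_measure /expect -[complex.Re _]/(rip _ _).
rewrite diag_rip_series => [|//|k]; last by rewrite indicE ler0n.
by apply: eq_eseriesr => k _; rewrite mulrC.
Qed.

Lemma diag_pvmP : projection_valued_measure dot diag_pvm.
Proof.
split.
- move=> S _; split.
  + by move=> a x y; rewrite /diag_pvm diag_lin.
  + move=> x; apply: diag_unique => // k; rewrite /diag_pvm diag_dot //.
    by rewrite indicE; case: (_ \in _); rewrite ?mul1r // !mul0r.
  + by move=> x y; rewrite /diag_pvm diag_sym.
- apply/funext => x; apply: diag_unique => // k.
  by rewrite dot0l indicE in_set0 mul0r.
- apply/funext => x; apply: diag_unique => // k.
  by rewrite indicE in_setT mul1r.
- move=> x; have -> : scalar_measure dot diag_pvm x =
      atomic (fun k => sq_ge0 dot x (b k)) g.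
    by apply/funext => S; rewrite diag_pvm_measure atomicE.
  exact: measure_semi_sigma_additive.
Qed.

(** The measure at x has mass |<x, b_k>|^2 at g_k, so its second moment is the series that defines
    [diag_dom g]. *)
Lemma diag_spectral_measure G : dom G = diag_dom g ->
  (forall x, dom G x -> G x = diag g x) -> is_spectral_measure dot G diag_pvm.
Proof.
move=> dG hG; have hm x (S : set R) (_ : measurable S) := diag_pvm_measure S x.
split; first exact: diag_pvmP.
  rewrite dG; apply/seteqP; split=> x; rewrite /= /diag_dom /=;
    rewrite (atomic_integral (fun k => sq_ge0 dot x (b k)) (hm x)).
  - by under [in X in X -> _]eq_eseriesr do rewrite mulrC EFinM.
  - by apply/measurable_EFinP; exact: measurable_funX.
  - by move=> k; rewrite lee_fin sqr_ge0.
  - by under [in X in _ -> X]eq_eseriesr do rewrite mulrC EFinM.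
  - by apply/measurable_EFinP; exact: measurable_funX.
  - by move=> k; rewrite lee_fin sqr_ge0.
move=> x dx; rewrite (atomic_integral (fun k => sq_ge0 dot x (b k)) (hm x)).
- rewrite /expect hG // -[complex.Re _]/(rip _ _) diag_rip_series //; last by rewrite -dG.
  by apply: eq_eseriesr => k _; rewrite mulrC EFinM.
- exact: measurable_id_EFin.
- by move=> k; rewrite lee_fin.
Qed.

Definition diag_operator : operator H := Operator (diag_dom g) (diag g).

Lemma diag_positive_operator : positive_operator dot diag_operator.
Proof.
split.
- split; first by rewrite /= /diag_dom /= eseries0 ?ltry // => k _ _; rewrite sq0l mulr0.
  by move=> a x y dx dy; split; [exact: diag_dom_lin|exact: diag_lin].
- apply/dense_closure/seteqP; split => // x _.
  apply: (hcvg_closure dotH _ (expansion dotH bON btot x)) => n.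
  rewrite /psum; elim: n => [|n IH].
    by rewrite big_ord0 /= /diag_dom /= eseries0 ?ltry // => k _ _; rewrite sq0l mulr0.
  rewrite big_ord_recr /= addrC; apply: diag_dom_lin => //; exact: diag_dom_b.
- move=> y z; split => [hyz|[dy <-] x dx]; last exact: diag_sym.
  have hz k : dot z (b k) = (g k)%:C * dot y (b k).
    rewrite dotC -(hyz (b k) (diag_dom_b g k)) /= diag_b dotZl conj_realM.
    by rewrite -dotC.
  (* Bessel's inequality for z is the summability that puts y in the domain; this makes the operator
     self-adjoint and not only symmetric. *)
  have dy : diag_dom g y.
    rewrite /diag_dom /=; have := bessel bON z.
    under eq_eseriesr do rewrite sqE hz cabs2M cabs2R -sqE.
    by move=> /le_lt_trans; apply; rewrite ltry.
  by split => //; exact: diag_unique.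
- by move=> x dx; exact: diag_ge0.
Qed.

End SpectralMeasure.
End DiagonalOperators.

(** * Functional calculus *)

Section FunctionalCalculus.
Context (R : realType) (H : completeNormedModType R[i])
  (dot : {dot H for Num.conj}).
Local Notation n2 := (nrm2 dot).
Local Notation sq := (sqip dot).
Local Notation positive := (pos_op dot).
Context (dotH : hilbert dot).
Implicit Types (x y z : H) (S : set R) (f : R -> R) (b : nat -> H).

Lemma positive_operator_sym (G : operator H) : positive_operator dot G ->
  symmetric_operator dot G.
Proof.
move=> [[d0 hl] _ ha _]; split => // x y dx dy.
by have [_ h] := ha y (G y); rewrite (h (conj dy erefl)).
Qed.

Lemma everywhere_sym (A : {linear H -> H}) : positive A ->
  symmetric_operator dot (everywhere A).
Proof.
by move=> Apos; split => // [a x y _ _|x y _ _]; [rewrite /= linearP|exact: pos_sym].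
Qed.

Section Operator.
Context (G : operator H) (Gsym : symmetric_operator dot G)
  (Gex : exists E, is_spectral_measure dot G E).

Lemma spectral_measureP : is_spectral_measure dot G (spectral_measure dot G).
Proof. exact: (@xgetPex _ _ (is_spectral_measure dot G)). Qed.

Let GE := spectral_measureP.
Local Notation E := (spectral_measure dot G).
Definition spectral_mu := pvm_measure (spectral_pvm GE).
HB.instance Definition _ x := Measure.on (spectral_mu x).
Local Notation mu := spectral_mu.

Lemma fexpectE f x : fexpect dot G f x = (\int[mu x]_t (f t)%:E)%E.
Proof. by rewrite /fexpect (scalar_integral (spectral_pvm GE)). Qed.

Lemma fexpect0 f : measurable_fun [set: R] f -> fexpect dot G f 0 = 0%E.
Proof.
move=> mf; rewrite fexpectE pvm_null_integral //; last by rewrite (pvm0 (spectral_pvm GE)).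
exact/measurable_EFinP.
Qed.

(** The set function S -> Tr E(S) does not depend on the basis: both sides are the double sum of |<E
    S b1_k, b2_j>|^2. *)
Lemma spectral_sum (b1 b2 : nat -> H) : on_seq dot b1 -> total dot b1 ->
  on_seq dot b2 -> total dot b2 -> forall S, measurable S ->
  mseries (fun k => mu (b1 k)) 0 S = mseries (fun k => mu (b2 k)) 0 S.
Proof.
move=> o1 t1 o2 t2 S mS; rewrite /mseries /mu /pvm_measure.
transitivity (\sum_(0 <= k <oo) \sum_(0 <= j <oo) (sq (E S (b1 k)) (b2 j))%:E)%E.
  by apply: eq_eseriesr => k _; rewrite (parseval dotH o2 t2).
rewrite nneseries_interchange; last by move=> i j; rewrite lee_fin sq_ge0.
apply: eq_eseriesr => k _; apply: etrans (parseval dotH o1 t1 _).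
apply: eq_eseriesr => j _; congr (_%:E).
by rewrite sqC !sqE (pvm_sym (spectral_pvm GE)).
Qed.

Lemma ge0_spectral_series (b1 b2 : nat -> H) f : on_seq dot b1 -> total dot b1 ->
  on_seq dot b2 -> total dot b2 -> measurable_fun [set: R] f -> (forall t, 0 <= f t) ->
  (\sum_(0 <= k <oo) \int[mu (b1 k)]_t (f t)%:E =
   \sum_(0 <= k <oo) \int[mu (b2 k)]_t (f t)%:E)%E.
Proof.
move=> o1 t1 o2 t2 mf f0; have mfE : measurable_fun [set: R] (EFin \o f) by exact/measurable_EFinP.
rewrite -(@ge0_integral_measure_series _ _ _ (fun k => mu (b1 k)) setT) //; last by move=> t _; rewrite lee_fin.
rewrite -(@ge0_integral_measure_series _ _ _ (fun k => mu (b2 k)) setT) //; last by move=> t _; rewrite lee_fin.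
by apply: eq_measure_integral => S mS _; exact: spectral_sum.
Qed.

Section Hbasis.
Context (h : nat -> H) (hh : enumerates dot h (hbasis dot)) (htot : total dot h).

Lemma ge0_ftrace b f : on_seq dot b -> total dot b ->
  measurable_fun [set: R] f -> (forall t, 0 <= f t) ->
  ftrace dot G f = (\sum_(0 <= k <oo) \int[mu (b k)]_t (f t)%:E)%E.
Proof.
move=> bON btot mf f0; rewrite /ftrace (trace_ge0 hh).
- under eq_eseriesr do rewrite fexpectE.
  exact: (ge0_spectral_series hh.1 htot).
- by move=> e; rewrite fexpectE integral_ge0 // => t _; rewrite lee_fin.
- exact: fexpect0.
Qed.

Section Diagonal.
Context (b : nat -> H) (bON : on_seq dot b) (btot : total dot b) (g : nat -> R)
  (bdom : forall k, dom G (b k)) (Gb : forall k, G (b k) = (g k)%:C *: b k).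

(** A spectral measure of G fixes b_k if g_k is in S and kills it otherwise, so the one selected by
    [xget] is determined on a basis. Parseval turns |E S x|^2 into a sum of point masses. *)
Lemma spectral_mu_diag x S : measurable S ->
  mu x S = (\sum_(0 <= k <oo) (sq x (b k) * \1_S (g k))%:E)%E.
Proof.
move=> mS; rewrite /mu /pvm_measure -(parseval dotH bON btot).
apply: eq_eseriesr => k _; congr (_%:E).
rewrite !sqE (pvm_sym (spectral_pvm GE)) // indicE.
case: (boolP (g k \in S)) => [/set_mem gS|/negP gS].
  by rewrite (eigenvector_in Gsym GE (bdom k) (Gb k)) // mulr1.
rewrite (eigenvector_notin Gsym GE (bdom k) (Gb k)) // => [|/mem_set //].
by rewrite mulr0 -sqE sq0r.
Qed.

Lemma fexpect_diag f x : measurable_fun [set: R] f -> (forall k, 0 <= f (g k)) ->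
  fexpect dot G f x = (\sum_(0 <= k <oo) (f (g k) * sq x (b k))%:E)%E.
Proof.
move=> mf f0; rewrite fexpectE.
rewrite (atomic_integral (fun k => sq_ge0 dot x (b k)) (@spectral_mu_diag x)) //.
  by apply: eq_eseriesr => k _; rewrite mulrC.
exact/measurable_EFinP.
Qed.

Lemma ftrace_diag f : measurable_fun [set: R] f -> (forall k, 0 <= f (g k)) ->
  ftrace dot G f = (\sum_(0 <= k <oo) (f (g k) * n2 (b k))%:E)%E.
Proof.
move=> mf f0; rewrite /ftrace (trace_ge0 hh).
- under eq_eseriesr do rewrite fexpect_diag //.
  rewrite nneseries_interchange; last by move=> i j; rewrite lee_fin mulr_ge0 ?sq_ge0.
  apply: eq_eseriesr => k _; under eq_eseriesr do rewrite sqC EFinM.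
  rewrite nneseriesZl; last by move=> i _; rewrite lee_fin sq_ge0.
  by rewrite (parseval dotH hh.1 htot).
- move=> e; rewrite fexpect_diag // nneseries_ge0 // => k _ _.
  by rewrite lee_fin mulr_ge0 ?sq_ge0.
- exact: fexpect0.
Qed.

End Diagonal.
End Hbasis.

(** The measure at a unit eigenvector is the Dirac mass at its eigenvalue, so f may have any
    sign. *)
Lemma fexpect_eigenvector f e (g : R) : measurable_fun [set: R] f ->
  dom G e -> G e = g%:C *: e -> n2 e = 1 -> fexpect dot G f e = (f g)%:E.
Proof.
move=> mf de Ge e1; rewrite fexpectE.
have -> : (\int[mu e]_t (f t)%:E = \int[\d_g]_t (f t)%:E)%E.
  apply: eq_setfun_integral => S mS; rewrite /mu /pvm_measure diracE.
  case: (boolP (g \in S)) => [/set_mem gS|/negP gS].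
    by rewrite (eigenvector_in Gsym GE de Ge) // e1.
  by rewrite (eigenvector_notin Gsym GE de Ge) ?n20 // => /mem_set.
rewrite integral_dirac // ?diracT ?mul1e //; exact/measurable_EFinP.
Qed.

End Operator.
End FunctionalCalculus.

(** * Eigenbases and spectral measures of states *)

Section States.
Context (R : realType) (H : completeNormedModType R[i])
  (dot : {dot H for Num.conj}).
Local Notation rip := (reip dot).
Local Notation positive := (pos_op dot).
Context (dotH : hilbert dot) (Hsep : separable_space H).
Context (rho : {linear H -> H}) (rho_state : state dot rho).

Lemma state_pos : positive rho.
Proof. by case: rho_state. Qed.

(** The existence of an orthonormal basis is read off from the unit trace: with the default value
    [set0] of [xget] the trace would be 0. *)
Lemma state_hbasis : orthonormal_basis dot setT (hbasis dot).
Proof.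
case: rho_state => _ _; rewrite /tr /trace /hbasis; case: xgetP => [B -> //|hn].
by rewrite /usum !esum_set0 sube0 => /eqP; rewrite eq_sym onee_eq0.
Qed.

Lemma state_enum : exists2 h : nat -> H, enumerates dot h (hbasis dot) &
  [/\ total dot h, traceable dot h rho &
      (\sum_(0 <= k <oo) (rip (rho (h k)) (h k))%:E = 1)%E].
Proof.
have [h [eh toth]] := orthonormal_basis_enum dotH Hsep state_hbasis.
have htr : (\sum_(0 <= k <oo) (rip (rho (h k)) (h k))%:E = 1)%E.
  case: rho_state => _ _ <-; rewrite /tr (trace_ge0 eh) //.
    by move=> e; rewrite lee_fin; exact: (pos_rip_ge0 state_pos).
  by rewrite -[expect _ _ _]/(rip (rho 0) 0) linear0 rip0l.
exists h => //; split => //; split; first exact: state_pos.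
  by case: rho_state => /(continuous_bounded dotH)[M _ hM] _ _; exists M.
by rewrite htr ltry.
Qed.

Local Notation B := (eigenbasis dot rho).

Lemma state_eigenbasis : exists2 b : nat -> H, enumerates dot b B &
  [/\ total dot b, forall k, rho (b k) = (rip (rho (b k)) (b k))%:C *: b k &
      (\sum_(0 <= k <oo) (rip (rho (b k)) (b k))%:E = 1)%E].
Proof.
have [h eh [toth trh sumh]] := state_enum.
have [oB eB] := eigenbasisP dotH Hsep eh.1 toth trh.
have [b [eb btot]] := orthonormal_basis_enum dotH Hsep oB.
exists b => //; split=> //.
  move=> k; have [->|] := enumerates_in k eb; first by rewrite linear0 scaler0.
  exact: (eigenbasis_lam dotH Hsep eh.1 toth trh).
rewrite -sumh -(eigenbasis_trace dotH Hsep eh.1 toth trh) (esum_enum eb) //.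
  by move=> x; rewrite lee_fin (pos_rip_ge0 state_pos).
by rewrite linear0 rip0l.
Qed.

(** The eigenvalues lie in [0, 1], so the diagonal operator built on the eigenbasis is defined
    everywhere and coincides with rho. *)
Lemma state_spectral : exists E, is_spectral_measure dot (everywhere rho) E.
Proof.
have [b eb [btot rb sumb]] := state_eigenbasis.
pose l k := rip (rho (b k)) (b k).
have l0 k : 0 <= l k by exact: (pos_rip_ge0 state_pos).
have l1 k : l k <= 1.
  rewrite -lee_fin -sumb (@nneseriesD1 _ _ k xpredT) //.
    by rewrite leeDl // nneseries_ge0 // => j _ _; rewrite lee_fin l0.
  by move=> j _; rewrite lee_fin l0.
have dT x : diag_dom dot b l x.
  by apply: (diag_dom_bounded dotH eb.1 btot (M := 1)) => k; rewrite expr_le1.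
exists (diag_pvm dot b l); apply: (diag_spectral_measure dotH eb.1 btot l0).
  by apply/seteqP; split => // x _; exact: dT.
move=> x _; apply/esym/(diag_unique dotH eb.1 btot (dT x)) => k.
by rewrite (pos_sym state_pos) rb dotZr conjc_real.
Qed.

End States.

(** * Growth of partition functions *)

Section RootLimit.
Context (R : realType).
Implicit Types (T U : R -> \bar R) (b c : R).

Definition root_limit T : Prop := (T b `^ b)%E @[b --> (0:R)^'+] --> 1%:E.

Lemma expR_cvg1 (f : R -> R) : f b @[b --> (0:R)^'+] --> (0:R) ->
  (expR (f b))%:E @[b --> (0:R)^'+] --> 1%:E.
Proof.
move=> f0; apply: cvg_EFin; first exact: nearW.
by rewrite -expR0; apply: (cvg_comp _ _ f0); exact: continuous_expR.
Qed.

Lemma cvg_mulr0 c : (b * c) @[b --> (0:R)^'+] --> (0:R).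
Proof.
apply: cvg_at_right_filter; rewrite -[X in _ --> X](mul0r c).
by apply: cvgM; [exact: cvg_id|exact: cvg_cst].
Qed.

Lemma root_limit_cst c : 0 < c -> root_limit (cst c%:E).
Proof.
move=> c0; rewrite /root_limit /=.
under eq_fun do rewrite /powR gt_eqF //.
exact: (expR_cvg1 (cvg_mulr0 _)).
Qed.

Lemma root_limit_powR c : 0 < c -> root_limit (fun b => (c `^ b)%:E).
Proof.
move=> c0; rewrite /root_limit /=.
under eq_fun do rewrite -powRrM /powR gt_eqF //.
under eq_fun do rewrite -mulrA.
have h : (b * (b * ln c)) @[b --> (0:R)^'+] --> (0 * 0 : R).
  by apply: cvgM (cvg_mulr0 _); apply: cvg_at_right_filter; exact: cvg_id.
by rewrite mulr0 in h; exact: expR_cvg1.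
Qed.

Lemma poweR_le (x y : \bar R) b : (0 <= b)%R -> (0 <= x)%E -> (x <= y)%E ->
  (x `^ b <= y `^ b)%E.
Proof.
move=> b0 x0 xy; apply: gt0_ler_poweR => //.
  by rewrite in_itv /= x0 leey.
by rewrite in_itv /= (le_trans x0 xy) leey.
Qed.

(** The constant c is enough from below because c^b tends to 1; thus the limit passes to every
    smaller function that stays away from 0. *)
Lemma root_limit_squeeze T U c : 0 < c ->
  (\forall b \near (0:R)^'+, (c%:E <= T b <= U b)%E) -> root_limit U -> root_limit T.
Proof.
move=> c0 cTU lU; apply: squeeze_cvge (root_limit_cst c0) lU.
near=> b.
have b0 : 0 <= b by apply: ltW; near: b; exact: nbhs_right_gt.
have /andP[h1 h2] : (c%:E <= T b <= U b)%E by near: b.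
have c0' : (0 <= c%:E)%E by rewrite lee_fin ltW.
by rewrite !poweR_le // (le_trans c0').
Unshelve. all: by end_near. Qed.

Lemma root_limitM T U : (\forall b \near (0:R)^'+, (0 <= T b)%E) ->
  (\forall b \near (0:R)^'+, (0 <= U b)%E) ->
  root_limit T -> root_limit U -> root_limit (fun b => T b * U b)%E.
Proof.
move=> T0 U0 lT lU; have : (T b `^ b * U b `^ b)%E @[b --> (0:R)^'+] --> (1%:E * 1%:E)%E.
  exact: cvgeM.
rewrite mul1e; apply: cvg_trans; apply: near_eq_cvg.
near=> b; rewrite poweRM //; [by near: b|by near: b].
Unshelve. all: by end_near. Qed.

(* As A, C >= c > 0, the sum A + C is at most (2 / c) A C. *)
Lemma root_limitD T U c : 0 < c ->
  (\forall b \near (0:R)^'+, (c%:E <= T b)%E) ->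
  (\forall b \near (0:R)^'+, (c%:E <= U b)%E) ->
  root_limit T -> root_limit U -> root_limit (fun b => T b + U b)%E.
Proof.
move=> c0 hT hU lT lU.
have ge0 V : (\forall b \near (0:R)^'+, (c%:E <= V b)%E) ->
    \forall b \near (0:R)^'+, (0 <= V b)%E.
  by apply: filterS => b; apply: le_trans; rewrite lee_fin ltW.
apply: (@root_limit_squeeze _ (fun b => (2 / c)%:E * (T b * U b))%E c c0).
  near=> b.
  have hTb : (c%:E <= T b)%E by near: b.
  have hUb : (c%:E <= U b)%E by near: b.
  have T0 : (0 <= T b)%E by near: b; exact: ge0.
  have U0 : (0 <= U b)%E by near: b; exact: ge0.
  have c1 : (0 <= c^-1%:E)%E by rewrite lee_fin invr_ge0 ltW.
  have cE x : (x = c^-1%:E * (c%:E * x))%E by rewrite muleA -EFinM mulVf ?gt_eqF // mul1e.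
  rewrite (le_trans hTb) ?leeDl //= mulrDl mul1r EFinD ge0_muleDl //.
  rewrite {1}(cE (T b)) {1}(cE (U b)); apply: leeD; apply: lee_wpmul2l => //.
    by rewrite muleC; exact: lee_wpmul2l.
  exact: lee_wpmul2r.
apply: (@root_limitM (cst (2 / c)%:E)).
- by near=> b; rewrite lee_fin divr_ge0 // ltW.
- near=> b; apply: mule_ge0; [by near: b; exact: ge0|by near: b; exact: ge0].
- exact/root_limit_cst/divr_gt0.
- by apply: root_limitM => //; exact: ge0.
Unshelve. all: by end_near. Qed.

Lemma root_limit_lty T : root_limit T -> \forall b \near (0:R)^'+, (T b < +oo)%E.
Proof.
move=> lT; have h : \forall b \near (0:R)^'+, (T b `^ b \is a fin_num)%E.
  by have /fine_cvgP[] := lT.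
near=> b.
have b0 : 0 < b by near: b; exact: nbhs_right_gt.
apply: (@lty_poweRy _ _ b); rewrite ?gt_eqF // ltey_eq.
by apply/orP; left; near: b.
Unshelve. all: by end_near. Qed.

(** The limit yields finiteness only for small parameters; the terms decrease in b, which extends it
    to all b > 0. This serves the parameter 1 of the Gibbs state and the traces of its powers. *)
Lemma root_limit_series_lty (g c : nat -> R) :
  (forall i, 0 <= g i) -> (forall i, 0 <= c i) ->
  root_limit (fun b => \sum_(0 <= i <oo) (expR (- b * g i) * c i)%:E)%E ->
  forall b, 0 < b -> (\sum_(0 <= i <oo) (expR (- b * g i) * c i)%:E < +oo)%E.
Proof.
move=> g0 c0 /root_limit_lty h b b0.
near (0:R)^'+ => a.
have ab : a <= b by near: a; exact: nbhs_right_le.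
apply: (@le_lt_trans _ _ (\sum_(0 <= i <oo) (expR (- a * g i) * c i)%:E)%E); last by near: a.
apply: lee_nneseries => [i _ _|i _]; first by rewrite lee_fin mulr_ge0 ?expR_ge0.
by rewrite lee_fin ler_wpM2r // ler_expR !mulNr lerN2 ler_wpM2r.
Unshelve. all: by end_near. Qed.

Lemma sum_inv_sqr_lty : (\sum_(0 <= i <oo) ((i.+1%:R ^+ 2)^-1 : R)%:E < +oo)%E.
Proof.
apply: (@le_lt_trans _ _ 2%:E); last exact: ltry.
apply: lime_le; first by apply: is_cvg_nneseries => i _ _; rewrite lee_fin invr_ge0 sqr_ge0.
apply: nearW => -[|n]; rewrite sumEFin lee_fin; first by rewrite big_geq.
(* Telescoping: with x = n + 1 the induction step has the slack 1 / (x (x + 1)^2). *)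
suff : \sum_(0 <= i < n.+1) (i.+1%:R ^+ 2)^-1 <= 2 - n.+1%:R^-1 :> R.
  by move/le_trans; apply; rewrite lerBlDr lerDl invr_ge0.
elim: n => [|n ih]; first by rewrite big_nat1 expr1n invr1; lra.
rewrite big_nat_recr //= (le_trans (lerD ih (lexx _))) //.
rewrite -addrA lerD2l -[n.+2]addn1 natrD.
have : 0 < n.+1%:R :> R by rewrite ltr0n.
move: (n.+1%:R : R) => x x0; rewrite -subr_ge0.
have -> : - (x + 1)^-1 - (- x^-1 + ((x + 1) ^+ 2)^-1) = (x * (x + 1) ^+ 2)^-1.
  by field; rewrite !gt_eqF // addr_gt0.
by rewrite invr_ge0 mulr_ge0 ?sqr_ge0 // ltW.
Qed.

(* For L <= (2/b)^(1/(q-1)) the right-hand side exceeds 2 L through its second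
   term, for larger L through its first one. *)
Lemma powR_linear_bound (q b L : R) : 1 < q -> 0 < b -> 0 <= L ->
  2 * L <= b * L `^ q + 2 * (2 / b) `^ (q - 1)^-1.
Proof.
move=> q1 b0 L0; have q10 : 0 < q - 1 by rewrite subr_gt0.
have [Lm|mL] := leP L ((2 / b) `^ (q - 1)^-1).
  by rewrite -[leLHS]add0r lerD // ?ler_pM2l // mulr_ge0 ?powR_ge0 // ltW.
rewrite -[leLHS]addr0 lerD // ?mulr_ge0 ?powR_ge0 //.
have Lp : 0 < L by rewrite (le_lt_trans _ mL) ?powR_ge0.
have -> : L `^ q = L * L `^ (q - 1).
  rewrite -{2}[L]powRr1 // -powRD; first by congr (_ `^ _); ring.
  by rewrite (gt_eqF Lp) implybT.
rewrite mulrCA [leLHS]mulrC ler_pM2l // mulrC -ler_pdivrMr //.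
have -> : 2 / b = ((2 / b) `^ (q - 1)^-1) `^ (q - 1).
  by rewrite -powRrM mulVf ?gt_eqF // powRr1 // divr_ge0 // ltW.
by rewrite ge0_ler_powR ?nnegrE ?powR_ge0 // ltW.
Qed.

(** With L = ln (i + 1), [powR_linear_bound] gives e^(-b L^q) <= e^(K b) / (i + 1)^2, so the sum is
    at most e^(K b) S. Here b K(b) is a constant times b^((q - 2) / (q - 1)), which tends to 0
    because q > 2. The term of index 0 is 1, a lower bound. *)
Lemma root_limit_ln_powR (q : R) : 2 < q ->
  root_limit (fun b => \sum_(0 <= i <oo) (expR (- b * ln i.+1%:R `^ q))%:E)%E.
Proof.
move=> q2; have q1 : 1 < q by rewrite (lt_trans _ q2) // ltr1n.
have q10 : 0 < q - 1 by rewrite subr_gt0.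
pose K b := 2 * (2 / b) `^ (q - 1)^-1 : R.
pose S := fine (\sum_(0 <= i <oo) ((i.+1%:R ^+ 2)^-1 : R)%:E)%E.
have t0 i : (0 <= ((i.+1%:R ^+ 2)^-1 : R)%:E)%E by rewrite lee_fin invr_ge0 sqr_ge0.
have SE : (\sum_(0 <= i <oo) ((i.+1%:R ^+ 2)^-1 : R)%:E)%E = S%:E.
  by rewrite fineK // ge0_fin_numE ?sum_inv_sqr_lty // nneseries_ge0.
have S0 : 0 < S.
  rewrite -lte_fin -SE; apply: (@lt_le_trans _ _ 1%:E) => //.
  rewrite (@nneseriesD1 _ _ 0%N xpredT) // expr1n invr1 leeDl // nneseries_ge0.
    by [].
  by move=> *; exact: t0.
apply: (@root_limit_squeeze _ (fun b => (expR (K b))%:E * S%:E)%E 1) => //.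
- near=> b.
  have b0 : 0 < b by near: b; exact: nbhs_right_gt.
  have e0 i : (0 <= (expR (- b * ln i.+1%:R `^ q))%:E)%E by rewrite lee_fin expR_ge0.
  apply/andP; split.
    rewrite (@nneseriesD1 _ _ 0%N xpredT) // ln1 powR0 ?mulr0 ?expR0; last first.
      by rewrite gt_eqF // (lt_trans _ q1).
    by rewrite leeDl // nneseries_ge0.
  rewrite -SE -nneseriesZl //; apply: lee_nneseries => // i _.
  rewrite lee_fin -[X in _ <= _ * X](@lnK _ (i.+1%:R ^+ 2)^-1).
    rewrite -expRD ler_expR lnV ?posrE ?exprn_gt0 // lnXn //.
    have := powR_linear_bound q1 b0 (ln_ge0 (_ : 1 <= i.+1%:R)); rewrite ler1n /K => /(_ isT).
    by rewrite mulr_natl; lra.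
  by rewrite posrE invr_gt0 exprn_gt0.
- apply: (@root_limitM (fun b => (expR (K b))%:E) (cst S%:E)).
  + by near=> b; rewrite lee_fin expR_ge0.
  + by near=> b; rewrite lee_fin ltW.
  + have hK : (b * K b) @[b --> (0:R)^'+] --> (0:R).
      have : (2 * 2 `^ (q - 1)^-1 * b `^ ((q - 2) / (q - 1))) @[b --> (0:R)^'+] -->
          2 * 2 `^ (q - 1)^-1 * 0.
        by apply: cvgMl_tmp; apply: powR_cvg0; rewrite divr_gt0 // subr_gt0.
      rewrite mulr0; apply: cvg_trans; apply: near_eq_cvg; near=> b.
      have b0 : 0 < b by near: b; exact: nbhs_right_gt.
      rewrite /K powRM // ?invr_ge0 ?ltW //.
      rewrite mulrCA -!mulrA; congr (_ * _); rewrite mulrCA; congr (_ * _).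
      rewrite -[b^-1]powR_inv1 ?ltW // -powRrM -{2}[b]powRr1 ?ltW // -powRD ?(gt_eqF b0) ?implybT //.
      by congr (_ `^ _); field; rewrite gt_eqF.
    have := expR_cvg1 hK; apply: cvg_trans; apply: near_eq_cvg; near=> b => /=.
    by rewrite /powR gt_eqF ?expR_gt0 // expRK.
  + exact: root_limit_cst.
Unshelve. all: by end_near. Qed.

(* The FA-property for eigenvalues w indexed by a subset P of any type, so that
   it can be carried along the bijection between the positive terms of
   eigenvalue_seq and the eigenbasis. *)
Definition FA (I : choiceType) (P : set I) (w : I -> R) : Prop := exists g : I -> R,
  [/\ forall i, 0 <= g i, (\esum_(i in P) (w i * g i)%:E < +oo)%E &
      root_limit (fun b => \esum_(i in P) (expR (- b * g i))%:E)%E].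

Lemma FA_set_bij (I J : choiceType) (P : set I) (Q : set J) v w (f : I -> J) :
  set_bij P Q f -> (forall i, P i -> v i = w (f i)) -> FA P v <-> FA Q w.
Proof.
move=> bf vw; split=> -[g [g0 lg rg]].
  pose h j := if pselect (exists i, P i /\ f i = j) is left ex then g (sval (cid ex)) else 0.
  have hf i : P i -> h (f i) = g i.
    move=> Pi; rewrite /h; case: pselect => [ex|[]]; last by exists i.
    case: cid => j /= [Pj fj]; congr g; case: bf => _ inj _.
    by apply: inj; rewrite ?inE.
  exists h; split => [j||].
  - by rewrite /h; case: pselect => [ex|//]; exact: g0.
  - rewrite (@reindex_esum R I J P Q f _ bf); move: lg; congr (_ < _)%E.
    by apply: eq_esum => i Pi; rewrite hf // vw.
  - congr root_limit: rg; apply/funext => b; rewrite (@reindex_esum R I J P Q f _ bf).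
    by apply: eq_esum => i Pi; rewrite hf.
exists (g \o f); split => [i||].
- exact: g0.
- rewrite (@eq_esum _ _ _ _ (fun i => (w (f i) * g (f i))%:E)) => [|i Pi]; last first.
    by rewrite /= vw.
  by rewrite -(@reindex_esum R I J P Q f (fun j => (w j * g j)%:E) bf).
- by congr root_limit: rg; apply/funext => b; rewrite (@reindex_esum R I J P Q f _ bf).
Qed.

Lemma esum_lb (I : choiceType) (P : set I) (a : I -> \bar R) i : P i ->
  (forall j, (0 <= a j)%E) -> (a i <= \esum_(j in P) a j)%E.
Proof.
move=> Pi a0; rewrite -(@esum_set1 _ _ i a) //.
by apply: esum_ge; exists [set i]; rewrite ?esum_fset //; split; [exact: finite_set1|move=> _ ->].
Qed.

(** The lower bound that [root_limit_squeeze] asks for: as soon as b <= 1, a single term is at least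
    e^(-g i). *)
Lemma root_limit_esum_lb (I : choiceType) (P : set I) (g : I -> R) i : P i ->
  (forall j, 0 <= g j) -> \forall b \near (0:R)^'+,
    ((expR (- g i))%:E <= \esum_(j in P) (expR (- b * g j))%:E)%E.
Proof.
move=> Pi g0; near=> b.
have b0 : 0 < b by near: b; exact: nbhs_right_gt.
have b1 : b <= 1 by near: b; exact: nbhs_right_le.
have e0 j : (0 <= (expR (- b * g j))%:E)%E by rewrite lee_fin expR_ge0.
rewrite (le_trans _ (esum_lb Pi e0)) // lee_fin ler_expR mulNr lerN2.
by rewrite ler_piMl.
Unshelve. all: by end_near. Qed.

Lemma root_limit_esum (I : choiceType) (P : set I) (g : I -> R) U : P !=set0 ->
  (forall i, 0 <= g i) ->
  (\forall b \near (0:R)^'+, (\esum_(i in P) (expR (- b * g i))%:E <= U b)%E) ->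
  root_limit U -> root_limit (fun b => \esum_(i in P) (expR (- b * g i))%:E)%E.
Proof.
move=> [k Pk] g0 hU; apply: (@root_limit_squeeze _ _ (expR (- g k)) (expR_gt0 _)).
apply: filterS2 (root_limit_esum_lb Pk g0) hU => b -> //.
Qed.

(* Energies on the kernel of rho; every power of ln above 2 would do. *)
Definition filler (i : nat) : R := ln i.+1%:R `^ 3.

Definition fill (P : set nat) (g : nat -> R) i := if `[< P i >] then g i else filler i.

(** The weights c are meant for the squared norms of basis vectors, 0 at padding indices. The part
    outside P is at most the full partition function of [filler], and two partition functions may be
    added by [root_limitD]. *)
Lemma root_limit_fill (P : set nat) (g c : nat -> R) : P !=set0 ->
  (forall i, 0 <= g i) -> (forall i, P i -> c i = 1) -> (forall i, 0 <= c i <= 1) ->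
  root_limit (fun b => \esum_(i in P) (expR (- b * g i))%:E)%E ->
  root_limit (fun b => \sum_(0 <= i <oo) (expR (- b * fill P g i) * c i)%:E)%E.
Proof.
move=> [k Pk] g0 c1 c01 rg.
have e0 (h : nat -> R) i : (0 <= (expR (h i))%:E)%E by rewrite lee_fin expR_ge0.
have hk := root_limit_esum_lb Pk g0.
apply: (@root_limit_squeeze _ (fun b => \esum_(i in P) (expR (- b * g i))%:E +
    \sum_(0 <= i <oo) (expR (- b * filler i))%:E)%E (expR (- g k))) => //.
- exact: expR_gt0.
- near=> b.
  have t0 i : (0 <= (expR (- b * fill P g i) * c i)%:E)%E.
    by rewrite lee_fin mulr_ge0 ?expR_ge0 //; have /andP[] := c01 i.
  rewrite !nneseries_esumT // [X in (_ <= X <= _)%E](esumID P) // !setTI.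
  have -> : (\esum_(i in P) (expR (- b * fill P g i) * c i)%:E =
             \esum_(i in P) (expR (- b * g i))%:E)%E.
    by apply: eq_esum => i Pi; rewrite c1 // mulr1 /fill asboolT.
  apply/andP; split.
    apply: (@le_trans _ _ (\esum_(i in P) (expR (- b * g i))%:E)%E); first by near: b.
    by rewrite leeDl // esum_ge0.
  apply: leeD => //; rewrite [leRHS](esumID P) // !setTI.
  rewrite -[leLHS]add0e leeD ?esum_ge0 //; apply: le_esum => i Pi.
  rewrite lee_fin /fill asboolF // ler_piMr ?expR_ge0 //.
  by have /andP[] := c01 i.
- apply: (@root_limitD _ _ (expR (- g k))); rewrite ?expR_gt0 //.
  + near=> b; rewrite (@nneseriesD1 _ _ 0%N xpredT) // /filler ln1 powR0 ?mulr0 ?expR0 //.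
    apply: (@le_trans _ _ 1%:E); last by rewrite leeDl // nneseries_ge0.
    by rewrite lee_fin -expR0 ler_expR oppr_le0.
  + by apply: root_limit_ln_powR; rewrite ltr_nat.
Unshelve. all: by end_near. Qed.

End RootLimit.

(** * The FA-property in an eigenbasis *)

Section EigenbasisIndex.
Context (R : realType) (H : completeNormedModType R[i])
  (dot : {dot H for Num.conj}).
Local Notation rip := (reip dot).
Local Notation n2 := (nrm2 dot).
Context (dotH : hilbert dot) (Hsep : separable_space H).
Context (rho : {linear H -> H}) (rho_state : state dot rho).
Local Notation B := (eigenbasis dot rho).
Local Notation l := (eigenvalue_seq dot rho).
Context (b : nat -> H) (eb : enumerates dot b B) (btot : total dot b)
  (rb : forall k, rho (b k) = (rip (rho (b k)) (b k))%:C *: b k)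
  (sumb : (\sum_(0 <= k <oo) (rip (rho (b k)) (b k))%:E = 1)%E).
Local Notation lam := (fun k => rip (rho (b k)) (b k)).
Local Notation K := [set k | 0 < rip (rho (b k)) (b k)].

Lemma lam_ge0 k : 0 <= lam k.
Proof. exact: (pos_rip_ge0 (state_pos rho_state)). Qed.

Lemma lam_le1 k : lam k <= 1.
Proof.
rewrite -lee_fin -sumb (@nneseriesD1 _ _ k xpredT) //.
  by rewrite leeDl // nneseries_ge0 // => j _ _; rewrite lee_fin lam_ge0.
by move=> j _; rewrite lee_fin lam_ge0.
Qed.

Lemma lam_neq0 k : 0 < lam k -> b k != 0.
Proof. by apply: contraTneq => ->; rewrite linear0 rip0l ltxx. Qed.

Lemma lam_n2 k : lam k * n2 (b k) = lam k.
Proof.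
have [->|/(on_neq0 eb.1) ->] := eqVneq (b k) 0; last by rewrite mulr1.
by rewrite linear0 rip0l mul0r.
Qed.

Lemma lam_exists : K !=set0.
Proof.
apply: contrapT => /set0P/negP/negPn/eqP K0.
have : (1 : \bar R)%E = 0%E.
  rewrite -sumb eseries0 // => k _ _; congr (_%:E); apply/eqP.
  rewrite eq_le lam_ge0 andbT leNgt; apply/negP => hk.
  by have : K k by []; rewrite K0.
by move/eqP; rewrite onee_eq0.
Qed.

Lemma esum_lam (g : nat -> R) : (forall k, 0 <= g k) ->
  (\esum_(k in K) (lam k * g k)%:E = \sum_(0 <= k <oo) (lam k * g k)%:E)%E.
Proof.
move=> g0; have t0 k : (0 <= (lam k * g k)%:E)%E by rewrite lee_fin mulr_ge0 // lam_ge0.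
rewrite nneseries_esumT // [RHS](esumID K) // !setTI [X in (_ + X)%E]esum1 ?adde0 // => k /= /negP.
by rewrite -leNgt => lk; rewrite (@le_anti _ _ (lam k) 0) ?mul0r // lk lam_ge0.
Qed.

Lemma FA_eigenbasis : FA [set i | 0 < l i] l <-> FA K lam.
Proof.
have [h eh [toth trh _]] := state_enum dotH Hsep rho_state.
have [f [bf lf]] := eigenvalue_bijection dotH Hsep eh.1 toth trh.
rewrite (FA_set_bij (w := fun e => rip (rho e) e) bf) => [|i /lf //].
apply: iff_sym; apply: (FA_set_bij (f := b)) => //; split.
- move=> k /= lk; split => //.
  by apply/eb.2; split; [exact: lam_neq0|exists k].
- by move=> i j /set_mem /lam_neq0 bi _; exact: (on_inj eb.1 bi).
- by move=> e [/eb.2[_ [k <-]] lk]; exists k.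
Qed.

Lemma eigenvalue_seq_ge0 i : 0 <= l i.
Proof.
have [h eh [toth trh _]] := state_enum dotH Hsep rho_state.
by have [_] := is_eigenvalue_seqP dotH eh.1 toth trh.
Qed.

Lemma eigenvalue_seq_exists : [set i | 0 < l i] !=set0.
Proof.
have [h eh [toth trh _]] := state_enum dotH Hsep rho_state.
have [f [[_ _ sf] lf]] := eigenvalue_bijection dotH Hsep eh.1 toth trh.
have [k lk] := lam_exists.
have [|i] := sf (b k); last by exists i.
by split => //; apply/eb.2; split; [exact: lam_neq0|exists k].
Qed.

(** The sides differ at the indices with eigenvalue 0. From left to right their terms are dropped,
    which only lowers the partition function; from right to left they receive the energies of
    [filler], at no cost in mean energy. *)
Lemma FA_property_eigenvalue : FA_property dot rho <-> FA [set i | 0 < l i] l.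
Proof.
have l0 := eigenvalue_seq_ge0; set P := [set i | 0 < l i].
have P0 : P !=set0 := eigenvalue_seq_exists.
have lP (g : nat -> R) : (forall i, 0 <= g i) ->
    (\esum_(i in P) (l i * g i)%:E = \sum_(0 <= i <oo) (l i * g i)%:E)%E.
  move=> g0; have t0 k : (0 <= (l k * g k)%:E)%E by rewrite lee_fin mulr_ge0.
  rewrite nneseries_esumT // [RHS](esumID P) // !setTI [X in (_ + X)%E]esum1 ?adde0 // => k /= /negP.
  by rewrite -leNgt => lk; rewrite (@le_anti _ _ (l k) 0) ?mul0r // lk l0.
split=> -[g [g0 lg rg]].
  exists g; split => //; first by rewrite lP.
  apply: (root_limit_esum P0 g0 _ rg); near=> c.
  have t0 k : (0 <= (expR (- c * g k))%:E)%E by rewrite lee_fin expR_ge0.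
  rewrite nneseries_esumT // [leRHS](esumID P) // !setTI.
  by rewrite leeDl // esum_ge0.
have f0 i : 0 <= fill P g i by rewrite /fill /filler; case: ifP => // _; exact: powR_ge0.
exists (fill P g); split=> //.
  rewrite -lP //; move: lg; congr (_ < _)%E; apply: eq_esum => i Pi.
  by rewrite /fill asboolT.
have := root_limit_fill (c := fun=> 1) P0 g0 (fun i _ => erefl) _ rg.
rewrite lexx ler01 => /(_ (fun=> isT)); congr root_limit; apply/funext => c.
by apply: eq_eseriesr => i _; rewrite mulr1.
Unshelve. all: by end_near. Qed.

Lemma FA_propertyP : FA_property dot rho <-> FA K lam.
Proof. by rewrite FA_property_eigenvalue FA_eigenbasis. Qed.

(** The powers of the logarithm serve as the energies themselves. *)
Lemma FA_property_ln q : 2 < q ->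
  (\sum_(0 <= i <oo) (l i * ln (i.+1%:R) `^ q)%:E < +oo)%E -> FA_property dot rho.
Proof.
move=> q2 hl; exists (fun i => ln i.+1%:R `^ q); split=> //.
  by move=> i; exact: powR_ge0.
exact: root_limit_ln_powR.
Qed.

End EigenbasisIndex.

(** * Condition (ii) *)

Section Jensen.
Context d (T : measurableType d) (R : realType) (mu : {measure set T -> \bar R}).
Context (D : set T) (mD : measurable D) (muD : mu D = 1%E) (f : T -> R)
  (mf : measurable_fun [set: T] f) (f0 : forall t, D t -> 0 <= f t).

(** The tangent of t -> e^(-c t) at m lies below the graph. Its linear term is moved to the other
    side, so that only nonnegative functions are integrated. *)
Lemma jensen_expR (m c : R) : 0 <= c -> (\int[mu]_(t in D) (f t)%:E = m%:E)%E ->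
  ((expR (- c * m))%:E <= \int[mu]_(t in D) (expR (- c * f t))%:E)%E.
Proof.
move=> c0 hm; set e := expR (- c * m); have e0 : 0 < e by exact: expR_gt0.
have mfD : measurable_fun D f by exact: measurable_funTS.
have mE : measurable_fun D (fun t => (expR (- c * f t))%:E).
  by apply/measurable_EFinP; apply: measurableT_comp => //; exact: measurable_funM.
have m0 : 0 <= m by rewrite -lee_fin -hm integral_ge0 // => t Dt; rewrite lee_fin f0.
have tangent t : e * (1 + c * m) <= expR (- c * f t) + e * c * f t.
  have := expR_ge1Dx (- c * f t + c * m).
  rewrite -(ler_pM2l e0) [X in _ <= X](_ : _ = expR (- c * f t)) => [|]; first by lra.
  by rewrite /e -expRD; congr expR; ring.
have : (\int[mu]_(t in D) (e * (1 + c * m))%:E <=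
        \int[mu]_(t in D) ((expR (- c * f t))%:E + (e * c)%:E * (f t)%:E))%E.
  apply: ge0_le_integral => //.
  - by move=> t Dt; rewrite lee_fin mulr_ge0 ?addr_ge0 ?mulr_ge0 // ltW.
  - by apply: emeasurable_funD => //; apply: measurable_funeM; exact/measurable_EFinP.
  - by move=> t Dt; rewrite -EFinM -EFinD lee_fin tangent.
rewrite integral_cst // muD mule1 ge0_integralD //; first last.
- by apply: measurable_funeM; exact/measurable_EFinP.
- by move=> t Dt; rewrite -EFinM lee_fin !mulr_ge0 ?f0 // ltW.
rewrite ge0_integralZl //; first last.
- by rewrite lee_fin mulr_ge0 // ltW.
- exact/measurable_EFinP.
rewrite hm -EFinM mulrDr mulr1 mulrA EFinD.
by rewrite leeD2rE.
Qed.

End Jensen.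

Section Hamiltonian.
Context (R : realType) (H : completeNormedModType R[i])
  (dot : {dot H for Num.conj}).
Local Notation rip := (reip dot).
Local Notation n2 := (nrm2 dot).
Context (dotH : hilbert dot) (Hsep : separable_space H).
Context (rho : {linear H -> H}) (rho_state : state dot rho).
Context (h : nat -> H) (hh : enumerates dot h (hbasis dot)) (htot : total dot h).
Context (b : nat -> H) (eb : enumerates dot b (eigenbasis dot rho)) (btot : total dot b)
  (rb : forall k, rho (b k) = (rip (rho (b k)) (b k))%:C *: b k)
  (sumb : (\sum_(0 <= k <oo) (rip (rho (b k)) (b k))%:E = 1)%E).
Local Notation lam := (fun k => rip (rho (b k)) (b k)).
Local Notation K := [set k | 0 < rip (rho (b k)) (b k)].

(* Y k is the energy of b k, possibly infinite where lam k = 0. *)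
Lemma FA_intro (Y : nat -> \bar R) (W : R -> nat -> \bar R) : (forall k, (0 <= Y k)%E) ->
  (\sum_(0 <= k <oo) (lam k)%:E * Y k < +oo)%E -> (forall c k, (0 <= W c k)%E) ->
  (forall c k m, 0 < c -> K k -> Y k = m%:E -> ((expR (- c * m))%:E <= W c k)%E) ->
  root_limit (fun c => \sum_(0 <= k <oo) W c k)%E -> FA K lam.
Proof.
move=> Y0 hY W0 YW rW.
have l0 k : (0 <= (lam k)%:E)%E by rewrite lee_fin (lam_ge0 rho_state).
have Yfin k : K k -> Y k = (fine (Y k))%:E.
  move=> lk; rewrite fineK // ge0_fin_numE //.
  have : ((lam k)%:E * Y k < +oo)%E.
    apply: le_lt_trans hY; rewrite (@nneseriesD1 _ _ k xpredT) //.
      by rewrite leeDl // nneseries_ge0 // => j _ _; exact: mule_ge0.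
    by move=> j _; exact: mule_ge0.
  by rewrite !ltey; apply: contra => /eqP ->; rewrite gt0_muley // lte_fin.
exists (fun k => fine (Y k)); split => [k||]; first exact: fine_ge0.
  rewrite (esum_lam rho_state b) => [|k]; last exact: fine_ge0.
  apply: le_lt_trans hY; apply: lee_nneseries => [k _ _|k _].
    by rewrite lee_fin mulr_ge0 ?(lam_ge0 rho_state) // fine_ge0.
  rewrite EFinM; have [lk|] := ltP 0 (lam k); first by rewrite -Yfin.
  move=> lk; have -> : lam k = 0 by apply/eqP; rewrite eq_le lk (lam_ge0 rho_state).
  by rewrite !mul0e.
apply: (root_limit_esum (lam_exists rho_state sumb) _ _ rW) => [k|].
  exact: fine_ge0.
near=> c; have c0 : 0 < c by near: c; exact: nbhs_right_gt.
rewrite nneseries_esumT // [leRHS](esumID K) // !setTI -[leLHS]adde0.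
apply: leeD; last exact: esum_ge0.
by apply: le_esum => k Kk; apply: YW => //; exact: Yfin.
Unshelve. all: by end_near. Qed.

Section MeanValue.
Context (G : operator H) (Gpos : positive_operator dot G)
  (Gex : exists E, is_spectral_measure dot G E).
Let Gsym := positive_operator_sym Gpos.
Let GE := spectral_measureP Gex.
Local Notation mu := (spectral_mu Gex).
Local Notation E := (spectral_measure dot G).

(* Tr G P_n rho is the integral of t over [0, n] for this measure, so that the
   supremum over n becomes a monotone limit. *)
Definition mixture : set R -> \bar R :=
  mseries (fun k => mscale (NngNum (lam_ge0 rho_state b k)) (mu (b k))) 0.
HB.instance Definition _ := Measure.on mixture.

Lemma mixture_integral D (f : R -> R) : measurable D -> measurable_fun [set: R] f ->
  (forall t, D t -> 0 <= f t) -> (\int[mixture]_(t in D) (f t)%:E =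
  \sum_(0 <= k <oo) (lam k)%:E * \int[mu (b k)]_(t in D) (f t)%:E)%E.
Proof.
move=> mD mf f0.
have mfE : measurable_fun D (EFin \o f).
  by apply/measurable_EFinP; exact: measurable_funTS.
rewrite /mixture ge0_integral_measure_series //.
by apply: eq_eseriesr => k _; rewrite ge0_integral_mscale.
Qed.

(** The truncated operator is bounded and positive, so [tr_mul] applies. The absolute value changes
    nothing on [0, n] and makes the integrand nonnegative everywhere. *)
Lemma mean_value_truncated n :
  tr dot (fun x => G (E `[0, n%:R]%classic (rho x))) =
  (\int[mixture]_(t in `[0%R, n%:R]) `|t|%:E)%E.
Proof.
have mS : measurable (`[0, n%:R]%classic : set R) by exact: measurable_itv.
have Sc (t : R) : `[0, n%:R]%classic t -> 0 <= t <= n%:R by rewrite /= in_itv.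
have n0 : 0 <= n%:R :> R by exact: ler0n.
have [_ Gdense _ Gnn] := Gpos.
pose A := truncation_op Gsym GE mS n0 Sc.
have := @tr_mul R H dot dotH h hh htot rho (state_pos rho_state) b eb.1 btot lam
  (lam_ge0 rho_state b) rb A (truncation_pos dotH Gsym GE Gnn Gdense mS n0 Sc) (n%:R ^+ 2)
  (truncation_bounded dotH Gsym GE Gnn Gdense mS n0 Sc).
under [X in (X < _)%E -> _]eq_eseriesr do rewrite (lam_n2 eb).
rewrite sumb => /(_ (ltry _)) ->; rewrite mixture_integral //.
apply: eq_eseriesr => k _; rewrite EFinM; congr (_ * _)%E.
rewrite (truncation_rip dotH Gsym GE Gdense mS n0 Sc).
apply: eq_integral => t; rewrite inE => /Sc /andP[t0 _]; by rewrite ger0_norm.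
Qed.

Lemma mean_valueE : mean_value dot G rho =
  (\sum_(0 <= k <oo) (lam k)%:E * \int[mu (b k)]_(t in `[0%R, +oo[) `|t|%:E)%E.
Proof.
rewrite -mixture_integral //.
have mn : measurable_fun [set: R] (fun t : R => `|t|) by exact: normr_measurable.
have F_mono : {homo (fun n => `[0, n%:R]%classic : set R) : i j / (i <= j)%N >-> (i <= j)%O}.
  by move=> i j ij; apply/subsetPset/subset_itvl; rewrite bnd_simp ler_nat.
have mF D : measurable_fun D (fun t : R => `|t|%:E).
  by apply/measurable_EFinP; exact: measurable_funTS.
have := @ge0_nondecreasing_set_cvg_integral _ _ _
  (fun n => `[0, n%:R]%classic : set R) (fun t => `|t|%:E) mixture F_mono (fun=> measurable_itv _)
  (fun=> mF _) (fun _ _ _ => normr_ge0 _).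
rewrite (_ : \bigcup_n _ = `[0, +oo[%classic) => [h1|]; last first.
  apply/seteqP; split => [t [n _]|t] /=; rewrite !in_itv /= andbT; first by case/andP.
  by move=> t0; exists (Num.bound t); rewrite //= in_itv /= t0 ltW // archi_boundP.
rewrite /mean_value.
under eq_fun do rewrite mean_value_truncated.
apply/esym/(cvg_unique _ h1); first exact: ereal_hausdorff.
apply: (@ereal_nondecreasing_cvgn R (fun n => \int[mixture]_(t in `[0%R, n%:R]) `|t|%:E)%E) => i j ij.
by apply: ge0_subset_integral => //; apply/subsetPset; exact: F_mono.
Qed.

End MeanValue.

(* With this, a limit 1 in (ii) yields a spectral measure of G without the
   spectral theorem for unbounded operators. *)
Lemma ftrace_no_spectral_measure (G : operator H) f :
  (~ exists E, is_spectral_measure dot G E) -> ftrace dot G f = 0%E.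
Proof.
move=> nE; rewrite /ftrace.
have fe x : fexpect dot G f x = 0%E.
  rewrite /fexpect (_ : spectral_measure dot G = fun=> cst 0).
    rewrite (@eq_setfun_integral _ _ mzero) ?integral_measure_zero // => S mS.
    by rewrite /scalar_measure -[expect _ _ _]/(rip 0 x) rip0l.
  by rewrite /spectral_measure; case: xgetP => // E _ hE; case: nE; exists E.
by rewrite (trace_ge0 hh) ?eseries0 // => e; rewrite fe.
Qed.

Lemma measurable_expR_scale (c : R) : measurable_fun [set: R] (fun t : R => expR (- c * t)).
Proof. by apply: measurableT_comp => //; exact: measurable_funM. Qed.

Lemma FA_hamiltonian : FA K lam -> exists G : operator H,
  [/\ positive_operator dot G, root_limit (fun c => ftrace dot G (fun t => expR (- c * t))) &
      (mean_value dot G rho < +oo)%E].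
Proof.
move=> [g [g0 lg rg]]; pose g' := fill K g.
have g'0 k : 0 <= g' k by rewrite /g' /fill /filler; case: ifP => // _; exact: powR_ge0.
have Gpos := diag_positive_operator dotH eb.1 btot g'0.
have Gex : exists E, is_spectral_measure dot (diag_operator dot b g') E.
  by eexists; apply: (diag_spectral_measure dotH eb.1 btot g'0).
have Gsym := positive_operator_sym Gpos.
have bdom k := diag_dom_b eb.1 g' k.
have Gb k := diag_b dotH eb.1 btot g' k.
exists (diag_operator dot b g'); split => //.
  have K0 := lam_exists rho_state sumb.
  have c1 k : K k -> n2 (b k) = 1 by move=> /lam_neq0 /(on_neq0 eb.1).
  have c01 k : 0 <= n2 (b k) <= 1.
    by rewrite (on_n2 eb.1); case: (_ != _); rewrite ?lexx ?ler01.
  have := root_limit_fill K0 g0 c1 c01 rg.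
  congr root_limit; apply/funext => c; apply/esym.
  apply: (ftrace_diag dotH Gsym Gex hh htot eb.1 btot bdom Gb).
    exact: measurable_expR_scale.
  by move=> k; exact: expR_ge0.
rewrite (mean_valueE Gpos Gex).
apply: (@le_lt_trans _ _ (\sum_(0 <= k <oo) (lam k * g' k)%:E)%E); last first.
  rewrite -(esum_lam rho_state b g'0); move: lg; congr (_ < _)%E.
  by apply: eq_esum => k Kk; rewrite /g' /fill asboolT.
have mn : measurable_fun [set: R] (fun t : R => `|t|) by exact: normr_measurable.
apply: lee_nneseries => [k _ _|k _].
  by rewrite mule_ge0 ?lee_fin ?(lam_ge0 rho_state) // integral_ge0.
have [b0|bn0] := eqVneq (b k) 0.
  by rewrite b0 linear0 rip0l mul0e mul0r.
rewrite EFinM; apply: lee_wpmul2l; first by rewrite lee_fin (lam_ge0 rho_state).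
have -> : ((g' k)%:E = fexpect dot (diag_operator dot b g') (fun t => `|t|)%R (b k))%E.
  rewrite (fexpect_eigenvector Gsym Gex mn (bdom k) (Gb k)) ?(on_neq0 eb.1) //.
  by rewrite ger0_norm.
rewrite (fexpectE Gex); apply: ge0_subset_integral => //; exact/measurable_EFinP.
Qed.

(** The energy of b_k is the first moment of the spectral measure at b_k, which makes sense also for
    b_k outside the domain of G; [mean_valueE] expresses Tr G rho by these moments. *)
Lemma hamiltonian_FA (G : operator H) : positive_operator dot G ->
  root_limit (fun c => ftrace dot G (fun t => expR (- c * t))) ->
  (mean_value dot G rho < +oo)%E -> FA K lam.
Proof.
move=> Gpos rG mG.
have Gsym := positive_operator_sym Gpos.
have [Gex|nE] := pselect (exists E, is_spectral_measure dot G E); last first.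
  have : root_limit (fun _ : R => 0%E).
    by move: rG; congr root_limit; apply/funext => c; rewrite ftrace_no_spectral_measure.
  rewrite /root_limit => r0.
  have z0 : ((0 : \bar R) `^ c)%E @[c --> (0:R)^'+] --> 0%E.
    apply: cvg_near_cst; near=> c.
    by rewrite poweR0r // gt_eqF //; near: c; exact: nbhs_right_gt.
  have /eqP : 1%:E = 0%E :> \bar R by exact: cvg_unique r0 z0.
  by rewrite onee_eq0.
pose D : set R := `[0, +oo[%classic.
have mD : measurable D by exact: measurable_itv.
have me c : measurable_fun [set: R] (fun t : R => (expR (- c * t))%:E).
  by apply/measurable_EFinP; exact: measurable_expR_scale.
apply: (@FA_intro (fun k => \int[spectral_mu Gex (b k)]_(t in D) `|t|%:E)%E
  (fun c k => \int[spectral_mu Gex (b k)]_t (expR (- c * t))%:E)%E) => [k||c k|c k m c0 Kk Xm|].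
- exact: integral_ge0.
- by rewrite -(mean_valueE Gpos Gex).
- by apply: integral_ge0 => t _; rewrite lee_fin expR_ge0.
- apply: (@le_trans _ _ (\int[spectral_mu Gex (b k)]_(t in D) (expR (- c * t))%:E)%E); last first.
    by apply: ge0_subset_integral => // t _; rewrite lee_fin expR_ge0.
  rewrite (eq_integral (fun t : R => (expR (- c * `|t|)%R)%:E)) => [|t]; last first.
    by rewrite inE /D /= in_itv /= andbT => t0'; rewrite ger0_norm.
  apply: jensen_expR => //; last exact: ltW.
  (* G has no spectrum below 0, so the measure at b_k has its full mass 1 on D, as Jensen's
     inequality requires. *)
  have EDb : spectral_measure dot G D (b k) = b k.
    have [_ Gdense _ Gnn] := Gpos.
    rewrite (_ : D = ~` `]-oo, 0[%classic); last by rewrite /D setCitvl.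
    rewrite (pvm_C (spectral_pvm (spectral_measureP Gex))) //.
    by rewrite (positive_spectrum Gsym (spectral_measureP Gex) Gnn) subr0.
  apply: (@etrans _ _ (n2 (spectral_measure dot G D (b k)))%:E) => //.
  by rewrite EDb (on_neq0 eb.1) // (lam_neq0 Kk).
- move: rG; congr root_limit; apply/funext => c.
  by rewrite (ge0_ftrace dotH Gex hh htot eb.1 btot) //; exact: measurable_expR_scale.
Unshelve. all: by end_near. Qed.
End Hamiltonian.

(** * Condition (iii) *)

Section Gibbs.
Context (R : realType) (H : completeNormedModType R[i])
  (dot : {dot H for Num.conj}).
Local Notation rip := (reip dot).
Local Notation n2 := (nrm2 dot).
Context (dotH : hilbert dot) (Hsep : separable_space H).
Context (rho : {linear H -> H}) (rho_state : state dot rho).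
Context (h : nat -> H) (hh : enumerates dot h (hbasis dot)) (htot : total dot h).
Context (b : nat -> H) (eb : enumerates dot b (eigenbasis dot rho)) (btot : total dot b)
  (rb : forall k, rho (b k) = (rip (rho (b k)) (b k))%:C *: b k)
  (sumb : (\sum_(0 <= k <oo) (rip (rho (b k)) (b k))%:E = 1)%E).
Local Notation lam := (fun k => rip (rho (b k)) (b k)).
Local Notation K := [set k | 0 < rip (rho (b k)) (b k)].
Let Rex := state_spectral dotH Hsep rho_state.
Let Rsym := everywhere_sym (state_pos rho_state).
Let l0 := lam_ge0 rho_state b.
Let l1 := lam_le1 rho_state sumb.

Lemma measurable_xlnx : measurable_fun [set: R] (fun t : R => t * ln t).
Proof. by apply: measurable_funM => //; exact: measurable_ln. Qed.

Lemma xlnx_le0 k : lam k * ln (lam k) <= 0.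
Proof. by rewrite mulr_ge0_le0 // ln_le0. Qed.

Lemma entropyE : entropy dot rho = (\sum_(0 <= k <oo) (- (lam k * ln (lam k)))%:E)%E.
Proof.
rewrite /entropy (ftrace_diag dotH Rsym Rex hh htot eb.1 btot (fun _ => I) rb).
- by apply: eq_eseriesr => k _; rewrite mulNr -mulrA [ln _ * _]mulrC mulrA (lam_n2 eb).
- by apply: measurable_funN; exact: measurable_xlnx.
- by move=> k; rewrite oppr_ge0 xlnx_le0.
Qed.

Lemma fexpect_xlnx k : b k != 0 ->
  fexpect dot (everywhere rho) (fun t => t * ln t) (b k) = (lam k * ln (lam k))%:E.
Proof.
move=> bk0; apply: (fexpect_eigenvector Rsym Rex measurable_xlnx I (rb k)).
exact: (on_neq0 eb.1 bk0).
Qed.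

(** Apply ln y <= y - 1 at y = e^(-t) / x and multiply by x. Summed with t the energy, this bounds
    the entropy by the mean energy plus the partition function at parameter 1. *)
Lemma xlnx_ge (x t : R) : 0 <= x -> - (x * ln x) <= x * t + expR (- t).
Proof.
rewrite le_eqVlt => /predU1P[<-|x0].
  by rewrite !mul0r oppr0 add0r expR_ge0.
have := @le_ln1Dx R (expR (- t) / x - 1).
rewrite ltrBDl subrr divr_gt0 ?expR_gt0 // subrKC => /(_ isT).
rewrite lnM ?posrE ?expR_gt0 ?invr_gt0 // expRK lnV ?posrE // -(ler_pM2l x0).
have -> : x * (expR (- t) / x - 1) = expR (- t) - x by field; rewrite gt_eqF.
by rewrite mulrDr !mulrN; lra.
Qed.

Section RelativeEntropy.
Context (sigma : {linear H -> H}) (sigma_state : state dot sigma).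
Let Sex := state_spectral dotH Hsep sigma_state.
Let Ssym := everywhere_sym (state_pos sigma_state).
Definition relative_term e : \bar R :=
  (fexpect dot (everywhere rho) (fun t => t * ln t)%R e
   - (expect dot rho e)%:E * fexpect dot (everywhere sigma) (@ln R) e)%E.
Local Notation q := relative_term.

Lemma relative_term0 : q 0 = 0%E.
Proof.
rewrite /relative_term (fexpect0 Rex) ?(fexpect0 Sex) ?mule0 ?sube0 //.
exact: measurable_xlnx.
Qed.

(** The product of 0 with a possibly infinite <b_k|log sigma|b_k> is 0. *)
Lemma relative_term_ker k : ~ K k -> q (b k) = 0%E.
Proof.
rewrite /relative_term => lk; have l00 : lam k = 0.
  by apply/eqP; rewrite eq_le l0 andbT leNgt; apply/negP.
have -> : expect dot rho (b k) = 0 by exact: l00.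
rewrite mul0e sube0; have [b0|b0] := eqVneq (b k) 0.
  by rewrite b0 (fexpect0 Rex) //; exact: measurable_xlnx.
by rewrite fexpect_xlnx // l00 mul0r.
Qed.

Lemma relative_entropyE : relative_entropy dot rho sigma =
  if `[< supp rho `<=` supp sigma >] then
    (\sum_(0 <= k <oo) q^\+ (b k) - \sum_(0 <= k <oo) q^\- (b k))%E else +oo%E.
Proof.
rewrite /relative_entropy; case: ifP => // _; transitivity (usum (eigenbasis dot rho) q) => //; rewrite /usum.
rewrite !(esum_enum eb) //.
- by rewrite funenegE relative_term0 oppe0 maxxx.
- by rewrite funeposE relative_term0 maxxx.
Qed.

End RelativeEntropy.

Lemma state_le1 (sigma : {linear H -> H}) : state dot sigma -> exists c : nat -> H, exists s : nat -> R,
  [/\ on_seq dot c, total dot c, forall j, sigma (c j) = (s j)%:C *: c j &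
      forall j, 0 <= s j <= 1].
Proof.
move=> st; have [c ec [tc sc sumc]] := state_eigenbasis dotH Hsep st.
exists c, (fun j => rip (sigma (c j)) (c j)); split => // [|j]; first exact: ec.1.
by rewrite (lam_ge0 st) (lam_le1 st sumc).
Qed.

(** Let Y_k be the integral of -ln t for the spectral measure of sigma at b_k. The k-th term of the
    relative entropy is lam_k ln lam_k + lam_k Y_k, so its negative part is at most -lam_k ln lam_k,
    which is summable as H(rho) is finite. Hence the positive parts are summable, and lam_k Y_k is
    at most the positive part plus -lam_k ln lam_k. *)
Lemma gibbs_FA (sigma : {linear H -> H}) : state dot sigma ->
  (entropy dot rho < +oo)%E -> (relative_entropy dot rho sigma < +oo)%E ->
  root_limit (fun c => ftrace dot (everywhere sigma) (fun t => t `^ c)) -> FA K lam.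
Proof.
move=> st; rewrite entropyE (relative_entropyE st) => Hfin.
case: asboolP => // hsupp RE rT.
have Sex := state_spectral dotH Hsep st.
have Ssym := everywhere_sym (state_pos st).
have SE := spectral_pvm (spectral_measureP Sex).
pose D : set R := `]0, 1]%classic.
have mD : measurable D by exact: measurable_itv.
have mln : measurable_fun [set: R] (@ln R) by exact: measurable_ln.
have mNln : measurable_fun [set: R] (fun t : R => - ln t) by exact: measurable_funN.
have mpow c : measurable_fun [set: R] (fun t : R => t `^ c) by exact: measurable_powR.
have ln0 t : D t -> 0 <= - ln t.
  by rewrite /D /= in_itv /= oppr_ge0 => /andP[_]; exact: ln_le0.
pose Y k := (\int[spectral_mu Sex (b k)]_(t in D) (- ln t)%:E)%E.
have Y0 k : (0 <= Y k)%E by apply: integral_ge0 => t Dt; rewrite lee_fin ln0.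
(* The measure at b_k is carried by the eigenvalues of sigma, all in [0, 1]. The point 0 is excluded
   by the support condition: b_k lies in [supp sigma], hence is orthogonal to the kernel of sigma.
   This matters because [ln 0] is 0 here. *)
have EDb k : K k -> spectral_measure dot (everywhere sigma) D (b k) = b k.
  move=> Kk; have [c [s [oc tc sc s01]]] := state_le1 st.
  have mC := measurableC mD.
  suff h0 : spectral_measure dot (everywhere sigma) (~` D) (b k) = 0.
    by have := pvm_C SE (b k) mD; rewrite h0 => /esym/eqP; rewrite subr_eq0 => /eqP.
  apply: (@n2_eq0 _ _ dot); apply: EFin_inj.
  have := spectral_mu_diag dotH Ssym Sex oc tc (fun _ => I) sc (b k) mC.
  rewrite /spectral_mu /pvm_measure /= => ->; apply: eseries0 => j _ _.
  have /andP[s0 s1] := s01 j; move: s0; rewrite le_eqVlt => /predU1P[s0|s0].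
    suff : dot (b k) (c j) = 0 by rewrite sqE => ->; rewrite cabs2R expr0n mul0r.
    have : supp sigma (b k).
      apply: hsupp; apply: subset_closure; apply: sub_span; exists (lam k) => //.
      exact: rb.
    apply: (closure_span_orth dotH) => x [a a0 ax].
    have : a%:C * dot x (c j) = 0.
      by rewrite -dotZl -ax (pos_sym (state_pos st)) sc -s0 scale0r dot0r.
    by move/eqP; rewrite mulf_eq0 fmorph_eq0 gt_eqF // => /eqP.
  rewrite indicE (_ : s j \in ~` D = false) ?mulr0 //.
  by apply/negbTE/negP => /set_mem; apply; rewrite /D /= in_itv /= s0 s1.
have lnY k : K k -> fexpect dot (everywhere sigma) (@ln R) (b k) = (- Y k)%E.
  move=> Kk; have mlnE : measurable_fun [set: R] (EFin \o @ln R) by exact/measurable_EFinP.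
  rewrite (fexpectE Sex) -[in LHS](EDb k Kk) (pvm_restrict SE (b k) mD mlnE).
  rewrite /Y -integral_ge0N; last by move=> t Dt; rewrite lee_fin ln0.
  by apply: eq_integral => t _; rewrite -EFinN opprK.
have qY k : K k -> relative_term sigma (b k) = ((lam k * ln (lam k))%:E + (lam k)%:E * Y k)%E.
  move=> Kk; rewrite /relative_term fexpect_xlnx ?(lam_neq0 Kk) // lnY //.
  by rewrite muleN oppeK.
have lY0 k : (0 <= (lam k)%:E * Y k)%E by rewrite mule_ge0 // lee_fin l0.
have hneg k : ((relative_term sigma)^\- (b k) <= (- (lam k * ln (lam k)))%:E)%E.
  rewrite funenegE ge_max [X in _ && X]lee_fin oppr_ge0 xlnx_le0 andbT.
  have [Kk|Kk] := pselect (K k); last by rewrite relative_term_ker // oppe0 lee_fin oppr_ge0 xlnx_le0.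
  by rewrite qY // EFinN leeN2 leeDl.
have hpos : (\sum_(0 <= k <oo) (relative_term sigma)^\+ (b k) < +oo)%E.
  have n0 k : (0 <= (relative_term sigma)^\- (b k))%E by rewrite funeneg_ge0.
  have nfin : (\sum_(0 <= k <oo) (relative_term sigma)^\- (b k) \is a fin_num)%E.
    rewrite ge0_fin_numE ?nneseries_ge0 //; apply: le_lt_trans Hfin.
    by apply: lee_nneseries => k _.
  move: RE; rewrite !ltey; apply: contra => /eqP ->.
  by rewrite -(fineK nfin).
apply: (FA_intro rho_state sumb (Y := Y) (W := fun c k =>
  (\int[spectral_mu Sex (b k)]_t (t `^ c)%:E)%E)) => [//||c k|c k m c0 Kk Ym|].
- apply: (@le_lt_trans _ _ (\sum_(0 <= k <oo) ((relative_term sigma)^\+ (b k) +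
    (- (lam k * ln (lam k)))%:E))%E); last first.
    rewrite nneseriesD; first by rewrite lte_add_pinfty.
    + by move=> k _; rewrite funepos_ge0.
    + by move=> k _; rewrite lee_fin oppr_ge0 xlnx_le0.
  apply: lee_nneseries => [k _ _ //|k _].
  have [Kk|Kk] := pselect (K k); last first.
    have -> : lam k = 0 by apply/eqP; rewrite eq_le l0 andbT leNgt; apply/negP.
    by rewrite mul0e adde_ge0 ?funepos_ge0 // lee_fin mul0r oppr0.
  apply: (@le_trans _ _ (relative_term sigma (b k) + (- (lam k * ln (lam k)))%:E)%E).
    by rewrite qY // addeAC -EFinD subrr add0e.
  by rewrite leeD2r // funeposE le_max lexx.
- by apply: integral_ge0 => t _; rewrite lee_fin powR_ge0.
- have mpE : measurable_fun [set: R] (fun t : R => (t `^ c)%:E) by exact/measurable_EFinP.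
  apply: (@le_trans _ _ (\int[spectral_mu Sex (b k)]_(t in D) (t `^ c)%:E)%E); last first.
    by apply: ge0_subset_integral => // t _; rewrite lee_fin powR_ge0.
  rewrite (eq_integral (fun t : R => (expR (- c * (- ln t))%R)%:E)) => [|t]; last first.
    by rewrite inE /D /= in_itv /= mulrNN => /andP[t0 _]; rewrite /powR gt_eqF.
  apply: (jensen_expR _ _ mNln ln0) => //; last exact: ltW.
  apply: (@etrans _ _ (n2 (spectral_measure dot (everywhere sigma) D (b k)))%:E) => //.
  by rewrite EDb // (on_neq0 eb.1) // (lam_neq0 Kk).
- move: rT; congr root_limit; apply/funext => c.
  by rewrite (ge0_ftrace dotH Sex hh htot eb.1 btot) // => t; exact: powR_ge0.
Qed.

(** For sigma with eigenvalues e^(-g'_k) / Z, Tr sigma^q is Z^(-q) times the partition function at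
    q, and the factor Z^(-q) does not affect the limit. *)
Lemma FA_gibbs : FA K lam -> (entropy dot rho < +oo)%E /\
  exists sigma : {linear H -> H},
    [/\ state dot sigma, (relative_entropy dot rho sigma < +oo)%E,
        (forall q : R, 0 < q -> (ftrace dot (everywhere sigma) (fun t => t `^ q)%R < +oo)%E) &
        root_limit (fun q => ftrace dot (everywhere sigma) (fun t => t `^ q)%R)].
Proof.
move=> [g [g0 lg rg]]; pose g' := fill K g.
have g'0 k : 0 <= g' k by rewrite /g' /fill /filler; case: ifP => // _; exact: powR_ge0.
have c1 k : K k -> n2 (b k) = 1 by move=> /lam_neq0 /(on_neq0 eb.1).
have c01 k : 0 <= n2 (b k) <= 1.
  by rewrite (on_n2 eb.1); case: (_ != _); rewrite ?lexx ?ler01.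
have n0 k : 0 <= n2 (b k) by have /andP[] := c01 k.
have rT := root_limit_fill (lam_exists rho_state sumb) g0 c1 c01 rg.
have Tfin := root_limit_series_lty g'0 n0 rT.
have t0 c k : (0 <= (expR (- c * g' k) * n2 (b k))%:E)%E.
  by rewrite lee_fin mulr_ge0 ?expR_ge0.
have lg' : (\sum_(0 <= k <oo) (lam k * g' k)%:E < +oo)%E.
  rewrite -(esum_lam rho_state b g'0); move: lg; congr (_ < _)%E.
  by apply: eq_esum => k Kk; rewrite /g' /fill asboolT.
pose Z := fine (\sum_(0 <= k <oo) (expR (- 1 * g' k) * n2 (b k))%:E)%E.
have ZE : (\sum_(0 <= k <oo) (expR (- 1 * g' k) * n2 (b k))%:E)%E = Z%:E.
  by rewrite fineK // ge0_fin_numE ?Tfin // nneseries_ge0.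
have Z0 : 0 < Z.
  have [k Kk] := lam_exists rho_state sumb.
  rewrite -lte_fin -ZE (@nneseriesD1 _ _ k xpredT) //; rewrite (c1 k Kk) mulr1.
  apply: (@lt_le_trans _ _ (expR (- 1 * g' k))%:E); first by rewrite lte_fin expR_gt0.
  by rewrite leeDl // nneseries_ge0.
pose m k := expR (- g' k) / Z.
have m0 k : 0 < m k by rewrite divr_gt0 ?expR_gt0.
have m0' k : 0 <= m k by exact: ltW.
have mZ k : m k <= Z^-1.
  by rewrite ler_piMl ?invr_ge0 ?(ltW Z0) // -expR0 ler_expR oppr_le0.
have mZ2 k : m k ^+ 2 <= Z^-1 ^+ 2 by rewrite lerXn2r ?nnegrE ?invr_ge0 ?(ltW Z0).
have dT x : diag_dom dot b m x by apply: (diag_dom_bounded dotH eb.1 btot) mZ2.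
have dlin : linear (diag dot b m) by move=> a x y; apply: (diag_lin dotH eb.1 btot); exact: dT.
pose sigma : {linear H -> H} := HB.pack (diag dot b m)
  (GRing.isLinear.Build R[i] H H _ (diag dot b m) dlin).
have sb k : sigma (b k) = (m k)%:C *: b k by exact: (diag_b dotH eb.1 btot).
have spos : pos_op dot sigma by move=> x; by apply: (diag_ge0 dotH eb.1 btot).
have sbnd x : n2 (sigma x) <= Z^-1 ^+ 2 * n2 x.
  have sle y : rip (sigma y) y <= Z^-1 * n2 y.
    rewrite -lee_fin EFinM (diag_rip dotH spos eb.1 btot sb) -(parseval dotH eb.1 btot).
    rewrite -nneseriesZl; last by move=> k _; rewrite lee_fin sq_ge0.
    apply: lee_nneseries => [k _ _|k _]; first by rewrite lee_fin mulr_ge0 ?sq_ge0.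
    by rewrite -EFinM lee_fin ler_wpM2r ?sq_ge0.
  apply: (le_trans (pos_n2 spos sle x)).
  by rewrite expr2 -mulrA ler_wpM2l ?sle // invr_ge0 ltW.
have [hM hT] : (exists M, forall x, n2 (sigma x) <= M * n2 x) /\
    (\sum_(0 <= k <oo) (rip (sigma (h k)) (h k))%:E = 1)%E.
  split; first by eexists; exact: sbnd.
  rewrite (diag_trace dotH spos hh.1 htot eb.1 btot sb m0').
  under eq_eseriesr do rewrite /m -mulN1r mulrAC EFinM muleC.
  by rewrite nneseriesZl // ZE -EFinM mulVf // gt_eqF.
have sst : state dot sigma.
  split; [exact: (bounded_continuous dotH sbnd)|exact: spos|].
  rewrite /tr (trace_ge0 hh) //.
    by move=> e; rewrite lee_fin; exact: (pos_rip_ge0 spos).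
  by rewrite -[expect _ _ _]/(rip (sigma 0) 0) linear0 rip0l.
have Sex := state_spectral dotH Hsep sst.
have Ssym := everywhere_sym (state_pos sst).
have mpow c : measurable_fun [set: R] (fun t : R => t `^ c) by exact: measurable_powR.
have ftraceE q : ftrace dot (everywhere sigma) (fun t => t `^ q)%R =
    ((Z^-1 `^ q)%:E * \sum_(0 <= k <oo) (expR (- q * g' k) * n2 (b k))%:E)%E.
  rewrite (ftrace_diag dotH Ssym Sex hh htot eb.1 btot (fun=> I) sb) //.
    rewrite -nneseriesZl //; apply: eq_eseriesr => k _; rewrite -EFinM; congr (_%:E).
    rewrite /m powRM ?expR_ge0 ?invr_ge0 ?(ltW Z0) //.
    rewrite -expRM (_ : - g' k * q = - q * g' k); last by ring.
    by rewrite -mulrA mulrCA.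
  by move=> k; exact: powR_ge0.
split; last first.
  exists sigma; split => //.
  - rewrite (relative_entropyE sst) asboolT; last first.
      (* All b_k are eigenvectors of sigma with a positive eigenvalue, kernel vectors of rho
         included, so [supp sigma] is the whole space. *)
      move=> x _; apply: (in_closure_span dotH eb.1) => [k|y hy].
        by right; exists (m k); [exact: m0|exact: sb].
      by rewrite (btot hy) dot0l.
    have qfin : (\sum_(0 <= k <oo) (relative_term sigma)^\+ (b k) < +oo)%E.
      (* The term is lam ln lam + lam g' + lam ln Z, and its first summand is at most 0. *)
      apply: (@le_lt_trans _ _ (\sum_(0 <= k <oo)
          ((lam k * g' k)%:E + `|ln Z|%:E * (lam k)%:E))%E); last first.
        rewrite nneseriesD => [||k _]; [|by move=> k _; rewrite lee_fin mulr_ge0 ?l0|].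
          rewrite lte_add_pinfty // nneseriesZl ?sumb ?mule1 ?ltry //.
          by move=> k _; rewrite lee_fin l0.
        by rewrite -EFinM lee_fin mulr_ge0 // l0.
      apply: lee_nneseries => [k _ _|k _]; first by rewrite funepos_ge0.
      rewrite funeposE ge_max andbC -EFinM -EFinD lee_fin addr_ge0 ?mulr_ge0 ?l0 //=.
      have [Kk|Kk] := pselect (K k); last first.
        by rewrite relative_term_ker // lee_fin addr_ge0 ?mulr_ge0 ?l0.
      have bk1 : n2 (b k) = 1 by exact: c1.
      rewrite /relative_term fexpect_xlnx ?(lam_neq0 Kk) //.
      rewrite (fexpect_eigenvector Ssym Sex _ I (sb k)) //.
      rewrite -[expect _ _ _]/(lam k) -EFinM -EFinB lee_fin /m lnM ?posrE ?expR_gt0 ?invr_gt0 //.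
      rewrite expRK lnV ?posrE //.
      have := xlnx_le0 k; have := ler_wpM2r (l0 k) (ler_norm (ln Z)).
      by move=> h1 h2; nra.
    apply: le_lt_trans qfin; rewrite -[leRHS]sube0 leeB //.
    by apply: nneseries_ge0 => k _ _; rewrite funeneg_ge0.
  - move=> q q0; rewrite ftraceE lte_mul_pinfty ?lee_fin ?powR_ge0 // Tfin //.
  - have : root_limit (fun q => (Z^-1 `^ q)%:E *
        \sum_(0 <= k <oo) (expR (- q * g' k) * n2 (b k))%:E)%E.
      apply: root_limitM => //.
      + by near=> q; rewrite lee_fin powR_ge0.
      + by near=> q; exact: nneseries_ge0.
      + by apply: root_limit_powR; rewrite invr_gt0.
    by congr root_limit; apply/funext => q; rewrite ftraceE.
rewrite entropyE; apply: (@le_lt_trans _ _ (\sum_(0 <= k <oo)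
    ((lam k * g' k)%:E + (expR (- 1 * g' k) * n2 (b k))%:E))%E); last first.
  rewrite nneseriesD => [||k _]; last by [].
    by rewrite lte_add_pinfty // Tfin.
  by move=> k _; rewrite lee_fin mulr_ge0 ?l0.
apply: lee_nneseries => [k _ _|k _]; first by rewrite lee_fin oppr_ge0 xlnx_le0.
rewrite -EFinD lee_fin; have [Kk|Kk] := pselect (K k).
  by rewrite c1 // mulr1 mulN1r; exact: xlnx_ge.
have -> : lam k = 0 by apply/eqP; rewrite eq_le l0 andbT leNgt; apply/negP.
by rewrite !mul0r oppr0 add0r mulr_ge0 ?expR_ge0.
Unshelve. all: by end_near. Qed.

End Gibbs.

Theorem theorem1 (R : realType) (H : completeNormedModType R[i])
    (dot : {dot H for Num.conj}) (H_hilbert : hilbert dot)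
    (H_separable : separable_space H)
    (rho : {linear H -> H}) (rho_state : state dot rho) :
  let cond_i := FA_property dot rho in
  let cond_ii := exists G : operator H,
    [/\ positive_operator dot G,
        (ftrace dot G (fun t => expR (- b * t)) `^ b)%E
          @[b --> (0:R)^'+] --> 1%:E &
        (mean_value dot G rho < +oo)%E] in
  let cond_iii := (entropy dot rho < +oo)%E /\
    exists sigma : {linear H -> H},
      [/\ state dot sigma,
          (relative_entropy dot rho sigma < +oo)%E,
          (forall q : R, 0 < q ->
            (ftrace dot (everywhere sigma) (fun t => t `^ q)%R < +oo)%E) &
          (ftrace dot (everywhere sigma) (fun t => t `^ q)%R `^ q)%E
            @[q --> (0:R)^'+] --> 1%:E] in
  ((cond_i <-> cond_ii) /\ (cond_ii <-> cond_iii)) /\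
  ((exists q : R, 2 < q /\
      (\sum_(0 <= i <oo)
         (eigenvalue_seq dot rho i * ln (i.+1%:R) `^ q)%:E < +oo)%E) ->
   [/\ cond_i, cond_ii & cond_iii]).
Proof.
move=> cond_i cond_ii cond_iii.
have [h eh [htot _ _]] := state_enum H_hilbert H_separable rho_state.
have [b eb [btot rb sumb]] := state_eigenbasis H_hilbert H_separable rho_state.
have FAP := FA_propertyP H_hilbert H_separable rho_state eb sumb.
have h1 : cond_i -> cond_ii.
  by move/FAP; exact: (FA_hamiltonian H_hilbert rho_state eh htot eb btot rb sumb).
have h2 : cond_ii -> cond_i.
  case=> G [Gpos rG mG]; apply/FAP.
  exact: (hamiltonian_FA H_hilbert rho_state eh htot eb btot rb sumb Gpos rG mG).
have h3 : cond_i -> cond_iii.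
  by move/FAP; exact: (FA_gibbs H_hilbert H_separable rho_state eh htot eb btot rb sumb).
have h4 : cond_iii -> cond_i.
  case=> Hfin [sigma [st RE _ rT]]; apply/FAP.
  exact: (gibbs_FA H_hilbert H_separable rho_state eh htot eb btot rb sumb st Hfin RE rT).
split; first by split; split => // hi; [apply: h3; exact: h2|apply: h1; exact: h4].
case=> q [q2 hq]; have hi : cond_i := FA_property_ln q2 hq.
by split; [|exact: h1|exact: h3].
Qed.
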